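(* Fix $0<p<\infty$. Let $\mu$ be a nonzero finite positive Borel measure on $\mathbb{T}$ which is singular with respect to $m$ and let $$S_\mu(z)=\exp\left(-\int_{\mathbb{T}}\frac{\xi+z}{\xi-z}\,d\mu(\xi)\right),\quad z\in\mathbb{D},$$ be the corresponding singular inner function. Consider the following conditions: (1) The measure $\mu$ is supported in a $\mathcal{C}(p)$-Beurling--Carleson set. (2) $S_\mu$ has finite $\mathcal{L}(p)$-entropy, that is, $\log|S_\mu'|\in L^p(\mathbb{T})$. (3) For every $0<c<1$, the integral $$\int_{\{z\in\mathbb{D}:|S_\mu(z)|<c\}}\frac{|\log(1-|z|)|^{p-1}}{1-|z|}\,dA(z)$$ converges. (4) There exists $0<c<1$ such that the integral $$\int_{\{z\in\mathbb{D}:|S_\mu(z)|<c\}}\frac{|\log(1-|z|)|^{p-1}}{1-|z|}\,dA(z)$$ converges. (5) The measure $\mu$ is concentrated in a countable union of $\mathcal{C}(p)$-Beurling--Carleson sets. Then the implications $(1)\Rightarrow(2)\Rightarrow(3)\Rightarrow(4)\Rightarrow(5)$ hold.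
   Context: $\mathbb{D}$ is the open unit disc in $\mathbb{C}$, $\mathbb{T}$ the unit circle, $m$ the normalized Lebesgue measure on $\mathbb{T}$, $dA$ area measure; $L^p(\mathbb{T})$ is with respect to $m$. Inner functions are analytic self-mappings of $\mathbb{D}$ whose radial limits have modulus one $m$-almost everywhere on $\mathbb{T}$. For a closed set $E\subset\mathbb{T}$, $\operatorname{dist}(\xi,E)$ denotes the distance from $\xi$ to $E$. A closed subset $E\subset\mathbb{T}$ of Lebesgue measure zero is called a $\mathcal{C}(p)$-Beurling--Carleson set if $\int_{\mathbb{T}}|\log\operatorname{dist}(\xi,E)|^p\,dm(\xi)<\infty$. A measure $\mu$ is concentrated in a Borel set $F$ if $\mu(\mathbb{T}\setminus F)=0$. Angular derivative: an analytic $f:\mathbb{D}\to\mathbb{D}$ has a finite angular derivative at $\xi\in\mathbb{T}$ if $\lim_{r\to1}f(r\xi)$ exists and belongs to $\mathbb{T}$ and $\lim_{r\to1}f'(r\xi)$ exists finitely; in this case $|f'(\xi)|:=\lim_{r\to1}|f'(r\xi)|$. If $f$ does not have a finite angular derivative at $\xi$, set $|f'(\xi)|:=\infty$. An inner function $f$ has finite $\mathcal{L}(p)$-entropy if $|f'(\xi)|$ is finite at $m$-almost every $\xi\in\mathbb{T}$ and $\log|f'(\xi)|\in L^p(\mathbb{T})$. *)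

(* Defs.v *)
From HB Require Import structures.
From mathcomp Require Import all_boot all_order all_algebra.
From mathcomp Require Import all_classical all_reals all_analysis.
From mathcomp Require Import measurable_realfun complex.
Set Implicit Arguments.
Unset Strict Implicit.
Unset Printing Implicit Defensive.
Import Order.TTheory GRing.Theory Num.Theory.
Import numFieldNormedType.Exports.
Local Open Scope classical_set_scope.
Local Open Scope complex_scope.
Local Open Scope ring_scope.

(* The topology of the complex plane is the normed-module topology of [R[i]^o]
   over [R[i]].  [cmod] is the modulus with values in [R], whereas the generic
   norm [`|z|] has values in [R[i]]. *)
Notation CC R := (R[i]^o) (only parsing).
Notation cmod := complex.ComplexField.Normc.normc.

Definition unit_disc (R : realType) : set (CC R) := [set z | cmod z < 1].
Definition unit_circle (R : realType) : set (CC R) := [set z | cmod z = 1].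
Arguments unit_disc : clear implicits.
Arguments unit_circle : clear implicits.

(* Measures on the unit circle are represented by Borel measures on the plane
   that vanish outside [unit_circle]. *)
Definition borelC (R : realType) := g_sigma_algebraType (@open (CC R)).

Definition cis (R : realType) (t : R) : CC R := cos t +i* sin t.

Definition cexp (R : realType) (z : CC R) : CC R :=
  (expR (complex.Re z))%:C * cis (complex.Im z).

Section circle_measure.
Context (R : realType).

Lemma continuous_cis : continuous (@cis R).
Proof.
move=> t; apply/cvgrPdist_lt => e e0.
have [er ei] : 0 < complex.Re e /\ e = (complex.Re e)%:C.
  by move: e0; case: e => a b; rewrite ltcE /= => /andP[/eqP -> a0].
pose d := complex.Re e / 2.
have d0 : 0 < d by rewrite divr_gt0.
have /cvgrPdist_lt/(_ d d0) cc := @continuous_cos R t.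
have /cvgrPdist_lt/(_ d d0) cs := @continuous_sin R t.
near=> s.
have hc : `|cos t - cos s| < d by near: s.
have hs : `|sin t - sin s| < d by near: s.
rewrite ei.
have -> : `|cis t - cis s| = (cmod (cis t - cis s))%:C by [].
rewrite ltcR.
have -> : cis t - cis s = (cos t - cos s)%:C + (0 +i* (sin t - sin s)).
  by apply/eqP; rewrite eq_complex /= add0r addr0 !eqxx.
apply: le_lt_trans (le_normcD _ _) _.
rewrite /= expr0n /= addr0 add0r !sqrtr_sqr.
by rewrite [ltRHS](splitr (complex.Re e)) ltrD.
Unshelve. all: by end_near. Qed.

Lemma measurable_cis :
  measurable_fun [set: measurableTypeR R]
    (@cis R : measurableTypeR R -> borelC R).
Proof.
apply: (@measurability _ _ (measurableTypeR R) (borelC R) setT (@cis R) (@open (CC R))) => //.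
move=> _ [A oA <-]; rewrite setTI; apply: open_measurable.
by move/continuousP: continuous_cis; apply.
Qed.

(* Normalized Lebesgue measure on the unit circle: the image of
   [dt / 2 pi] on [0, 2 pi[ under [t |-> e^(i t)]. *)
Definition circle_measure (A : set (borelC R)) : \bar R :=
  ((2 * pi)^-1%:E *
   @lebesgue_measure R (@cis R @^-1` A `&` `[0%R, (2 * pi)%R[))%E.

Let inv2pi_ge0 : 0 <= (2 * pi)^-1 :> R.
Proof. by rewrite invr_ge0 mulr_ge0 ?pi_ge0. Qed.

Let arc_measure := mscale (NngNum inv2pi_ge0)
  (mrestr (@lebesgue_measure R) (measurable_itv `[0, (2 * pi : R)[)).

Let measurable_cis_preimage (A : set (borelC R)) : measurable A ->
  measurable (@cis R @^-1` A : set (measurableTypeR R)).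
Proof. by move=> mA; rewrite -[X in measurable X]setTI; exact: measurable_cis. Qed.

Let circle_measure0 : circle_measure set0 = 0%E.
Proof. exact: (measure0 arc_measure). Qed.

Let circle_measure_ge0 A : (0 <= circle_measure A)%E.
Proof. exact: (measure_ge0 arc_measure). Qed.

Let circle_measure_sigma_additive : semi_sigma_additive circle_measure.
Proof.
move=> F mF tF mUF.
have := @measure_semi_sigma_additive _ _ _ arc_measure
  (fun n => @cis R @^-1` F n).
rewrite -preimage_bigcup; apply.
- by move=> n; exact: measurable_cis_preimage.
- apply/trivIsetP => i j _ _ ij; rewrite -preimage_setI.
  by move/trivIsetP : tF => /(_ _ _ _ _ ij) ->//; rewrite preimage_set0.
- exact: measurable_cis_preimage.
Qed.

HB.instance Definition _ := isMeasure.Build _ _ _ circle_measure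
  circle_measure0 circle_measure_ge0 circle_measure_sigma_additive.

End circle_measure.
Arguments circle_measure : clear implicits.

Section definitions.
Context (R : realType).
Implicit Types (p : R) (E : set (CC R)) (f : CC R -> CC R) (xi z : CC R).
Implicit Types mu nu : {measure set (borelC R) -> \bar R}.

Local Notation T := (unit_circle R).
Local Notation m := (circle_measure R).

Definition dist xi E : R := inf [set cmod (xi - w) | w in E].

(* [lne] is used because [ln 0 = 0] while [lne 0 = -oo].  For empty [E] we have
   [dist xi E = 0], so that the empty set does not qualify. *)
Definition beurling_carleson p E : Prop :=
  [/\ closed E, E `<=` T, m E = 0%E &
      (\int[m]_(xi in T) (`|lne (dist xi E)%:E| `^ p) < +oo)%E].

Definition singular mu nu : Prop :=
  exists N : set (borelC R), [/\ measurable N, nu N = 0%E & mu (~` N) = 0%E].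

Definition measure_support mu : set (CC R) :=
  [set x | forall U : set (CC R), open U -> U x -> mu U != 0%E].

Definition concentrated mu (F : set (CC R)) : Prop := mu (T `\` F) = 0%E.

Definition cintegral mu (D : set (CC R)) (g : CC R -> CC R) : CC R :=
  (\int[mu]_(x in D) complex.Re (g x)) +i*
  (\int[mu]_(x in D) complex.Im (g x)).

Definition singular_inner mu z : CC R :=
  cexp (- cintegral mu T (fun xi => (xi + z) / (xi - z))).

Definition cderive f : CC R -> CC R := @derive1 R[i] (CC R) f.

Definition has_angular_derivative f xi : Prop :=
  [/\ cvg (f (r%:C * xi) @[r --> (1 : R)^'-]),
      T (lim (f (r%:C * xi) @[r --> (1 : R)^'-])) &
      cvg (cderive f (r%:C * xi) @[r --> (1 : R)^'-])].

Definition abs_angular_derivative f xi : \bar R :=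
  if `[< has_angular_derivative f xi >]
  then (lim (cmod (cderive f (r%:C * xi)) @[r --> (1 : R)^'-]))%:E
  else +oo%E.

Definition in_Lp_circle p (g : CC R -> \bar R) : Prop :=
  measurable_fun (T : set (borelC R)) g /\
  (\int[m]_(xi in T) (`|g xi| `^ p) < +oo)%E.

Definition finite_entropy p f : Prop :=
  {ae m, forall xi, T xi -> abs_angular_derivative f xi \is a fin_num} /\
  in_Lp_circle p (fun xi => lne (abs_angular_derivative f xi)).

(* The integral of a nonnegative function [g] over [D] with respect to area
   measure, written in the coordinates [z = x + i y]. *)
Definition area_integral (D : set (CC R)) (g : CC R -> R) : \bar R :=
  \int[(@lebesgue_measure R \x @lebesgue_measure R)%E]_(
      u in [set u : R * R | D (u.1 +i* u.2)]) (g (u.1 +i* u.2))%:E.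

Definition sublevel_integral p f (c : R) : \bar R :=
  area_integral [set z | unit_disc R z /\ cmod (f z) < c]
    (fun z => `|ln (1 - cmod z)| `^ (p - 1) / (1 - cmod z)).

End definitions.

(* Main.v *)
Require Import Defs.
From HB Require Import structures.
From mathcomp Require Import all_boot all_order all_algebra.
From mathcomp Require Import all_classical all_reals all_analysis.
From mathcomp Require Import measurable_realfun complex ring lra.
Set Implicit Arguments.
Unset Strict Implicit.
Unset Printing Implicit Defensive.
Import Order.TTheory GRing.Theory Num.Theory.
Import numFieldNormedType.Exports.
Import HBSimple HBNNSimple.
Local Open Scope classical_set_scope.
Local Open Scope ring_scope.

(** Let u = - log |S_mu| be the Poisson integral of mu and, for xi on the circle,
    let J(xi) be the integral of |zeta - xi|^-2 with respect to dmu(zeta).  The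
    four conditions are linked by two facts: the identity |S_mu'(xi)| = 2 J(xi),
    valid at every xi with both sides possibly infinite
    ([abs_angular_derivativeE]), and integration in polar coordinates
    ([sublevel_integral_polar]), where the weight |ln s|^(p-1) / s in the distance
    s to the circle has the antiderivative - |ln s|^p / p.

    The identity for the angular derivative holds because, if J(xi) is finite,
    |zeta - xi|^-2 dominates the kernels of S_mu and S_mu' along the radius, so
    that both have limits.  Conversely, if S_mu' is bounded and |S_mu| tends to 1
    along the radius, then the mean value theorem gives u(r xi) <= M (1 - r), and
    monotone convergence in the Poisson integral gives J(xi) < oo.

    (1) => (2).  If mu lives on E, then J lies between constants times 1 and
    dist(xi, E)^-2, so that |log |S_mu'|| <= C + 2 |log dist(xi, E)|.

    (2) => (3).  Since u((1 - s) xi) <= 8 s J(xi), the radius of xi meets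
    {|S_mu| < c} only where s exceeds a constant over |S_mu'(xi)|.  The radial
    integral of the weight over such s is at most a constant plus a constant times
    |log |S_mu'(xi)||^p.

    (4) => (5).  Let F_n be the set of points of the circle such that every dyadic
    arc around them, of length 2^-k with k >= n, has mass at least A 2^-k.  If xi
    is within s < 2^-n of F_n, then u((1 - s) xi) is large, whence
    |S_mu((1 - s) xi)| < c provided that A is large ([near_dense_small]).  So the
    radius of xi lies in the sublevel set from distance 2^-n down to
    dist(xi, F_n), and the convergence of the sublevel integral says that
    |log dist(xi, F_n)|^p is integrable.  The distances to F_n and to its closure
    coincide, and the closure is a null set because its points have infinite
    logarithm; thus it is a Beurling-Carleson set.  Finally mu is carried by the
    union of the F_n because it is singular: cover a null set that carries mu by an
    open set U of small length; the maximal dyadic intervals in U on which the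
    density of mu is below A are disjoint, hence their union has mass at most A |U|
    ([dyadic_density_negligible]). *)

(** * Weighted images of measures *)

Lemma measurable_funV d (X : measurableType d) (R : realType) (f : X -> R) :
  measurable_fun [set: X] f -> measurable_fun [set: X] (fun x => (f x)^-1).
Proof.
move=> mf.
(* at [f x = 0] both sides are 0, as the inverse of 0 is 0 *)
have -> : (fun x => (f x)^-1) = (fun x => f x * ((f x ^+ 2) `^ (-1))).
  apply/funext => x; rewrite powR_inv1 ?sqr_ge0//.
  have [->|f0] := eqVneq (f x) 0; first by rewrite invr0 mul0r.
  by rewrite expr2 invfM mulrA mulfV// mul1r.
apply: measurable_funM => //.
apply: (measurableT_comp (measurable_powR (-1))).
exact: measurable_funX.
Qed.

(** It suffices to test the identity between the two measures on sets: simple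
    functions follow by linearity and nonnegative functions by monotone
    convergence. *)
Lemma ge0_integral_weight d1 d2 (X : measurableType d1) (Y : measurableType d2)
    (R : realType) (m1 : {measure set X -> \bar R})
    (m2 : {measure set Y -> \bar R}) (phi : X -> Y) (w : X -> R)
    (f : Y -> \bar R) :
  measurable_fun [set: X] phi -> measurable_fun [set: X] w ->
  (forall x, 0 <= w x) ->
  (forall A, measurable A ->
    m2 A = (\int[m1]_x (w x * \1_A (phi x))%:E)%E) ->
  measurable_fun [set: Y] f -> (forall y, 0 <= f y)%E ->
  (\int[m2]_y f y = \int[m1]_x ((w x)%:E * f (phi x)))%E.
Proof.
move=> mphi mw w0 m2E mf f0.
have mphiA A : measurable A -> measurable (phi @^-1` A).
  by move=> mA; rewrite -[X in measurable X]setTI; exact: mphi.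
pose f_ := nnsfun_approx measurableT mf.
have f_cvg y : (f_ n y)%:E @[n --> \oo] --> f y.
  by apply: (cvg_nnsfun_approx measurableT mf) => //.
transitivity (limn (fun n => (\int[m2]_x (f_ n x)%:E)%E)).
  rewrite -monotone_convergence//.
  - by apply: eq_integral => y _; apply/esym/cvg_lim.
  - by move=> n; exact/measurable_EFinP/measurable_funP.
  - by move=> n y _; rewrite lee_fin.
  - by move=> y _ m n mn; rewrite lee_fin; exact/lefP/nd_nnsfun_approx.
rewrite [X in limn X](_ : _ =
    (fun n => \int[m1]_x (w x * f_ n (phi x))%:E)%E).
  rewrite -monotone_convergence//; last 3 first.
  - move=> n; apply/measurable_EFinP/measurable_funM => //.
    exact: (measurableT_comp _ mphi).
  - by move=> n x _; rewrite lee_fin mulr_ge0.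
  - move=> x _ m n mn; rewrite lee_fin ler_wpM2l//.
    exact/lefP/nd_nnsfun_approx.
  apply: eq_integral => x _; apply/cvg_lim => //.
  under eq_fun do rewrite EFinM.
  exact: cvgeZl.
apply/funext => n.
transitivity (\sum_(k \in range (f_ n))
    (k%:E * m2 (f_ n @^-1` [set k])))%E.
  by rewrite integralT_nnsfun sintegralE.
transitivity (\sum_(k \in range (f_ n))
    \int[m1]_x (k * (w x * \1_(f_ n @^-1` [set k]) (phi x)))%:E)%E.
  apply: eq_fsbigr => r /set_mem [y _ <-].
  rewrite m2E// -ge0_integralZl//.
  - by apply/measurable_EFinP/measurable_funM => //; exact: measurableT_comp.
  - by move=> x _; rewrite lee_fin mulr_ge0.
  - by rewrite lee_fin.
transitivity (\int[m1]_x (\sum_(k \in range (f_ n))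
    (k * (w x * \1_(f_ n @^-1` [set k]) (phi x)))%:E))%E.
  rewrite ge0_integral_fsum//.
  - move=> r; apply/measurable_EFinP/measurable_funM => //.
    by apply/measurable_funM => //; exact: measurableT_comp.
  - move=> r x _; rewrite lee_fin mulrCA mulr_ge0//.
    by have := nnfun_muleindic_ge0 (f_ n) r (phi x); rewrite lee_fin.
apply: eq_integral => x _; rewrite fsumEFin//; congr EFin.
rewrite [f_ n (phi x)]fimfunE mulr_fsumr//.
by apply: eq_fsbigr => r _; rewrite mulrCA.
Qed.

(** * One-dimensional changes of variable *)

Section change_of_variables.
Context (R : realType).
Notation lambda := (@lebesgue_measure R).
Implicit Types (phi w : measurableTypeR R -> R) (f : R -> \bar R).

(** The weighted image of Lebesgue measure under [phi] is itself a measure, so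
    that, by the uniqueness of Lebesgue measure, it only has to be compared with
    the length on half-open intervals. *)
Lemma ge0_change_of_variables phi w f :
  measurable_fun [set: measurableTypeR R] phi ->
  measurable_fun [set: measurableTypeR R] w ->
  (forall x, 0 <= w x) ->
  (forall a b, a < b ->
    (\int[lambda]_x (w x * \1_(`]a, b]) (phi x))%:E)%E = (b - a)%:E) ->
  measurable_fun [set: R] f -> (forall y, 0 <= f y)%E ->
  (\int[lambda]_y f y = \int[lambda]_x ((w x)%:E * f (phi x)))%E.
Proof.
move=> mphi mw w0 H mf f0.
pose m (A : set (measurableTypeR R)) : \bar R :=
  (\int[lambda]_x (w x * \1_A (phi x))%:E)%E.
have m0 : m set0 = 0%E.
  rewrite /m; under eq_integral do rewrite indic0 mulr0.
  exact: integral0.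
have mge0 A : (0 <= m A)%E.
  by apply: integral_ge0 => x _; rewrite lee_fin mulr_ge0.
have msig : semi_sigma_additive m.
  move=> F mF tF mUF.
  have mI n : measurable_fun [set: measurableTypeR R]
      (fun x => (w x * \1_(F n) (phi x))%:E).
    apply/measurable_EFinP/measurable_funM => //.
    exact: (measurableT_comp (measurable_indic (mF n)) mphi).
  have -> : m (\bigcup_n F n) = (\sum_(0 <= n <oo) m (F n))%E.
    rewrite -integral_nneseries//; last first.
      by move=> n x _; rewrite lee_fin mulr_ge0.
    apply: eq_integral => x _.
    rewrite EFinM (_ : (\1_(\bigcup_n F n) (phi x))%:E =
      (\sum_(0 <= n <oo) (\1_(F n) (phi x))%:E)%E); last first.
      have := @measure_bigcup _ R _ (dirac (phi x : measurableTypeR R)) setT F.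
      move=> /(_ (fun n _ => mF n) tF); rewrite /= /dirac => ->.
      rewrite (@eq_eseriesl _ _ xpredT); last by move=> n; rewrite in_setT.
      by [].
    by rewrite -nneseriesZl.
  apply: is_cvg_nneseries => n _ _.
  exact: mge0.
pose M : {measure set (measurableTypeR R) -> \bar R} :=
  HB.pack m (isMeasure.Build _ _ _ m m0 mge0 msig).
apply: (@ge0_integral_weight _ _ _ _ _ lambda lambda phi w f) => //.
move=> A mA; refine (etrans (@lebesgue_measure_unique R M _ A mA) erefl).
move=> _ [[a b] _ <-] /=; rewrite [RHS]/m.
have [ab|ba] := ltP a b; first by rewrite H// lebesgue_measure_itv/= lte_fin ab.
rewrite set_itv_ge ?bnd_simp -?leNgt//.
by rewrite measure0 -/(m _) m0.
Qed.
Lemma ge0_integral_affine f (a b : R) : 0 < a ->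
  measurable_fun [set: R] f -> (forall y, 0 <= f y)%E ->
  (\int[lambda]_y f y = \int[lambda]_x (a%:E * f (a * x + b)%R))%E.
Proof.
move=> a0 mf f0.
apply: (@ge0_change_of_variables (fun x => a * x + b) (cst a)) => //.
- by apply: measurable_funD => //; exact: measurable_funM.
- by move=> x; exact: ltW.
move=> c d cd /=.
transitivity (\int[lambda]_x
    (a%:E * (\1_(`](c - b) / a, (d - b) / a] : set R) x)%:E))%E.
  apply: eq_integral => x _; rewrite EFinM !indicE; congr (_ * (nat_of_bool _)%:R%:E)%E.
  apply/idP/idP; rewrite !inE/= !in_itv/= ltr_pdivrMr// ler_pdivlMr//.
    by move=> /andP[? ?]; apply/andP; split; lra.
  by move=> /andP[? ?]; apply/andP; split; lra.
rewrite ge0_integralZl//; last 2 first.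
- exact/measurable_EFinP/measurable_indic.
- by rewrite lee_fin ltW.
rewrite integral_indic//= setIT lebesgue_measure_itv/= lte_fin ifT.
  by rewrite -!EFinB -EFinM; congr EFin; field; rewrite gt_eqF.
by rewrite ltr_pM2r ?invr_gt0// ltrD2r.
Qed.

Lemma ge0_integral_reflect f :
  measurable_fun [set: R] f -> (forall y, 0 <= f y)%E ->
  (\int[lambda]_y f y = \int[lambda]_x f (- x)%R)%E.
Proof.
move=> mf f0.
have := @ge0_integral_pushforward _ _ (measurableTypeR R) (measurableTypeR R) R
  (-%R) (@oppr_measurable _ _) lambda setT f measurableT mf (fun x _ => f0 x).
rewrite preimage_setT => <-.
apply: eq_measure_integral => A mA _; apply: esym.
exact: (etrans _ (lebesgue_measureN mA)).
Qed.

Lemma integral_derive (F f : R -> R) (a b : R) : a < b ->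
  (forall x, a <= x <= b -> is_derive x 1 F (f x)) ->
  (forall x, a <= x <= b -> {for x, continuous f}) ->
  (\int[lambda]_(x in `[a, b]) (f x)%:E)%E = (F b - F a)%:E.
Proof.
move=> ab dF cf.
have cF x : a <= x <= b -> {for x, continuous F}.
  move=> xab; apply: differentiable_continuous; apply/derivable1_diffP.
  by case: (dF x xab).
rewrite (@continuous_FTC2 _ f F)//.
- apply: continuous_in_subspaceT => x; rewrite inE/= in_itv/= => xab.
  exact: cf.
- split.
  + move=> x; rewrite in_itv/= => /andP[ax xb].
    by case: (dF x _) => //; rewrite !ltW.
  + by apply: cvg_at_right_filter; apply: cF; rewrite lexx ltW.
  + by apply: cvg_at_left_filter; apply: cF; rewrite lexx ltW.
- move=> x; rewrite in_itv/= => /andP[ax xb].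
  have H := dF x; rewrite derive1E; apply: derive_val.
  by apply: H; rewrite !ltW.
Qed.

(** On ]0, pi[ the cotangent of t is the tangent of pi / 2 - t, so that it is
    inverted by the arctangent; this describes the preimages of intervals. *)
Lemma cot_itv (x y t : R) : 0 < y -> 0 < t < pi ->
  (x < y * (cos t / sin t)) = (t < pi / 2 - atan (x / y)).
Proof.
move=> y0 /andP[t0 tpi].
have tE : cos t / sin t = tan (pi / 2 - t).
  rewrite /tan -(opprB t) sinN cosN sinBpihalf cosBpihalf opprK.
  by [].
rewrite tE mulrC -ltr_pdivrMr//.
have tan_itv : pi / 2 - t \in `](- (pi / 2)), (pi / 2)[.
  by rewrite in_itv/=; apply/andP; split; have := pi_gt0 R; lra.
rewrite -(leW_mono (le_mono (@lt_atan R))) tanK//.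
by apply/idP/idP; lra.
Qed.

(** The substitution x = y cot t parametrizes a horizontal line of the upper
    half-plane by the angle. *)
Lemma ge0_integral_cot f (y : R) : 0 < y ->
  measurable_fun [set: R] f -> (forall x, 0 <= f x)%E ->
  (\int[lambda]_x f x = \int[lambda]_t
    ((\1_`]0, pi[ t * (y * (sin t)^-2))%:E * f (y * (cos t / sin t))%R))%E.
Proof.
move=> y0 mf f0.
have mcot : measurable_fun [set: measurableTypeR R]
    (fun t : R => y * (cos t / sin t)).
  apply: measurable_funM => //; apply: measurable_funM.
    by apply: continuous_measurable_fun; exact: continuous_cos.
  apply: measurable_funV.
  by apply: continuous_measurable_fun; exact: continuous_sin.
have msin2 : measurable_fun [set: measurableTypeR R]
    (fun t : R => y * (sin t)^-2).
  apply: measurable_funM => //; apply: measurable_funV; apply: measurable_funX.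
  by apply: continuous_measurable_fun; exact: continuous_sin.
apply: (@ge0_change_of_variables (fun t => y * (cos t / sin t))
   (fun t => \1_`]0, pi[ t * (y * (sin t)^-2))) => //.
- by apply: measurable_funM => //; exact: measurable_indic.
- move=> t; apply: mulr_ge0 => //; apply: mulr_ge0; first exact: ltW.
  by rewrite invr_ge0 sqr_ge0.
move=> c d cd.
pose u := pi / 2 - atan (d / y); pose v := pi / 2 - atan (c / y).
have uv : u < v by rewrite /u /v ltrD2l ltrN2 lt_atan// ltr_pM2r// invr_gt0.
have u0 : 0 < u by rewrite subr_gt0 atan_ltpi2.
have vpi : v < pi.
  by have := atan_gtNpi2 (c / y); rewrite /v; lra.
transitivity (\int[lambda]_(t in `[u, v[) (y * (sin t)^-2)%:E)%E.
  rewrite [RHS]integral_mkcond/=; apply: eq_integral => t _.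
  rewrite patchE mem_setE/= in_itv/= !indicE !mem_setE !in_itv/=.
  have [t_in|t_notin] := boolP (0 < t < pi).
    rewrite cot_itv// -/v leNgt cot_itv// -/u -leNgt mul1r.
    by rewrite andbC; case: ifP => _; rewrite ?mulr1// mulr0.
  rewrite mulr0n !mul0r ifF//.
  apply: contraNF t_notin => /andP[ut tv].
  by rewrite (lt_le_trans u0 ut) (lt_trans tv vpi).
rewrite integral_itv_bndo_bndc; last first.
  by apply/measurable_EFinP; exact: measurable_funTS.
have sin_pos t : u <= t <= v -> 0 < sin t.
  by move=> /andP[ut tv]; rewrite sin_gt0_pi// (lt_le_trans u0)// (le_lt_trans tv).
have dcot t : u <= t <= v ->
    is_derive t 1 (fun t => - (y * (cos t / sin t))) (y * (sin t)^-2).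
  move=> /sin_pos st.
  have sn0 : sin t != 0 by rewrite gt_eqF.
  apply: is_derive_eq.
  rewrite /GRing.scale/=.
  transitivity (y * (cos t ^+ 2 + sin t ^+ 2) / sin t ^+ 2); first by field.
  by rewrite cos2Dsin2 mulr1.
rewrite (integral_derive uv dcot); last first.
  move=> t /sin_pos st; apply: continuousM; first exact: cvg_cst.
  apply: continuousV; first by rewrite expf_neq0// gt_eqF.
  by apply: continuousM; exact: continuous_sin.
have H z : y * (cos (pi / 2 - atan (z / y)) / sin (pi / 2 - atan (z / y))) = z.
  rewrite -(opprB (atan _)) sinN cosN sinBpihalf cosBpihalf opprK.
  by rewrite -/(tan _) atanK mulrC divfK// gt_eqF.
by rewrite /u /v !H opprK addrC.
Qed.

End change_of_variables.

(** * Polar coordinates *)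

Section polar_coordinates.
Context (R : realType).
Notation lambda := (@lebesgue_measure R).
Notation RR := (measurableTypeR R * measurableTypeR R)%type.

Lemma integral_indicM d (X : measurableType d) (m : {measure set X -> \bar R})
    (D : set X) (f : X -> \bar R) :
  (\int[m]_(x in D) f x = \int[m]_x ((\1_D x)%:E * f x))%E.
Proof.
rewrite integral_mkcond; apply: eq_integral => x _.
by rewrite patchE indicE; case: ifP => _; rewrite ?mul1e ?mul0e.
Qed.

Lemma measurable_fun_pairing d (X : measurableType d)
    d1 (X1 : measurableType d1) d2 (X2 : measurableType d2)
    (f : X -> X1) (g : X -> X2) :
  measurable_fun setT f -> measurable_fun setT g ->
  measurable_fun [set: X] (fun x => (f x, g x)).
Proof. by move=> mf mg; apply/measurable_fun_pairP; split. Qed.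

Lemma measurable_fun_polar d (X : measurableType d) (r t : X -> R) :
  measurable_fun [set: X] r -> measurable_fun [set: X] t ->
  measurable_fun [set: X] (fun x =>
    (r x * cos (t x), r x * sin (t x)) : RR).
Proof.
move=> mr mt; apply: measurable_fun_pairing; apply: measurable_funM => //.
  apply: (measurableT_comp _ mt).
  by apply: continuous_measurable_fun; exact: continuous_cos.
apply: (measurableT_comp _ mt).
by apply: continuous_measurable_fun; exact: continuous_sin.
Qed.

Definition radial (F : RR -> \bar R) (t : R) : \bar R :=
  (\int[lambda]_(r in `]0%R, +oo[) (r%:E * F (r * cos t, r * sin t)%R))%E.

Section upper.
Variable F : RR -> \bar R.
Hypothesis mF : measurable_fun [set: RR] F.
Hypothesis F0 : forall z, (0 <= F z)%E.

Lemma measurable_polar_integrand :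
  measurable_fun [set: RR] (fun z : RR => ((\1_(`]0%R, +oo[ : set R) z.2)%:E *
    (z.2%:E * F (z.2 * cos z.1, z.2 * sin z.1)%R))%E).
Proof.
apply: emeasurable_funM.
  apply/measurable_EFinP; apply: (measurableT_comp _ measurable_snd).
  exact: measurable_indic.
apply: emeasurable_funM.
  by apply/measurable_EFinP; apply: measurable_snd.
apply: (measurableT_comp mF).
exact: (measurable_fun_polar measurable_snd measurable_fst).
Qed.

Lemma radial_ge0 (t : R) : (0 <= radial F t)%E.
Proof.
apply: integral_ge0 => r /=; rewrite in_itv/= andbT => r0.
by rewrite mule_ge0// lee_fin ltW.
Qed.

Lemma measurable_radial : measurable_fun [set: measurableTypeR R] (radial F).
Proof.
rewrite (_ : radial F = fubini_F lambda (fun z : RR => ((\1_(`]0%R, +oo[ : set R) z.2)%:E *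
    (z.2%:E * F (z.2 * cos z.1, z.2 * sin z.1)%R))%E)); last first.
  by apply/funext => t; rewrite /radial integral_indicM.
apply: measurable_fun_fubini_tonelli_F; first exact: measurable_polar_integrand.
move=> [t r] /=; rewrite indicE mem_setE/= in_itv/= andbT.
by case: ltP => r0; rewrite ?mul0e// mul1e mule_ge0// lee_fin ltW.
Qed.

(** The map (r, t) |-> (r cos t, r sin t) is the composition of two maps that
    each move one coordinate only: x = y cot t at fixed height y, and then
    y = r sin t at fixed angle t.  Between the two substitutions Tonelli's theorem
    exchanges the order of integration, and the Jacobians multiply to
    (y / sin^2 t) sin t = r. *)
Lemma polar_upper_half_plane :
  (\int[lambda]_(y in `]0%R, +oo[) \int[lambda]_x F (x, y) =
   \int[lambda]_(t in `]0%R, pi[) radial F t)%E.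
Proof.
pose h (y t : R) : \bar R := ((\1_(`]0%R, +oo[ : set R) y * \1_(`]0%R, pi[ : set R) t *
   (y * (sin t)^-2))%:E * F (y * (cos t / sin t), y)%R)%E.
rewrite integral_indicM.
transitivity (\int[lambda]_y \int[lambda]_t h y t)%E.
  apply: eq_integral => y _; rewrite indicE mem_setE/= in_itv/= andbT.
  have [y0|y0] := ltP 0 y; last first.
    rewrite mul0e integral0_eq// => t _.
    by rewrite /h indicE mem_setE/= in_itv/= andbT ltNge y0/= !mul0r mul0e.
  rewrite mul1e (ge0_integral_cot y0)//; last first.
    by apply: (measurableT_comp mF); exact: measurable_fun_pairing.
  apply: eq_integral => t _; rewrite /h [\1_(`]0%R, +oo[ : set R) y]indicE mem_setE/= in_itv/=.
  by rewrite andbT y0 mul1r.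
rewrite (@fubini_tonelli _ _ _ _ _ lambda lambda
  (fun z : RR => h z.1 z.2)); last 2 first.
- apply: emeasurable_funM; last first.
    apply: (measurableT_comp mF); apply: measurable_fun_pairing => //.
    apply: measurable_funM => //; apply: measurable_funM.
      apply: (measurableT_comp _ measurable_snd).
      by apply: continuous_measurable_fun; exact: continuous_cos.
    apply: measurable_funV; apply: (measurableT_comp _ measurable_snd).
    by apply: continuous_measurable_fun; exact: continuous_sin.
  apply/measurable_EFinP; apply: measurable_funM; first apply: measurable_funM.
  + apply: (measurableT_comp _ measurable_fst); exact: measurable_indic.
  + apply: (measurableT_comp _ measurable_snd); exact: measurable_indic.
  + apply: measurable_funM => //.
    apply: measurable_funV; apply: measurable_funX.
    apply: (measurableT_comp _ measurable_snd).
    by apply: continuous_measurable_fun; exact: continuous_sin.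
- move=> [y t] /=; rewrite /h [\1_(`]0%R, +oo[ : set R) y]indicE mem_setE/= in_itv/= andbT.
  case: ltP => y0; last by rewrite !mul0r mul0e.
  rewrite mul1r mule_ge0// lee_fin mulr_ge0// mulr_ge0 ?(ltW y0)//.
  by rewrite invr_ge0 sqr_ge0.
rewrite [RHS]integral_indicM; apply: eq_integral => t _ /=.
rewrite indicE mem_setE/= in_itv/=.
have [tpi|tpi] := boolP (0 < t < pi); last first.
  rewrite mul0e integral0_eq// => y _.
  by rewrite /h [\1_(`]0%R, pi[ : set R) t]indicE mem_setE/= in_itv/= (negbTE tpi) mulr0 mul0r mul0e.
have st : 0 < sin t by exact: sin_gt0_pi.
have hpos y : (0 <= h y t)%E.
  rewrite /h [\1_(`]0%R, +oo[ : set R) y]indicE mem_setE/= in_itv/= andbT.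
  case: ltP => y0; last by rewrite !mul0r mul0e.
  rewrite mul1r mule_ge0// lee_fin mulr_ge0// mulr_ge0 ?(ltW y0)//.
  by rewrite invr_ge0 sqr_ge0.
rewrite mul1e (@ge0_integral_affine _ (h ^~ t) (sin t) 0 st)//; last first.
  apply: emeasurable_funM; last first.
    apply: (measurableT_comp mF); apply: measurable_fun_pairing => //.
    exact: measurable_funM.
  apply/measurable_EFinP; apply: measurable_funM; last exact: measurable_funM.
  apply: measurable_funM => //; exact: measurable_indic.
rewrite /radial [RHS]integral_indicM; apply: eq_integral => r _.
rewrite /h addr0 !indicE !mem_setE/= !in_itv/= !andbT tpi pmulr_rgt0//.
case: ltP => r0; last by rewrite !mul0r !mul0e mule0.
rewrite !mul1r mul1e muleA -EFinM; congr (_%:E * F (_, _))%E.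
- by field; rewrite gt_eqF.
- by field; rewrite gt_eqF.
- by rewrite mulrC.
Qed.

End upper.

(** The lower half-plane is the image of the upper one under z |-> - z, which
    amounts to adding pi to the angle. *)
Theorem ge0_integral_polar (F : RR -> \bar R) :
  measurable_fun [set: RR] F -> (forall z, (0 <= F z)%E) ->
  (\int[(lambda \x lambda)%E]_z F z =
   \int[lambda]_(t in `[0%R, (2 * pi)%R[) radial F t)%E.
Proof.
move=> mF F0.
pose A (y : R) := (\int[lambda]_x F (x, y))%E.
have A0 y : (0 <= A y)%E by exact: integral_ge0.
have mA : measurable_fun [set: measurableTypeR R] A.
  exact: (@measurable_fun_fubini_tonelli_G _ _ _ _ _ lambda F mF F0).
pose F' (z : RR) := F (- z.1, - z.2)%R.
have mF' : measurable_fun [set: RR] F'.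
  apply: (measurableT_comp mF).
  apply: measurable_fun_pairing; apply: measurableT_comp => //; exact: oppr_measurable.
have F'0 z : (0 <= F' z)%E by exact: F0.
have pi0 := pi_gt0 R.
have mr := measurable_radial mF F0.
have r0 := radial_ge0 F0.
have lower : (\int[lambda]_(y in `]-oo, 0%R]) A y =
    \int[lambda]_(t in `]pi, (2 * pi)%R[) radial F t)%E.
  rewrite integral_indicM ge0_integral_reflect; last 2 first.
  - apply: emeasurable_funM => //.
    by apply/measurable_EFinP; exact: measurable_indic.
  - by move=> y; rewrite mule_ge0// lee_fin.
  transitivity (\int[lambda]_(y in `[0%R, +oo[) A (- y)%R)%E.
    rewrite [RHS]integral_indicM; apply: eq_integral => y _.
    by rewrite !indicE !mem_setE/= !in_itv/= andbT oppr_le0.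
  rewrite -integral_itv_obnd_cbnd; last first.
    apply: measurable_funTS; apply: (measurableT_comp mA).
    exact: oppr_measurable.
  transitivity (\int[lambda]_(y in `]0%R, +oo[) \int[lambda]_x F' (x, y))%E.
    apply: eq_integral => y _.
    rewrite /A [LHS]ge0_integral_reflect//.
    by apply: (measurableT_comp mF); exact: measurable_fun_pairing.
  rewrite (polar_upper_half_plane mF' F'0) integral_indicM [RHS]integral_indicM.
  rewrite [RHS](@ge0_integral_affine _ _ 1 pi)//; last 2 first.
  - apply: emeasurable_funM => //.
    by apply/measurable_EFinP; exact: measurable_indic.
  - by move=> y; rewrite mule_ge0// lee_fin.
  apply: eq_integral => t _; rewrite mul1e mul1r; congr (_ * _)%E.
    rewrite !indicE !mem_setE/= !in_itv/=; congr ((nat_of_bool _)%:R%:E).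
    by apply/idP/idP => /andP[? ?]; apply/andP; split; lra.
  rewrite /radial; apply: eq_integral => r _.
  by rewrite sinDpi cosDpi !mulrN.
rewrite fubini_tonelli2//.
have -> : [set: measurableTypeR R] = `]-oo, 0%R] `|` `]0%R, +oo[.
  apply/seteqP; split=> [x _|]//=; rewrite !in_itv/= andbT.
  by case: (leP x 0) => ?; [left|right].
rewrite ge0_integral_setU//; last 2 first.
- exact: measurable_funTS.
- apply/disj_setPS => x [/=]; rewrite !in_itv/= andbT => x0 xp.
  by move: x0; rewrite leNgt xp.
rewrite [X in (X + _)%E]lower [X in (_ + X)%E]polar_upper_half_plane//.
have -> : `[0%R, (2 * pi)%R[%classic =
    `[0%R, pi[ `|` `[pi, (2 * pi)%R[ :> set R.
  apply/seteqP; split=> x /=; rewrite !in_itv/=.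
    by case: (ltP x pi) => xpi /andP[-> ?]; [left|right].
  by case=> /andP[? ?]; apply/andP; split; lra.
rewrite ge0_integral_setU//; last 2 first.
- exact: measurable_funTS.
- apply/disj_setPS => x [/=]; rewrite !in_itv/= => /andP[_ x1] /andP[x2 _].
  by move: x1; rewrite ltNge x2.
rewrite addeC; congr (_ + _)%E; rewrite -integral_itv_obnd_cbnd//;
  exact: measurable_funTS.
Qed.

End polar_coordinates.

(** * Modulus and convergence in the complex plane *)

Section complex_basics.
Context (R : realType).
Implicit Types (z w : CC R) (f : CC R -> R).
Local Open Scope complex_scope.
Local Notation Re := (@complex.Re R).
Local Notation Im := (@complex.Im R).

Lemma cmod_ge0 z : 0 <= cmod z.
Proof. by case: z => a b /=; exact: sqrtr_ge0. Qed.

Lemma sqr_cmod z : cmod z ^+ 2 = Re z ^+ 2 + Im z ^+ 2.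
Proof. by case: z => a b /=; rewrite sqr_sqrtr// addr_ge0// sqr_ge0. Qed.

Lemma cmodM z w : cmod (z * w) = cmod z * cmod w.
Proof. exact: Normc.normcM. Qed.

Lemma cmodV z : cmod z^-1 = (cmod z)^-1.
Proof. exact: Normc.normcV. Qed.

Lemma cmodN z : cmod (- z) = cmod z.
Proof. by case: z => a b /=; rewrite !sqrrN. Qed.

Lemma cmodB z w : cmod (z - w) = cmod (w - z).
Proof. by rewrite -cmodN opprB. Qed.

Lemma cmod_real (r : R) : cmod (r%:C : CC R) = `|r|.
Proof. by rewrite /= expr0n addr0 sqrtr_sqr. Qed.

Lemma le_cmodD z w : cmod (z + w) <= cmod z + cmod w.
Proof. exact: le_normcD. Qed.

Lemma le_cmodB z w : cmod z - cmod w <= cmod (z - w).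
Proof. by rewrite lerBlDr (le_trans _ (le_cmodD _ _))// subrK. Qed.

Lemma le_cmod_dist z w v : cmod (z - w) <= cmod (z - v) + cmod (v - w).
Proof. by rewrite (le_trans _ (le_cmodD _ _))// addrA subrK. Qed.

Lemma cmod_eq0 z : (cmod z == 0) = (z == 0).
Proof.
apply/eqP/eqP => [|->]; first exact: Normc.eq0_normc.
by rewrite /= expr0n addr0 sqrtr0.
Qed.

Lemma cmod_gt0 z : (0 < cmod z) = (z != 0).
Proof. by rewrite lt_def cmod_ge0 andbT cmod_eq0. Qed.

Lemma cmod_cis (t : R) : cmod (cis t) = 1.
Proof. by rewrite /= cos2Dsin2 sqrtr1. Qed.

Lemma abs_Re_le z : `|Re z| <= cmod z.
Proof.
rewrite -(@ler_pXn2r _ 2)// ?nnegrE ?cmod_ge0// sqr_cmod -normrX ger0_norm ?sqr_ge0//.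
by rewrite lerDl sqr_ge0.
Qed.

Lemma abs_Im_le z : `|Im z| <= cmod z.
Proof.
rewrite -(@ler_pXn2r _ 2)// ?nnegrE ?cmod_ge0// sqr_cmod -normrX ger0_norm ?sqr_ge0//.
by rewrite lerDr sqr_ge0.
Qed.

Lemma cmod_le_ReIm z : cmod z <= `|Re z| + `|Im z|.
Proof.
have -> : z = (Re z)%:C + (0 +i* Im z).
  by case: z => a b /=; apply/eqP; rewrite eq_complex/= addr0 add0r !eqxx.
apply: le_trans (le_cmodD _ _) _.
by case: z => a b /=; rewrite expr0n /= !addr0 !add0r !sqrtr_sqr.
Qed.

Lemma ReB z w : Re (z - w) = Re z - Re w.
Proof. by case: z w => a b [c d]. Qed.
Lemma ImB z w : Im (z - w) = Im z - Im w.
Proof. by case: z w => a b [c d]. Qed.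
Lemma ReD z w : Re (z + w) = Re z + Re w.
Proof. by case: z w => a b [c d]. Qed.
Lemma ImD z w : Im (z + w) = Im z + Im w.
Proof. by case: z w => a b [c d]. Qed.
Lemma ReN z : Re (- z) = - Re z.
Proof. by case: z => a b. Qed.
Lemma ReM z w : Re (z * w) = Re z * Re w - Im z * Im w.
Proof. by case: z w => a b [c d]. Qed.
Lemma ImM z w : Im (z * w) = Re z * Im w + Im z * Re w.
Proof. by case: z w => a b [c d]. Qed.
Lemma ReV z : Re z^-1 = Re z / cmod z ^+ 2.
Proof. by rewrite sqr_cmod; case: z => a b. Qed.
Lemma ImV z : Im z^-1 = - Im z / cmod z ^+ 2.
Proof. by rewrite sqr_cmod; case: z => a b /=; rewrite mulNr. Qed.

Lemma complex_ext z w : Re z = Re w -> Im z = Im w -> z = w.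
Proof. by case: z w => a b [c d] /= -> ->. Qed.

(** The norm of the plane takes values in the complex numbers; this is the
    criterion with real tolerances. *)
Lemma cvgCP (U : Type) (F : set_system U) (FF : Filter F) (g : U -> CC R) l :
  g @ F --> l <-> (forall e : R, 0 < e -> \forall x \near F, cmod (l - g x) < e).
Proof.
split=> [/cvgrPdist_lt H e e0|H].
  have := H e%:C; rewrite ltcR => /(_ e0).
  by apply: filterS => x; rewrite -ltcR.
apply/cvgrPdist_lt => e e0.
have [er ei] : 0 < Re e /\ e = (Re e)%:C.
  by move: e0; case: e => a b; rewrite ltcE /= => /andP[/eqP -> a0].
rewrite ei; apply: filterS (H _ er) => x.
by rewrite -ltcR.
Qed.

(** Real and imaginary parts, the modulus and the distance to a set are all
    1-Lipschitz, so this one criterion settles their continuity. *)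
Lemma cmod_lipschitz_continuous f :
  (forall z w, `|f z - f w| <= cmod (z - w)) -> continuous f.
Proof.
move=> lf z; apply/(@cvgrPdist_lt _ _ _ (nbhs (z : CC R)) (nbhs_filter (z : CC R))) => e e0.
have H := (@cvgCP _ (nbhs z) (nbhs_filter z) id z).1 cvg_id.
by apply: filterS (H e e0) => w; exact: le_lt_trans.
Qed.

Lemma continuous_Re : continuous (Re : CC R -> R).
Proof. by apply: cmod_lipschitz_continuous => z w; rewrite -ReB abs_Re_le. Qed.

Lemma continuous_Im : continuous (Im : CC R -> R).
Proof. by apply: cmod_lipschitz_continuous => z w; rewrite -ImB abs_Im_le. Qed.

Lemma continuous_cmod : continuous (@complex.ComplexField.Normc.normc R : CC R -> R).
Proof.
apply: cmod_lipschitz_continuous => z w.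
rewrite ler_norml lerNl opprB le_cmodB andbT.
by rewrite cmodB le_cmodB.
Qed.

Lemma measurable_continuousC f : continuous f ->
  measurable_fun [set: borelC R] (f : borelC R -> R).
Proof.
move=> cf.
apply: (measurability _ (RGenOpens.measurableE R)).
move=> _ [A [a [b ->]] <-]; rewrite setTI.
apply: sub_sigma_algebra.
by move/continuousP: cf; apply; exact: interval_open.
Qed.

End complex_basics.

(** * Estimates for the exponential, sine and cosine *)

Section elementary_estimates.
Context (R : realType).
Implicit Types (x y : R) (f df : R -> R).

Lemma lipschitz_derive f df M a b : a <= b ->
  (forall x, a <= x <= b -> is_derive x 1 f (df x)) ->
  (forall x, a <= x <= b -> `|df x| <= M) ->
  `|f b - f a| <= M * (b - a).
Proof.
move=> ab hdf bf.
have [c cab ->] : exists2 c, c \in `[a, b]%R & f b - f a = df c * (b - a).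
  apply: MVT_segment => //.
    by move=> x; rewrite in_itv/= => /andP[? ?]; apply: hdf; rewrite !ltW.
  apply: continuous_in_subspaceT => x; rewrite inE/= in_itv/= => xab.
  apply: differentiable_continuous; apply/derivable1_diffP.
  by case: (hdf x xab).
rewrite normrM (ger0_norm (_ : 0 <= b - a)) ?subr_ge0//.
by rewrite ler_wpM2r ?subr_ge0// bf// -in_itv.
Qed.

Lemma lipschitz_derive0 f df M y :
  (forall x, `|x| <= `|y| -> is_derive x 1 f (df x)) ->
  (forall x, `|x| <= `|y| -> `|df x| <= M) ->
  `|f y - f 0| <= M * `|y|.
Proof.
move=> hdf bf; have [y0|y0] := leP 0 y.
  rewrite (ger0_norm y0) -[X in _ * X](subr0 y); apply: lipschitz_derive => // x /andP[x0 xy].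
    by apply: hdf; rewrite !ger0_norm// (le_trans x0).
  by apply: bf; rewrite !ger0_norm// (le_trans x0).
rewrite distrC (ltr0_norm y0) -[X in _ * X]sub0r; apply: lipschitz_derive; first exact: ltW.
  by move=> x /andP[yx x0]; apply: hdf; rewrite !ler0_norm ?lerN2// ltW.
by move=> x /andP[yx x0]; apply: bf; rewrite !ler0_norm ?lerN2// ltW.
Qed.

Lemma abs_sin_le y : `|sin y| <= `|y|.
Proof.
have := @lipschitz_derive0 (@sin R) (@cos R) 1 y.
rewrite sin0 subr0 mul1r; apply => x _.
exact: cos_max.
Qed.

Lemma abs_cosB1_le y : `|cos y - 1| <= y ^+ 2.
Proof.
have := @lipschitz_derive0 (@cos R) (fun x => - sin x) `|y| y.
rewrite cos0 -normrM -expr2 [`|_ ^+ 2|]ger0_norm ?sqr_ge0//; apply => x xy.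
by rewrite normrN (le_trans (abs_sin_le x)).
Qed.

Lemma abs_sinB_le y : `|y| <= 1 -> `|sin y - y| <= y ^+ 2.
Proof.
move=> y1.
have := @lipschitz_derive0 (fun x => sin x - x) (fun x => cos x - 1) `|y| y.
rewrite sin0 !subr0 -normrM -expr2 [`|_ ^+ 2|]ger0_norm ?sqr_ge0//; apply => x xy.
rewrite (le_trans (abs_cosB1_le x))// -real_normK ?num_real//.
by rewrite (le_trans _ xy)// expr2 ler_piMl// (le_trans xy).
Qed.

Lemma expR_quadratic x : `|x| <= 2^-1 ->
  0 <= expR x - 1 - x <= 2 * x ^+ 2 /\ expR x <= 2.
Proof.
rewrite ler_norml => /andP[x0 x1].
have h1 := expR_ge1Dx x.
have h2 := expR_ge1Dx (- x).
have e0 := expR_gt0 x.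
have h3 : expR x * (1 - x) <= 1.
  by rewrite -[leRHS](expR0 R) -(subrr x) expRD ler_wpM2l// ltW.
have e2 : expR x <= 2 by nra.
split => //; apply/andP; split; nra.
Qed.

End elementary_estimates.

Section complex_exponential.
Context (R : realType).
Implicit Types (z w : CC R).
Local Open Scope complex_scope.
Local Notation Re := (@complex.Re R).
Local Notation Im := (@complex.Im R).

Lemma cexpE z : cexp z = (expR (Re z) * cos (Im z)) +i* (expR (Re z) * sin (Im z)).
Proof.
apply: complex_ext; rewrite /cexp ?ReM ?ImM/= !mul0r ?subr0 ?addr0//.
Qed.

Lemma cmod_cexp z : cmod (cexp z) = expR (Re z).
Proof. by rewrite /cexp cmodM cmod_cis mulr1 cmod_real ger0_norm ?expR_ge0. Qed.

Lemma cexpD z w : cexp (z + w) = cexp z * cexp w.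
Proof.
rewrite !cexpE ReD ImD expRD cosD sinD.
by apply: complex_ext; rewrite ?ReM ?ImM/=; ring.
Qed.

(** This second-order bound is what the complex differentiability of
    exp (- H(z)) needs, without a general theory of the complex exponential. *)
Lemma cmod_cexp_quadratic z : cmod z <= 2^-1 ->
  cmod (cexp z - 1 - z) <= 4 * cmod z ^+ 2.
Proof.
move=> z2; apply: le_trans (cmod_le_ReIm _) _; rewrite sqr_cmod.
have x2 := le_trans (abs_Re_le z) z2.
have y2 := le_trans (abs_Im_le z) z2.
rewrite cexpE; case: z z2 x2 y2 => x y /= _ x2 y2.
have [/andP[ex0 ex] ex2] := expR_quadratic x2.
have y1 : `|y| <= 1 by apply: le_trans y2 _; lra.
have e0 := expR_gt0 x.
have cy := abs_cosB1_le y.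
have sy := abs_sin_le y.
have sy2 := abs_sinB_le y1.
have re : `|expR x * cos y - 1 - x| <= 2 * (x ^+ 2 + y ^+ 2).
  rewrite (_ : _ - x = (expR x - 1 - x) + expR x * (cos y - 1)); last by ring.
  rewrite (le_trans (ler_normD _ _))// normrM (ger0_norm ex0) (gtr0_norm e0).
  rewrite mulrDr lerD// ler_pM// ltW//.
have im : `|expR x * sin y - 0 - y| <= 2 * (x ^+ 2 + y ^+ 2).
  rewrite (_ : _ - y = (expR x - 1) * sin y + (sin y - y)); last by ring.
  rewrite (le_trans (ler_normD _ _))// normrM.
  have ex1 : `|expR x - 1| <= 2 * `|x|.
    rewrite (_ : _ - 1 = (expR x - 1 - x) + x); last by ring.
    rewrite (le_trans (ler_normD _ _))// (ger0_norm ex0).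
    suff : 2 * x ^+ 2 <= `|x| by lra.
    rewrite -real_normK ?num_real// expr2 mulrA ler_piMl//.
    by rewrite -ler_pdivlMl// mulr1.
  have : `|expR x - 1| * `|sin y| <= 2 * `|x| * `|y| by rewrite ler_pM.
  have : 0 <= (`|x| - `|y|) ^+ 2 by exact: sqr_ge0.
  rewrite -(real_normK (num_real x)) -(real_normK (num_real y)).
  rewrite -(real_normK (num_real y)) in sy2.
  nra.
lra.
Qed.

End complex_exponential.

(** * Borel measurability and integration on the circle *)

Section complex_measurability.
Context (R : realType).
Local Open Scope complex_scope.
Local Notation Re := (@complex.Re R).
Local Notation Im := (@complex.Im R).
Local Notation T := (unit_circle R).

(** Measurability is tested on the real and imaginary parts, which avoids
    comparing the Borel sets of the plane with those of a product of two lines. *)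
Definition cmeasurable d (X : measurableType d) (g : X -> CC R) :=
  measurable_fun [set: X] (fun x => Re (g x)) /\
  measurable_fun [set: X] (fun x => Im (g x)).

Section closure.
Context d (X : measurableType d).
Implicit Types g : X -> CC R.

Lemma cmeasurable_cst (c : CC R) : cmeasurable (fun _ : X => c).
Proof. by split; exact: measurable_cst. Qed.

Lemma cmeasurableD g1 g2 : cmeasurable g1 -> cmeasurable g2 ->
  cmeasurable (fun x => g1 x + g2 x).
Proof.
move=> [r1 i1] [r2 i2]; split.
  by under eq_fun do rewrite ReD; exact: measurable_funD.
by under eq_fun do rewrite ImD; exact: measurable_funD.
Qed.

Lemma cmeasurableB g1 g2 : cmeasurable g1 -> cmeasurable g2 ->
  cmeasurable (fun x => g1 x - g2 x).
Proof.
move=> [r1 i1] [r2 i2]; split.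
  by under eq_fun do rewrite ReB; exact: measurable_funB.
by under eq_fun do rewrite ImB; exact: measurable_funB.
Qed.

Lemma cmeasurableM g1 g2 : cmeasurable g1 -> cmeasurable g2 ->
  cmeasurable (fun x => g1 x * g2 x).
Proof.
move=> [r1 i1] [r2 i2]; split.
  under eq_fun do rewrite ReM.
  by apply: measurable_funB; exact: measurable_funM.
under eq_fun do rewrite ImM.
by apply: measurable_funD; exact: measurable_funM.
Qed.

Lemma measurable_sqr_cmod g : cmeasurable g ->
  measurable_fun [set: X] (fun x => cmod (g x) ^+ 2).
Proof.
move=> [r i]; under eq_fun do rewrite sqr_cmod.
by apply: measurable_funD; exact: measurable_funX.
Qed.

Lemma measurable_cmod g : cmeasurable g ->
  measurable_fun [set: X] (fun x => cmod (g x)).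
Proof.
move=> mg.
have -> : (fun x => cmod (g x)) = (fun x => (cmod (g x) ^+ 2) `^ (2^-1)).
  apply/funext => x; rewrite powR12_sqrt ?sqr_ge0// sqrtr_sqr ger0_norm//.
  exact: cmod_ge0.
apply: (measurableT_comp (measurable_powR (2^-1))).
exact: measurable_sqr_cmod.
Qed.

Lemma cmeasurableV g : cmeasurable g -> cmeasurable (fun x => (g x)^-1).
Proof.
move=> mg; have [r i] := mg; split.
  under eq_fun do rewrite ReV.
  apply: measurable_funM => //.
  exact: (measurable_funV (measurable_sqr_cmod mg)).
under eq_fun do rewrite ImV.
apply: measurable_funM.
  exact: (measurableT_comp (@oppr_measurable R setT) i).
exact: (measurable_funV (measurable_sqr_cmod mg)).
Qed.

End closure.

Lemma cmeasurable_comp d (X : measurableType d) d' (Y : measurableType d')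
    (g : Y -> CC R) (h : X -> Y) :
  measurable_fun setT h -> cmeasurable g -> cmeasurable (fun x => g (h x)).
Proof. by move=> mh [mr mi]; split; [exact: (measurableT_comp mr mh)|exact: (measurableT_comp mi mh)]. Qed.

Lemma cmeasurable_id : cmeasurable (fun z : borelC R => z : CC R).
Proof.
split; first exact: measurable_continuousC (@continuous_Re R).
exact: measurable_continuousC (@continuous_Im R).
Qed.

Lemma measurable_unit_circle : measurable (T : set (borelC R)).
Proof.
rewrite (_ : T = (fun z : borelC R => cmod (z : CC R)) @^-1` [set 1]); last by [].
rewrite -[X in measurable X]setTI.
by apply: (measurable_cmod cmeasurable_id) => //; exact: measurable_set1.
Qed.

Lemma open_measurableC (U : set (CC R)) : open U -> measurable (U : set (borelC R)).
Proof. by move=> oU; exact: sub_sigma_algebra. Qed.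

Lemma closed_measurableC (U : set (CC R)) :
  closed U -> measurable (U : set (borelC R)).
Proof.
move=> cU; rewrite -(setCK U); apply: measurableC.
by apply: open_measurableC; exact: closed_openC.
Qed.

(** The normalized measure of the circle is the image under [cis] of Lebesgue
    measure weighted by the indicator function of [0, 2 pi[ over 2 pi. *)
Lemma ge0_integral_circle (g : borelC R -> \bar R) :
  measurable_fun (T : set (borelC R)) g -> (forall x, 0 <= g x)%E ->
  (\int[circle_measure R]_(x in T) g x =
   ((2 * pi)^-1)%:E * \int[@lebesgue_measure R]_(t in `[0%R, (2 * pi)%R[) g (cis t))%E.
Proof.
move=> mg g0.
have pi0 := pi_gt0 R.
have i0 : 0 <= (2 * pi)^-1 :> R by rewrite invr_ge0 mulr_ge0// ltW.
rewrite integral_mkcond.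
rewrite (@ge0_integral_weight _ _ _ _ _ (@lebesgue_measure R) (circle_measure R)
   (@cis R : measurableTypeR R -> borelC R)
   (fun t => (2 * pi)^-1 * \1_(`[0, 2 * pi[ : set R) t)); last first.
- by move=> y; rewrite patchE; case: ifP.
- by apply/(measurable_restrictT _ _).1 => //; exact: measurable_unit_circle.
- move=> A mA; rewrite /= /circle_measure.
  under eq_integral do rewrite -mulrA EFinM.
  have mI : measurable_fun setT (fun x : measurableTypeR R =>
      (\1_(`[0, 2 * pi[ : set R) x * \1_A (cis x : borelC R) : R)).
    apply: measurable_funM; first exact: measurable_indic.
    exact: (measurableT_comp (measurable_indic mA) (@measurable_cis R)).
  rewrite ge0_integralZl ?lee_fin//; last first.
    exact/measurable_EFinP.
  congr (_ * _)%E.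
  have mcA : measurable (@cis R @^-1` A : set (measurableTypeR R)).
    by rewrite -[X in measurable X]setTI; exact: measurable_cis.
  transitivity (\int[@lebesgue_measure R]_x
      (\1_(@cis R @^-1` A `&` `[0%R, (2 * pi)%R[) x)%:E)%E.
    by rewrite integral_indic ?setIT//; exact: measurableI.
  by apply: eq_integral => x _; rewrite indicI/= mulrC.
- by move=> x; rewrite mulr_ge0.
- by apply: measurable_funM => //; exact: measurable_indic.
- exact: measurable_cis.
rewrite [in RHS]integral_indicM -ge0_integralZl//; last 2 first.
- apply: emeasurable_funM; first by apply/measurable_EFinP; exact: measurable_indic.
  apply: (@measurable_comp _ _ _ _ _ _ (T : set (borelC R))) => //.
  - exact: measurable_unit_circle.
  - by move=> _ [t _ <-]; exact: cmod_cis.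
  - exact: measurable_cis.
- by move=> t _; rewrite mule_ge0// lee_fin.
apply: eq_integral => t _; rewrite EFinM -muleA; congr (_ * (_ * _))%E.
by rewrite patchE mem_set//; exact: cmod_cis.
Qed.

Lemma ge0_integral_circle_lty (g : borelC R -> \bar R) :
  measurable_fun (T : set (borelC R)) g -> (forall x, 0 <= g x)%E ->
  (\int[circle_measure R]_(x in T) g x < +oo)%E =
  (\int[@lebesgue_measure R]_(t in `[0%R, (2 * pi)%R[) g (cis t) < +oo)%E.
Proof.
move=> mg g0; rewrite ge0_integral_circle//.
have c0 : 0 < (2 * pi)^-1 :> R by rewrite invr_gt0 mulr_gt0// pi_gt0.
have : (0 <= \int[@lebesgue_measure R]_(t in `[0%R, (2 * pi)%R[) g (cis t))%E.
  exact: integral_ge0.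
case: (\int[_]_(_ in _) _)%E => [r| |]// _; first by rewrite -EFinM !ltry.
by rewrite gt0_muley ?lte_fin.
Qed.

End complex_measurability.

(** * The Herglotz integral *)

Section singular_inner_derivative.
Context (R : realType) (mu : {finite_measure set (borelC R) -> \bar R}).
Local Open Scope complex_scope.
Local Notation Re := (@complex.Re R).
Local Notation Im := (@complex.Im R).
Local Notation T := (unit_circle R).
Local Notation mass := (fine (mu T)).
Implicit Types (z w zeta h : CC R) (g : CC R -> CC R).

Lemma mu_circle_fin : (mu T < +oo)%E.
Proof.
by rewrite ltey_eq fin_num_measure//; exact: measurable_unit_circle.
Qed.

Lemma mass_ge0 : 0 <= mass. Proof. exact: fine_ge0. Qed.

Lemma bounded_integrable (f : borelC R -> R) (M : R) :
  measurable_fun [set: borelC R] f -> (forall x, T x -> `|f x| <= M) ->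
  mu.-integrable T (EFin \o f).
Proof.
move=> mf fM; have mT := @measurable_unit_circle R.
apply: (@le_integrable _ _ _ mu T _ _ (cst M%:E)) => //.
- by apply/measurable_EFinP; exact: measurable_funTS.
- by move=> x Tx /=; rewrite lee_fin (le_trans (fM x Tx))// ler_norm.
- exact: (@finite_measure_integrable_cst _ _ R mu (T : set (borelC R)) M mT).
Qed.

Definition cintegrable g :=
  mu.-integrable (T : set (borelC R)) (fun x => (Re (g x))%:E) /\
  mu.-integrable (T : set (borelC R)) (fun x => (Im (g x))%:E).

Lemma cintegrable_bounded g M : cmeasurable (g : borelC R -> CC R) ->
  (forall x, T x -> cmod (g x) <= M) -> cintegrable g.
Proof.
move=> [mr mi] gM; split; apply: (bounded_integrable (M := M)) => // x Tx.
  exact: le_trans (abs_Re_le _) (gM x Tx).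
exact: le_trans (abs_Im_le _) (gM x Tx).
Qed.

Lemma cintegralB g1 g2 : cintegrable g1 -> cintegrable g2 ->
  cintegral mu T (fun x => g1 x - g2 x) = cintegral mu T g1 - cintegral mu T g2.
Proof.
move=> [r1 i1] [r2 i2]; have mT := @measurable_unit_circle R.
apply: complex_ext; rewrite ?ReB ?ImB/=.
  by rewrite -RintegralB//; apply: eq_Rintegral => x _; rewrite ReB.
by rewrite -RintegralB//; apply: eq_Rintegral => x _; rewrite ImB.
Qed.

Lemma cintegralZ c g : cintegrable g ->
  cintegral mu T (fun x => c * g x) = c * cintegral mu T g.
Proof.
move=> [r1 i1]; have mT := @measurable_unit_circle R.
have iZ (a : R) (f : borelC R -> R) : mu.-integrable T (EFin \o f) ->
    mu.-integrable T (EFin \o (fun x => a * f x)).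
  by move=> If; have := integrableZl mT a If.
apply: complex_ext; rewrite ?ReM ?ImM/=.
  rewrite -!RintegralZl// -RintegralB//; try exact: iZ.
  by apply: eq_Rintegral => x _; rewrite ReM.
rewrite -!RintegralZl// -RintegralD//; try exact: iZ.
by apply: eq_Rintegral => x _; rewrite ImM.
Qed.

Lemma cintegrable_sub g1 g2 : cintegrable g1 -> cintegrable g2 ->
  cintegrable (fun x => g1 x - g2 x).
Proof.
move=> [r1 i1] [r2 i2]; have mT := @measurable_unit_circle R; split.
  under eq_fun do rewrite ReB EFinB.
  exact: integrableB.
under eq_fun do rewrite ImB EFinB.
exact: integrableB.
Qed.

Lemma cintegrable_scale c g : cintegrable g -> cintegrable (fun x => c * g x).
Proof.
move=> [r1 i1]; have mT := @measurable_unit_circle R; split.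
  under eq_fun do rewrite ReM EFinB !EFinM.
  by apply: integrableB => //; exact: integrableZl.
under eq_fun do rewrite ImM EFinD !EFinM.
by apply: integrableD => //; exact: integrableZl.
Qed.

Lemma eq_cintegral g1 g2 : (forall x, T x -> g1 x = g2 x) ->
  cintegral mu T g1 = cintegral mu T g2.
Proof.
move=> g12; apply: complex_ext => /=; apply: eq_Rintegral => x;
  by rewrite inE => Tx; rewrite g12.
Qed.

Lemma abs_Rintegral_le (f : borelC R -> R) (M : R) :
  measurable_fun [set: borelC R] f -> (forall x, T x -> `|f x| <= M) ->
  `|\int[mu]_(x in T) f x| <= M * mass.
Proof.
move=> mf fM; have mT := @measurable_unit_circle R.
have intf := bounded_integrable mf fM.
apply: le_trans (le_normr_Rintegral mT intf) _.
rewrite -(Rintegral_cst mu mT M); apply: le_Rintegral => //.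
- exact: integrable_norm.
- exact: (@finite_measure_integrable_cst _ _ R mu (T : set (borelC R)) M mT).
Qed.

(** The factor 2 comes from estimating the two parts of the integral separately;
    it is harmless since the bound only serves to show that error terms vanish. *)
Lemma cmod_cintegral_le g M : cmeasurable (g : borelC R -> CC R) ->
  (forall x, T x -> cmod (g x) <= M) ->
  cmod (cintegral mu T g) <= 2 * M * mass.
Proof.
move=> [mr mi] gM; apply: le_trans (cmod_le_ReIm _) _ => /=.
rewrite mulr2n 2!mulrDl mul1r; apply: lerD; apply: abs_Rintegral_le => // x Tx.
  exact: le_trans (abs_Re_le _) (gM x Tx).
exact: le_trans (abs_Im_le _) (gM x Tx).
Qed.

(** S_mu = exp (- [herglotz]), and [dherglotz] is the complex derivative of
    [herglotz]. *)
Definition herglotz z : CC R := cintegral mu T (fun xi => (xi + z) / (xi - z)).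
Definition dherglotz z : CC R := cintegral mu T (fun xi => 2 * xi / (xi - z) ^+ 2).

Lemma cmeasurable_herglotz z :
  cmeasurable (fun xi : borelC R => ((xi : CC R) + z) / ((xi : CC R) - z)).
Proof.
have mi := @cmeasurable_id R.
apply: cmeasurableM; first exact: cmeasurableD (cmeasurable_cst _ _).
by apply: cmeasurableV; exact: cmeasurableB (cmeasurable_cst _ _).
Qed.

Lemma cmeasurable_dherglotz z :
  cmeasurable (fun xi : borelC R => 2 * (xi : CC R) / ((xi : CC R) - z) ^+ 2).
Proof.
have mi := @cmeasurable_id R.
apply: cmeasurableM; first exact: cmeasurableM (cmeasurable_cst _ _) _.
apply: cmeasurableV.
by apply: cmeasurableM; exact: cmeasurableB (cmeasurable_cst _ _).
Qed.

Lemma circle_dist_ge xi z : T xi -> 1 - cmod z <= cmod (xi - z).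
Proof. by move=> <-; exact: le_cmodB. Qed.

Lemma circle_neq xi z : T xi -> cmod z < 1 -> xi - z != 0.
Proof.
move=> Tx z1; rewrite -cmod_gt0; apply: lt_le_trans (circle_dist_ge z Tx).
by rewrite subr_gt0.
Qed.

Lemma cmod2 : cmod (2 : CC R) = 2.
Proof.
have -> : (2 : CC R) = (2 : R)%:C by rewrite rmorph_nat.
by rewrite cmod_real ger0_norm.
Qed.

Lemma cintegrable_herglotz z : cmod z < 1 ->
  cintegrable (fun xi => (xi + z) / (xi - z)).
Proof.
move=> z1; apply: (@cintegrable_bounded _ (2 / (1 - cmod z))).
  exact: cmeasurable_herglotz.
move=> x Tx; rewrite cmodM cmodV ler_pM ?invr_ge0 ?cmod_ge0//.
  rewrite (le_trans (le_cmodD _ _))// (_ : cmod x = 1)//.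
  by rewrite mulr2n lerD2l ltW.
rewrite lef_pV2 ?posrE ?subr_gt0//; first exact: circle_dist_ge.
by rewrite cmod_gt0 circle_neq.
Qed.

Lemma cintegrable_dherglotz z : cmod z < 1 ->
  cintegrable (fun xi => 2 * xi / (xi - z) ^+ 2).
Proof.
move=> z1; apply: (@cintegrable_bounded _ (2 / (1 - cmod z) ^+ 2)).
  exact: cmeasurable_dherglotz.
move=> x Tx; rewrite cmodM cmodV !cmodM cmod2 -expr2 (_ : cmod x = 1)// mulr1.
rewrite ler_wpM2l// lef_pV2 ?posrE ?exprn_gt0 ?subr_gt0//.
  apply: lerXn2r; rewrite ?nnegrE ?cmod_ge0//; first by rewrite subr_ge0 ltW.
  exact: circle_dist_ge.
by rewrite cmod_gt0 circle_neq.
Qed.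

(** The difference of the kernels at z + h and at z, minus h times the derivative
    of the kernel, is exactly 2 h^2 xi / ((xi - z)^2 (xi - z - h)), and both factors
    of the denominator stay away from 0.  No limit has to be exchanged with the
    integral. *)
Lemma herglotz_quadratic z h : cmod z < 1 -> cmod h <= (1 - cmod z) / 2 ->
  cmod (herglotz (z + h) - herglotz z - h * dherglotz z) <=
  8 * mass / (1 - cmod z) ^+ 3 * cmod h ^+ 2.
Proof.
move=> z1 hz; set d := 1 - cmod z.
have d0 : 0 < d by rewrite subr_gt0.
have zh1 : cmod (z + h) < 1.
  by apply: le_lt_trans (le_cmodD _ _) _; rewrite -/d in hz; rewrite /d in d0 hz *; lra.
set g := fun xi : CC R => 2 * xi / ((xi - z) ^+ 2 * (xi - (z + h))).
have mg : cmeasurable (g : borelC R -> CC R).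
  have mi := @cmeasurable_id R.
  apply: cmeasurableM; first exact: cmeasurableM (cmeasurable_cst _ _) _.
  apply: cmeasurableV; apply: cmeasurableM.
    by apply: cmeasurableM; exact: cmeasurableB (cmeasurable_cst _ _).
  by exact: cmeasurableB (cmeasurable_cst _ _).
have dh : d / 2 <= 1 - cmod (z + h).
  have := le_cmodD z h; rewrite /d in hz *; lra.
have gM x : T x -> cmod (g x) <= 4 / d ^+ 3.
  move=> Tx; rewrite /g cmodM cmodV !cmodM cmod2 -expr2 (_ : cmod x = 1)// mulr1.
  have -> : 4 / d ^+ 3 = 2 / (d ^+ 2 * (d / 2)) by field; rewrite gt_eqF.
  rewrite ler_wpM2l// lef_pV2 ?posrE ?mulr_gt0 ?exprn_gt0 ?cmod_gt0 ?circle_neq ?divr_gt0//.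
  apply: ler_pM; rewrite ?sqr_ge0//; first by rewrite divr_ge0// ltW.
    apply: lerXn2r; rewrite ?nnegrE ?cmod_ge0//; first exact: ltW.
    exact: circle_dist_ge.
  exact: le_trans dh (circle_dist_ge _ Tx).
have Ig := cintegrable_bounded mg gM.
have -> : herglotz (z + h) - herglotz z - h * dherglotz z = h ^+ 2 * cintegral mu T g.
  rewrite /herglotz /dherglotz.
  have I1 := cintegrable_herglotz zh1; have I2 := cintegrable_herglotz z1.
  have I3 := cintegrable_dherglotz z1.
  rewrite -cintegralB// -cintegralZ// -cintegralB//; last 2 first.
  - exact: cintegrable_sub.
  - exact: cintegrable_scale.
  rewrite -cintegralZ//; apply: eq_cintegral => x Tx.
  have n1 := circle_neq Tx z1; have n2 := circle_neq Tx zh1.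
  rewrite /g; move: n1 n2; rewrite opprD addrA => n1 n2.
  by field; rewrite n1 n2.
rewrite cmodM expr2 cmodM -expr2 mulrC ler_wpM2r ?sqr_ge0//.
apply: le_trans (cmod_cintegral_le mg gM) _.
by rewrite le_eqVlt; apply/orP; left; apply/eqP; field; rewrite gt_eqF.
Qed.

End singular_inner_derivative.

(** * The singular inner function in the disc *)

Section singular_inner_values.
Context (R : realType) (mu : {finite_measure set (borelC R) -> \bar R}).
Local Open Scope complex_scope.
Local Notation Re := (@complex.Re R).
Local Notation Im := (@complex.Im R).
Local Notation T := (unit_circle R).
Local Notation mass := (fine (mu T)).
Local Notation S := (singular_inner mu).
Local Notation H := (herglotz mu).
Local Notation dH := (dherglotz mu).
Implicit Types (z w zeta xi h : CC R).

Definition poisson z xi : R := (1 - cmod z ^+ 2) / cmod (xi - z) ^+ 2.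

(** On the circle |xi| = 1, so that Re ((xi + z) (conj xi - conj z)) is
    1 - |z|^2. *)
Lemma Re_herglotz_kernel z xi : T xi -> Re ((xi + z) / (xi - z)) = poisson z xi.
Proof.
rewrite /unit_circle/= => Txi; rewrite /poisson.
rewrite ReM ReV ImV ReD ImD ReB ImB mulNr mulrN opprK mulrA mulrA -mulrDl.
congr (_ / _); rewrite -(expr1n _ 2) -Txi !sqr_cmod; ring.
Qed.

Definition poisson_integral z : R := \int[mu]_(xi in T) poisson z xi.

Lemma Re_herglotz z : Re (H z) = poisson_integral z.
Proof.
by apply: eq_Rintegral => xi; rewrite inE => Txi; exact: Re_herglotz_kernel.
Qed.

Lemma poisson_ge0 z xi : cmod z < 1 -> 0 <= poisson z xi.
Proof.
move=> z1; rewrite divr_ge0 ?sqr_ge0// subr_ge0 expr_le1 ?cmod_ge0//.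
exact: ltW.
Qed.

Lemma measurable_poisson z : measurable_fun [set: borelC R] (poisson z).
Proof.
apply: measurable_funM => //; apply: measurable_funV.
apply: measurable_sqr_cmod.
exact: cmeasurableB (@cmeasurable_id R) (cmeasurable_cst _ _).
Qed.

Lemma integrable_poisson z : cmod z < 1 ->
  mu.-integrable (T : set (borelC R)) (fun xi => (poisson z xi)%:E).
Proof.
move=> z1; have [Ir _] := cintegrable_herglotz mu z1.
apply: eq_integrable Ir => //; first exact: measurable_unit_circle.
by move=> xi; rewrite inE => Txi; rewrite Re_herglotz_kernel.
Qed.

Lemma EFin_poisson_integral z : cmod z < 1 ->
  (poisson_integral z)%:E = (\int[mu]_(xi in T) (poisson z xi)%:E)%E.
Proof.
move=> z1; rewrite /poisson_integral /Rintegral fineK//.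
apply: integrable_fin_num; last exact: integrable_poisson.
exact: measurable_unit_circle.
Qed.

Lemma poisson_integral_ge0 z : cmod z < 1 -> 0 <= poisson_integral z.
Proof. by move=> z1; apply: Rintegral_ge0 => xi _; exact: poisson_ge0. Qed.

(** Thus - log |S_mu| is the Poisson integral of mu. *)
Lemma cmod_singular_inner z : cmod (S z) = expR (- poisson_integral z).
Proof.
rewrite -Re_herglotz -ReN; exact: (cmod_cexp (- H z)).
Qed.

Lemma singular_inner_shift z h : S (z + h) = S z * cexp (- (H (z + h) - H z)).
Proof. by rewrite -[S z]/(cexp (- H z)) -cexpD -opprD subrKC. Qed.

(** S(z + h) = S(z) exp (- k) with k = H(z + h) - H(z); the second-order bounds
    for exp and for H show that the difference quotient is within C |h| of
    - S(z) H'(z). *)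
Lemma cderive_singular_inner z : cmod z < 1 -> cderive S z = - (S z * dH z).
Proof.
move=> z1; set d := 1 - cmod z.
have d0 : 0 < d by rewrite subr_gt0.
set K := 8 * mass / d ^+ 3.
have K0 : 0 <= K.
  by rewrite divr_ge0 ?exprn_ge0 ?(ltW d0)// mulr_ge0 ?mass_ge0.
(* [B] is a Lipschitz constant of [H] around [z]; the summand 1 makes it positive *)
set B := cmod (dH z) + K + 1.
have B0 : 0 < B by rewrite ltr_wpDl// addr_ge0// cmod_ge0.
set C := cmod (S z) * (4 * B ^+ 2 + K).
have C0 : 0 <= C.
  by rewrite mulr_ge0 ?cmod_ge0// addr_ge0// mulr_ge0// sqr_ge0.
have key h : cmod h <= 1 -> cmod h <= d / 2 -> B * cmod h <= 2^-1 ->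
    cmod (S (z + h) - S z + h * (S z * dH z)) <= C * cmod h ^+ 2.
  move=> h1 hd hB.
  have Hq := herglotz_quadratic mu z1 hd; rewrite -/d -/K in Hq.
  set k := H (z + h) - H z in Hq *.
  have kB : cmod k <= B * cmod h.
    rewrite (_ : k = (k - h * dH z) + h * dH z); last by ring.
    apply: le_trans (le_cmodD _ _) _; rewrite cmodM.
    apply: (le_trans (lerD Hq (lexx _))).
    have : K * cmod h ^+ 2 <= K * cmod h.
      by rewrite ler_wpM2l// expr2 ler_piMl ?cmod_ge0.
    rewrite /B; have := cmod_ge0 h; lra.
  have eq : S (z + h) - S z + h * (S z * dH z) =
      S z * ((cexp (- k) - 1 - (- k)) - (k - h * dH z)).
    by rewrite singular_inner_shift -/k; ring.
  rewrite eq cmodM /C -mulrA ler_wpM2l ?cmod_ge0// mulrDl.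
  apply: le_trans (le_cmodD _ _) _; rewrite cmodN; apply: lerD => //.
  have := @cmod_cexp_quadratic R (- k); rewrite cmodN => /(_ (le_trans kB hB)).
  move=> /le_trans; apply; rewrite -mulrA ler_wpM2l// -exprMn.
  by apply: lerXn2r; rewrite ?nnegrE ?cmod_ge0// mulr_ge0 ?cmod_ge0// ltW.
rewrite /cderive /derive1; apply: cvg_lim; first exact: norm_hausdorff.
apply/cvgCP => e e0.
have e'0 : 0 < Num.min (Num.min 1 (d / 2)) (Num.min (2^-1 / B) (e / (C + 1))).
  have p1 : 0 < d / 2 by rewrite divr_gt0.
  have p2 : 0 < 2^-1 / B by rewrite divr_gt0// invr_gt0.
  have p3 : 0 < e / (C + 1) by rewrite divr_gt0// ltr_wpDl.
  by rewrite !lt_min ltr01 p1 p2 p3.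
move: e'0; set e' := Num.min _ _ => e'0.
near=> h.
have h0 : h != 0 by near: h; exact: nbhs_dnbhs_neq.
have : cmod h < e'.
  rewrite -ltcR; near: h; apply: (@dnbhs0_lt _ (CC R) (e'%:C)).
  by rewrite ltcR.
rewrite !lt_min => /andP[/andP[h1 h2] /andP[h3 h4]].
have hp : 0 < cmod h by rewrite cmod_gt0.
have := key h (ltW h1) (ltW h2).
rewrite mulrC -ler_pdivlMr// => /(_ (ltW h3)) hk.
rewrite (addrC h z) [_ *: _](_ : _ = h^-1 * (S (z + h) - S z)); last by [].
rewrite -cmodN opprB opprK.
rewrite (_ : _ + _ = h^-1 * (S (z + h) - S z + h * (S z * dH z))); last first.
  by field.
rewrite cmodM cmodV mulrC ltr_pdivrMr//.
apply: le_lt_trans hk _; rewrite expr2 mulrA ltr_pM2r//.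
move: h4; rewrite ltr_pdivlMr ?ltr_wpDl// => h4.
by have := hp; nra.
Unshelve. all: by end_near. Qed.

End singular_inner_values.

(** * Boundary energy and radial limits *)

Section boundary_kernel.
Context (R : realType) (mu : {finite_measure set (borelC R) -> \bar R}).
Local Open Scope complex_scope.
Local Notation Re := (@complex.Re R).
Local Notation Im := (@complex.Im R).
Local Notation T := (unit_circle R).
Local Notation mass := (fine (mu T)).
Local Notation S := (singular_inner mu).
Local Notation H := (herglotz mu).
Local Notation dH := (dherglotz mu).
Implicit Types (z w zeta xi h : CC R).

(** The value on the diagonal is forced to be infinite, whereas the inverse of
    0 is 0 in the reals: an atom at xi must give infinite energy. *)
Definition invsq_dist xi zeta : \bar R :=
  if cmod (zeta - xi) ^+ 2 == 0 then +oo%E else (cmod (zeta - xi) ^- 2)%:E.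

(** Half the modulus of the angular derivative of S_mu, see
    [abs_angular_derivativeE]. *)
Definition boundary_energy xi : \bar R :=
  (\int[mu]_(zeta in T) invsq_dist xi zeta)%E.

Lemma invsq_dist_ge0 xi zeta : (0 <= invsq_dist xi zeta)%E.
Proof.
by rewrite /invsq_dist; case: ifP => // _; rewrite lee_fin invr_ge0 sqr_ge0.
Qed.

Lemma boundary_energy_ge0 xi : (0 <= boundary_energy xi)%E.
Proof. by apply: integral_ge0 => zeta _; exact: invsq_dist_ge0. Qed.

Lemma measurable_invsq_dist2 :
  measurable_fun [set: borelC R * borelC R]
    (fun p : borelC R * borelC R => invsq_dist p.1 p.2).
Proof.
have m2 : measurable_fun [set: borelC R * borelC R]
    (fun p => cmod ((p.2 : CC R) - (p.1 : CC R)) ^+ 2).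
  apply: measurable_sqr_cmod; apply: cmeasurableB.
    exact: (cmeasurable_comp measurable_snd (@cmeasurable_id R)).
  exact: (cmeasurable_comp measurable_fst (@cmeasurable_id R)).
apply: measurable_fun_ifT.
- by apply: measurable_fun_eqr.
- exact: measurable_cst.
- by apply/measurable_EFinP; exact: measurable_funV.
Qed.

Lemma measurable_invsq_dist xi :
  measurable_fun [set: borelC R] (invsq_dist xi).
Proof.
have mp : measurable_fun [set: borelC R]
    (fun z : borelC R => ((xi : borelC R), z)).
  by apply: measurable_fun_pairing.
exact: (measurableT_comp measurable_invsq_dist2 mp).
Qed.

Lemma measurable_boundary_energy : measurable_fun [set: borelC R] boundary_energy.
Proof.
pose f (p : borelC R * borelC R) :=
  ((\1_(T : set (borelC R)) p.2)%:E * invsq_dist p.1 p.2)%E.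
rewrite (_ : boundary_energy = fubini_F mu f); last first.
  by apply/funext => xi; rewrite /boundary_energy integral_indicM.
apply: measurable_fun_fubini_tonelli_F.
  apply: emeasurable_funM; last exact: measurable_invsq_dist2.
  apply/measurable_EFinP; apply: (measurableT_comp _ measurable_snd).
  by apply: measurable_indic; exact: measurable_unit_circle.
by move=> p; rewrite mule_ge0// ?lee_fin//; exact: invsq_dist_ge0.
Qed.

Lemma cvg_radial xi : (r%:C * xi : CC R) @[r --> (1 : R)^'-] --> (xi : CC R).
Proof.
apply/cvgCP => e e0.
have e'0 : 0 < e / (cmod xi + 1) by rewrite divr_gt0// ltr_wpDl// cmod_ge0.
near=> r.
have -> : xi - r%:C * xi = (1 - r)%:C * xi.
  by rewrite rmorphB/= mulrBl mul1r.
have r1 : r < 1 by near: r; exact: nbhs_left_lt.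
have : 1 - r < e / (cmod xi + 1) by near: r; exact: nbhs_left_ltBl.
rewrite cmodM cmod_real gtr0_norm ?subr_gt0// ltr_pdivlMr ?ltr_wpDl ?cmod_ge0//.
by apply: le_lt_trans; rewrite ler_wpM2l ?lerDl// subr_ge0 ltW.
Unshelve. all: by end_near. Qed.

Lemma cvg_ReIm (F : set_system R) (FF : Filter F) (g : R -> CC R) (l : CC R) :
  Re (g r) @[r --> F] --> Re l -> Im (g r) @[r --> F] --> Im l -> g @ F --> l.
Proof.
move=> /cvgrPdist_lt hr /cvgrPdist_lt hi; apply/cvgCP => e e0.
have e2 : 0 < e / 2 by rewrite divr_gt0.
near=> r; apply: le_lt_trans (cmod_le_ReIm _) _.
rewrite ReB ImB (splitr e) ltrD//; near: r; [exact: hr|exact: hi].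
Unshelve. all: by end_near. Qed.

Lemma cvg_Re (F : set_system R) (FF : Filter F) (g : R -> CC R) (l : CC R) :
  g @ F --> l -> Re (g r) @[r --> F] --> Re l.
Proof.
move=> /cvgCP hr; apply/cvgrPdist_lt => e e0.
apply: filterS (hr e e0) => r; apply: le_lt_trans.
by rewrite -ReB abs_Re_le.
Qed.

Lemma cvg_Im (F : set_system R) (FF : Filter F) (g : R -> CC R) (l : CC R) :
  g @ F --> l -> Im (g r) @[r --> F] --> Im l.
Proof.
move=> /cvgCP hr; apply/cvgrPdist_lt => e e0.
apply: filterS (hr e e0) => r; apply: le_lt_trans.
by rewrite -ImB abs_Im_le.
Qed.

Lemma cvg_cmod (F : set_system R) (FF : Filter F) (g : R -> CC R) (l : CC R) :
  g @ F --> l -> cmod (g r) @[r --> F] --> cmod l.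
Proof.
move=> /cvgCP hr; apply/cvgrPdist_lt => e e0.
apply: filterS (hr e e0) => r; apply: le_lt_trans.
rewrite ler_norml lerNl opprB le_cmodB andbT.
by rewrite cmodB le_cmodB.
Qed.

(** The point r xi is at distance 1 - r from xi, and no point of the circle is
    closer to it than that; so seen from zeta it is at least half as far as xi.
    This dominates every kernel at r xi by its boundary value. *)
Lemma circle_dist_radial xi zeta (r : R) : T xi -> T zeta -> 0 <= r <= 1 ->
  cmod (zeta - xi) <= 2 * cmod (zeta - r%:C * xi).
Proof.
move=> Txi Tz /andP[r0 r1].
apply: le_trans (le_cmod_dist _ _ (r%:C * xi)) _.
rewrite mulr2n mulrDl mul1r lerD2l.
have -> : r%:C * xi - xi = - ((1 - r)%:C * xi).
  by rewrite rmorphB/= mulrBl mul1r opprB.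
rewrite cmodN cmodM cmod_real ger0_norm ?subr_ge0// Txi mulr1.
apply: le_trans (circle_dist_ge _ Tz).
by rewrite cmodM cmod_real ger0_norm// Txi mulr1.
Qed.

Lemma invsq_distE xi zeta : zeta != xi ->
  invsq_dist xi zeta = (cmod (zeta - xi) ^- 2)%:E.
Proof.
by move=> zx; rewrite /invsq_dist ifF// expf_eq0/= cmod_eq0 subr_eq0; apply/negbTE.
Qed.

Lemma invsq_dist_diag xi : invsq_dist xi xi = +oo%E.
Proof. by rewrite /invsq_dist subrr (_ : cmod 0 = 0) ?expr0n ?eqxx// Normc.normc0. Qed.

Lemma integrable_invsq_dist xi : (boundary_energy xi < +oo)%E ->
  mu.-integrable (T : set (borelC R)) (invsq_dist xi).
Proof.
move=> fin; apply/integrableP; split.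
  by apply: measurable_funTS; exact: measurable_invsq_dist.
under eq_integral do rewrite gee0_abs ?invsq_dist_ge0//.
exact: fin.
Qed.

(** Finite energy excludes an atom at xi. *)
Lemma ae_neq xi : (boundary_energy xi < +oo)%E ->
  {ae mu, forall zeta : borelC R, T zeta -> (zeta : CC R) != xi}.
Proof.
move=> fin.
have := integrable_ae (@measurable_unit_circle R) (integrable_invsq_dist fin).
apply: filterS => zeta h Tz; move: (h Tz).
by apply: contraTneq => ->; rewrite invsq_dist_diag.
Qed.

(** Dominated convergence along sequences of radii tending to 1. *)
Lemma cvg_Rintegral_radial xi (f : R -> CC R -> R) (l : CC R -> R) :
  T xi -> (boundary_energy xi < +oo)%E ->
  (forall r, measurable_fun [set: borelC R] (f r)) ->
  measurable_fun [set: borelC R] l ->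
  (forall r zeta, 0 <= r < 1 -> T zeta ->
    (`|f r zeta|%:E <= 8%:E * invsq_dist xi zeta)%E) ->
  (forall zeta, T zeta -> zeta != xi -> f r zeta @[r --> 1^'-] --> l zeta) ->
  \int[mu]_(zeta in T) f r zeta @[r --> 1^'-] --> \int[mu]_(zeta in T) l zeta.
Proof.
move=> Txi fin mf ml dom cf; apply/cvg_at_leftP => u [u1 cu].
(* the domination holds for nonnegative radii only *)
pose v n := Num.max 0 (u n).
have v01 n : 0 <= v n < 1 by rewrite /v le_max lexx/= gt_max ltr01 u1.
have uv : \forall n \near \oo, u n = v n.
  have /cvgrPdist_lt/(_ 1 ltr01) := cu.
  apply: filterS => n; rewrite ger0_norm ?subr_ge0 ?(ltW (u1 n))// => h.
  by rewrite /v max_r//; lra.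
have cv : v n @[n --> \oo] --> (1 : R).
  by apply: cvg_trans cu; apply: near_eq_cvg.
have mT := @measurable_unit_circle R.
have ae_cvg : {ae mu, forall zeta : borelC R, T zeta ->
    (f (v n) zeta)%:E @[n --> \oo] --> (l zeta)%:E}.
  have := ae_neq fin; apply: filterS => zeta zx Tz.
  apply/fine_cvgP; split; first by apply: nearW.
  by have /cvg_at_leftP := cf zeta Tz (zx Tz); apply; split => // n; case/andP: (v01 n).
have dom_int : mu.-integrable (T : set (borelC R))
    (fun zeta => 8%:E * invsq_dist xi zeta)%E.
  by apply: integrableZl => //; exact: integrable_invsq_dist.
have ae_dom : {ae mu, forall zeta : borelC R, forall n : nat, T zeta ->
    (`|(f (v n) zeta)%:E| <= 8%:E * invsq_dist xi zeta)%E}.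
  by apply: aeW => zeta n Tz; rewrite abse_EFin; exact: dom.
have mfv n : measurable_fun (T : set (borelC R)) (fun zeta => (f (v n) zeta)%:E).
  by apply/measurable_EFinP; exact: measurable_funTS.
have mlT : measurable_fun (T : set (borelC R)) (fun zeta => (l zeta)%:E).
  by apply/measurable_EFinP; exact: measurable_funTS.
have [il _ ci] := dominated_convergence mT mfv mlT ae_cvg dom_int ae_dom.
have : fine (\int[mu]_(zeta in T) (f (v n) zeta)%:E)%E @[n --> \oo] -->
    \int[mu]_(zeta in T) l zeta.
  apply: fine_cvg; rewrite /Rintegral fineK//.
  exact: integrable_fin_num.
apply: cvg_trans; apply: near_eq_cvg.
by apply: filterS uv => n ->.
Qed.

End boundary_kernel.

(** * Angular derivatives where the energy is finite *)

Section boundary_values.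
Context (R : realType) (mu : {finite_measure set (borelC R) -> \bar R}).
Local Open Scope complex_scope.
Local Notation Re := (@complex.Re R).
Local Notation Im := (@complex.Im R).
Local Notation T := (unit_circle R).
Local Notation S := (singular_inner mu).
Local Notation H := (herglotz mu).
Local Notation dH := (dherglotz mu).
Local Notation J := (boundary_energy mu).
Implicit Types (z w zeta xi h : CC R).

Lemma cvg_cM (F : set_system R) (FF : Filter F) (f g : R -> CC R) (a b : CC R) :
  f r @[r --> F] --> a -> g r @[r --> F] --> b ->
  (f r * g r : CC R) @[r --> F] --> (a * b : CC R).
Proof. by move=> fa gb; exact: (@cvgM R[i] R F FF f g a b fa gb). Qed.

Lemma cvg_cV (F : set_system R) (FF : Filter F) (f : R -> CC R) (a : CC R) :
  a != 0 -> f r @[r --> F] --> a -> ((f r)^-1 : CC R) @[r --> F] --> (a^-1 : CC R).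
Proof. by move=> a0 fa; exact: (@cvgV R[i] R F FF f a a0 fa). Qed.

(** The factor 8 accommodates both kernels (xi + z) / (xi - z) and
    2 xi / (xi - z)^2. *)
Lemma cvg_cintegral_radial xi (g : CC R -> CC R -> CC R) :
  T xi -> (J xi < +oo)%E ->
  (forall z, cmeasurable (g z : borelC R -> CC R)) ->
  (forall (r : R) zeta, 0 <= r < 1 -> T zeta -> zeta != xi ->
    cmod (g (r%:C * xi) zeta) <= 8 * cmod (zeta - xi) ^- 2) ->
  (forall zeta, T zeta -> zeta != xi ->
    g (r%:C * xi) zeta @[r --> (1 : R)^'-] --> g xi zeta) ->
  cintegral mu T (g (r%:C * xi)) @[r --> (1 : R)^'-] --> cintegral mu T (g xi).
Proof.
move=> Txi fin mg dom cg.
have dom' (r : R) zeta : 0 <= r < 1 -> T zeta ->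
    ((cmod (g (r%:C * xi) zeta))%:E <= 8%:E * invsq_dist xi zeta)%E.
  move=> r01 Tz; have [->|zx] := eqVneq zeta xi.
    by rewrite invsq_dist_diag gt0_muley ?lte_fin// leey.
  by rewrite invsq_distE// -EFinM lee_fin dom.
apply: cvg_ReIm => /=.
- apply: (@cvg_Rintegral_radial _ mu xi (fun r zeta => Re (g (r%:C * xi) zeta))) => //.
  + by move=> r; case: (mg (r%:C * xi)).
  + by case: (mg xi).
  + move=> r zeta r01 Tz; apply: le_trans (dom' _ _ r01 Tz).
    by rewrite lee_fin abs_Re_le.
  + by move=> zeta Tz zx; apply: cvg_Re; exact: cg.
- apply: (@cvg_Rintegral_radial _ mu xi (fun r zeta => Im (g (r%:C * xi) zeta))) => //.
  + by move=> r; case: (mg (r%:C * xi)).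
  + by case: (mg xi).
  + move=> r zeta r01 Tz; apply: le_trans (dom' _ _ r01 Tz).
    by rewrite lee_fin abs_Im_le.
  + by move=> zeta Tz zx; apply: cvg_Im; exact: cg.
Qed.

Lemma cvg_herglotz_radial xi : T xi -> (J xi < +oo)%E ->
  H (r%:C * xi) @[r --> (1 : R)^'-] --> H xi.
Proof.
move=> Txi fin.
apply: (@cvg_cintegral_radial xi (fun z zeta => (zeta + z) / (zeta - z))) => //.
- exact: cmeasurable_herglotz.
- move=> r zeta /andP[r0 r1] Tz zx.
  have rle : 0 <= r <= 1 by rewrite r0 ltW.
  have h := circle_dist_radial Txi Tz rle.
  have c0 : 0 < cmod (zeta - xi) by rewrite cmod_gt0 subr_eq0.
  have w0 : 0 < cmod (zeta - r%:C * xi).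
    by rewrite -(@pmulr_rgt0 _ 2)//; exact: lt_le_trans h.
  have c2 : cmod (zeta - xi) <= 2.
    by rewrite (le_trans (le_cmodD _ _))// cmodN Tz Txi.
  have n2 : cmod (zeta + r%:C * xi) <= 2.
    rewrite (le_trans (le_cmodD _ _))// Tz cmodM cmod_real ger0_norm// Txi mulr1.
    by rewrite mulr2n lerD2l ltW.
  rewrite cmodM cmodV ler_pdivrMr// mulrAC ler_pdivlMr ?exprn_gt0//.
  apply: (@le_trans _ _ (2 * cmod (zeta - xi) ^+ 2)).
    by rewrite ler_wpM2r// sqr_ge0.
  rewrite expr2; nra.
- move=> zeta Tz zx; apply: cvg_cM.
    by apply: cvgD; [exact: cvg_cst|exact: cvg_radial].
  apply: cvg_cV; first by rewrite subr_eq0.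
  by apply: cvgB; [exact: cvg_cst|exact: cvg_radial].
Qed.

Lemma cvg_dherglotz_radial xi : T xi -> (J xi < +oo)%E ->
  dH (r%:C * xi) @[r --> (1 : R)^'-] --> dH xi.
Proof.
move=> Txi fin.
apply: (@cvg_cintegral_radial xi (fun z zeta => 2 * zeta / (zeta - z) ^+ 2)) => //.
- exact: cmeasurable_dherglotz.
- move=> r zeta /andP[r0 r1] Tz zx.
  have rle : 0 <= r <= 1 by rewrite r0 ltW.
  have h := circle_dist_radial Txi Tz rle.
  have c0 : 0 < cmod (zeta - xi) by rewrite cmod_gt0 subr_eq0.
  have w0 : 0 < cmod (zeta - r%:C * xi).
    by rewrite -(@pmulr_rgt0 _ 2)//; exact: lt_le_trans h.
  rewrite !expr2 cmodM cmodV !cmodM cmod2 Tz mulr1 ler_pdivrMr ?mulr_gt0//.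
  rewrite mulrAC ler_pdivlMr ?mulr_gt0//.
  nra.
- move=> zeta Tz zx; apply: cvg_cM; first exact: cvg_cst.
  have hc : (zeta - r%:C * xi : CC R) @[r --> (1 : R)^'-] --> (zeta - xi : CC R).
    by apply: cvgB; [exact: cvg_cst|exact: cvg_radial].
  apply: cvg_cV; first by rewrite expf_eq0/= subr_eq0.
  exact: cvg_cM.
Qed.

Lemma cvg_cexp (F : set_system R) (FF : Filter F) (f : R -> CC R) (a : CC R) :
  f r @[r --> F] --> a -> cexp (f r) @[r --> F] --> cexp a.
Proof.
move=> fa; have fr := cvg_Re FF fa; have fi := cvg_Im FF fa.
have cre : expR (Re (f r)) @[r --> F] --> expR (Re a).
  by apply: (cvg_comp _ _ fr); exact: continuous_expR.
have hr w : Re (cexp w) = expR (Re w) * cos (Im w) by rewrite cexpE.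
have hi w : Im (cexp w) = expR (Re w) * sin (Im w) by rewrite cexpE.
apply: cvg_ReIm.
  under eq_fun do rewrite hr.
  by rewrite hr; apply: cvgM => //; apply: (cvg_comp _ _ fi); exact: continuous_cos.
under eq_fun do rewrite hi.
by rewrite hi; apply: cvgM => //; apply: (cvg_comp _ _ fi); exact: continuous_sin.
Qed.

(** For zeta and xi on the circle, |zeta - xi|^2 is
    (zeta - xi) (1 / zeta - 1 / xi) = - (zeta - xi)^2 / (zeta xi).  Hence the kernel
    2 zeta / (zeta - xi)^2 has the constant argument of - 1 / xi, and there is no
    cancellation in the integral. *)
Lemma cmod_dherglotz_boundary xi : T xi -> (J xi < +oo)%E ->
  (cmod (dH xi))%:E = (2%:E * J xi)%E.
Proof.
move=> Txi fin; have mT := @measurable_unit_circle R.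
pose kr zeta : R := cmod (zeta - xi) ^- 2.
have xi0 : xi != 0 by rewrite -cmod_gt0 Txi.
have conjV zeta : T zeta -> zeta^*%C = zeta^-1.
  move=> Tz; rewrite invc_norm.
  have -> : `|zeta| = (cmod zeta)%:C :> R[i] by [].
  by rewrite Tz expr1n invr1 mul1r.
have mkr : measurable_fun [set: borelC R] kr.
  apply: measurable_funV; apply: measurable_sqr_cmod.
  exact: cmeasurableB (@cmeasurable_id R) (cmeasurable_cst _ _).
have Jkr : (\int[mu]_(zeta in T) (kr zeta)%:E)%E = J xi.
  apply: ae_eq_integral => //.
  - by apply/measurable_EFinP; exact: measurable_funTS.
  - by apply: measurable_funTS; exact: measurable_invsq_dist.
  - have := ae_neq fin; apply: filterS => zeta zx Tz.
    by rewrite invsq_distE// zx.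
have ikr : mu.-integrable (T : set (borelC R)) (fun zeta => (kr zeta)%:E).
  apply/integrableP; split.
    by apply/measurable_EFinP; exact: measurable_funTS.
  under eq_integral do rewrite gee0_abs ?lee_fin ?invr_ge0 ?sqr_ge0//.
  by rewrite Jkr.
have ickr : cintegrable mu (fun zeta => (kr zeta)%:C).
  split => //=; exact: integrable0.
have -> : dH xi = (- (2 / xi)) * cintegral mu T (fun zeta => (kr zeta)%:C).
  rewrite -cintegralZ//; apply: eq_cintegral => zeta Tz.
  have [->|zx] := eqVneq zeta xi.
    have -> : kr xi = 0.
      by rewrite /kr subrr (_ : cmod 0 = 0) ?expr0n ?invr0//; exact: Normc.normc0.
    by rewrite subrr expr0n/= invr0 !mulr0.
  have z0 : zeta != 0 by rewrite -cmod_gt0 Tz.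
  have zx0 : zeta - xi != 0 by rewrite subr_eq0.
  have -> : (kr zeta)%:C = ((zeta - xi) * (zeta^-1 - xi^-1))^-1 :> R[i].
    rewrite -(conjV zeta Tz) -(conjV xi Txi) -rmorphB/= -sqr_normc.
    have -> : `|zeta - xi| = (cmod (zeta - xi))%:C :> R[i] by [].
    by rewrite /kr fmorphV/= rmorphXn.
  field.
  by rewrite xi0 zx0 z0 mulN1r subr_eq0 eq_sym zx.
have -> : cintegral mu T (fun zeta => (kr zeta)%:C) = (fine (J xi))%:C.
  apply: complex_ext => /=; first by rewrite /Rintegral Jkr.
  by rewrite /Rintegral integral0.
have J0 := boundary_energy_ge0 mu xi.
rewrite cmodM cmodN cmodM cmod2 cmodV Txi invr1 mulr1 cmod_real ger0_norm ?fine_ge0//.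
by rewrite EFinM fineK// ge0_fin_numE.
Qed.

(** The Poisson kernel vanishes on the circle, so the limit of S_mu at xi is
    unimodular. *)
Lemma Re_herglotz_boundary xi : T xi -> Re (H xi) = 0.
Proof.
move=> Txi; rewrite Re_herglotz /poisson_integral.
rewrite (@eq_Rintegral _ _ _ mu T (cst 0)) ?Rintegral_cst ?mul0r//.
  exact: measurable_unit_circle.
by move=> zeta _; rewrite /poisson Txi expr1n subrr mul0r.
Qed.

Lemma cmod_radial xi (r : R) : T xi -> 0 <= r -> cmod (r%:C * xi) = r.
Proof. by move=> Txi r0; rewrite cmodM cmod_real ger0_norm// Txi mulr1. Qed.

Lemma finite_energy_angular xi : T xi -> (J xi < +oo)%E ->
  has_angular_derivative S xi /\
  cmod (cderive S (r%:C * xi)) @[r --> (1 : R)^'-] --> 2 * fine (J xi).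
Proof.
move=> Txi fin.
have cS : S (r%:C * xi) @[r --> (1 : R)^'-] --> cexp (- H xi).
  by apply: cvg_cexp; apply: cvgN; exact: cvg_herglotz_radial.
have cD : cderive S (r%:C * xi) @[r --> (1 : R)^'-] --> - (cexp (- H xi) * dH xi).
  have cSd : - (S (r%:C * xi) * dH (r%:C * xi)) @[r --> (1 : R)^'-] -->
      - (cexp (- H xi) * dH xi).
    have hm := cvg_cM _ cS (cvg_dherglotz_radial Txi fin).
    by apply: cvgN; exact: hm.
  apply: cvg_trans cSd; apply: near_eq_cvg; near=> r.
  have r0 : 0 <= r by near: r; exact: nbhs_left_ge.
  have r1 : r < 1 by near: r; exact: nbhs_left_lt.
  by rewrite cderive_singular_inner// cmod_radial.
have e1 : cmod (cexp (- H xi)) = 1.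
  by rewrite cmod_cexp ReN Re_herglotz_boundary// oppr0 expR0.
have lS := cvg_lim (@norm_hausdorff _ (CC R)) cS.
split; first split.
- exact: (cvgP _ cS).
- rewrite lS; exact: e1.
- exact: (cvgP _ cD).
have <- : cmod (dH xi) = 2 * fine (J xi).
  apply: EFin_inj; rewrite cmod_dherglotz_boundary// EFinM fineK//.
  by rewrite ge0_fin_numE// boundary_energy_ge0.
have cc := cvg_cmod _ cD.
rewrite cmodN cmodM e1 mul1r in cc; exact: cc.
Unshelve. all: by end_near. Qed.

End boundary_values.

(** * Finite energy where an angular derivative exists *)

Section angular_energy.
Context (R : realType) (mu : {finite_measure set (borelC R) -> \bar R}).
Local Open Scope complex_scope.
Local Notation Re := (@complex.Re R).
Local Notation Im := (@complex.Im R).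
Local Notation T := (unit_circle R).
Local Notation S := (singular_inner mu).
Local Notation H := (herglotz mu).
Local Notation dH := (dherglotz mu).
Local Notation J := (boundary_energy mu).
Implicit Types (z w zeta xi h : CC R).

(** Real part of the complex derivative of [herglotz] in the direction xi. *)
Lemma is_derive_poisson_radial xi (r : R) : T xi -> 0 <= r < 1 ->
  is_derive r 1 (fun s : R => poisson_integral mu (s%:C * xi))
    (Re (xi * dH (r%:C * xi))).
Proof.
move=> Txi /andP[r0 r1]; set z := r%:C * xi.
have zr : cmod z = r by exact: cmod_radial.
have z1 : cmod z < 1 by rewrite zr.
set K := 8 * fine (mu T) / (1 - cmod z) ^+ 3.
have d0 : 0 < 1 - cmod z by rewrite subr_gt0.
have K0 : 0 <= K.
  by rewrite divr_ge0 ?exprn_ge0 ?(ltW d0)// mulr_ge0 ?mass_ge0.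
set f := fun s : R => poisson_integral mu (s%:C * xi).
set D := Re (xi * dH z).
have C : h^-1 *: ((f \o shift r) (h *: (1 : R)) - f r) @[h --> 0^'] --> D.
  apply/cvgrPdist_lt => e e0.
  have e'0 : 0 < Num.min ((1 - cmod z) / 2) (e / (K + 1)).
    have p1 : 0 < (1 - cmod z) / 2 by rewrite divr_gt0.
    have p2 : 0 < e / (K + 1) by rewrite divr_gt0// ltr_wpDl.
    by rewrite lt_min p1 p2.
  move: e'0; set e' := Num.min _ _ => e'0.
  near=> h.
  have h0 : h != 0 by near: h; exact: nbhs_dnbhs_neq.
  have : `|h| < e' by near: h; exact: dnbhs0_lt.
  rewrite lt_min => /andP[h1 h2].
  have ch : cmod (h%:C * xi) = `|h| by rewrite cmodM cmod_real Txi mulr1.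
  have := @herglotz_quadratic R mu z (h%:C * xi) z1.
  rewrite ch => /(_ (ltW h1)); rewrite -/K => hq.
  have {}hq : `|f (h + r) - f r - h * D| <= K * `|h| ^+ 2.
    apply: le_trans hq; apply: le_trans (abs_Re_le _).
    rewrite !ReB !Re_herglotz /f /D /z rmorphD/= mulrDl addrC.
    rewrite [X in _ <= X](_ : _ = `|poisson_integral mu (r%:C * xi + h%:C * xi) -
        poisson_integral mu (r%:C * xi) - h * Re (xi * dH (r%:C * xi))|); last first.
      congr `|_ - _|; rewrite -mulrA.
      by rewrite [LHS]ReM/= mul0r subr0.
    by rewrite (addrC (h%:C * xi)) addrC.
  rewrite /= /GRing.scale/= mulr1.
  have -> : D - h^-1 * (f (h + r) - f r) = - (h^-1 * (f (h + r) - f r - h * D)).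
    by field.
  have hp : 0 < `|h| by rewrite normr_gt0.
  rewrite normrN normrM normfV mulrC ltr_pdivrMr//.
  apply: le_lt_trans hq _; rewrite expr2 mulrA ltr_pM2r//.
  move: h2; rewrite ltr_pdivlMr ?ltr_wpDl// => h2.
  by nra.
by split; [apply/cvg_ex; exists D|apply: cvg_lim].
Unshelve. all: by end_near. Qed.

(** Along the radius the Poisson kernel over 1 - r is at least
    (|zeta - xi| + 1 - r)^-2, which increases to |zeta - xi|^-2 as r tends to 1;
    monotone convergence then bounds the energy, atoms included. *)
Lemma finite_energy_of_poisson_bound xi (M r0 : R) : T xi -> 0 <= r0 < 1 ->
  (forall r, r0 < r < 1 -> poisson_integral mu (r%:C * xi) <= M * (1 - r)) ->
  (J xi < +oo)%E.
Proof.
move=> Txi /andP[r00 r01] bM.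
(* [eps n] plays the part of 1 - r *)
pose eps (n : nat) : R := n.+1%:R^-1.
pose g (n : nat) zeta : \bar R := (((cmod (zeta - xi) + eps n) ^+ 2)^-1)%:E.
have eps0 n : 0 < eps n by rewrite invr_gt0.
have mT := @measurable_unit_circle R.
have mg n : measurable_fun (T : set (borelC R)) (g n).
  apply/measurable_EFinP; apply: measurable_funTS.
  apply: measurable_funV; apply: measurable_funX; apply: measurable_funD => //.
  apply: measurable_cmod.
  exact: cmeasurableB (@cmeasurable_id R) (cmeasurable_cst _ _).
have g0 n zeta : T zeta -> (0 <= g n zeta)%E.
  by move=> _; rewrite lee_fin invr_ge0 sqr_ge0.
have eps_dec m n : (m <= n)%N -> eps n <= eps m.
  by move=> mn; rewrite lef_pV2 ?posrE// ler_nat.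
have gnd zeta : T zeta -> {homo (g ^~ zeta) : m n / (m <= n)%N >-> (m <= n)%E}.
  move=> _ m n mn; rewrite lee_fin.
  have := cmod_ge0 (zeta - xi) => c0.
  have e0 n' : 0 < cmod (zeta - xi) + eps n' by rewrite ltr_wpDl.
  rewrite lef_pV2 ?posrE ?exprn_gt0//.
  by apply: lerXn2r; rewrite ?nnegrE ?(ltW (e0 _))// lerD2l eps_dec.
have eps_cvg : eps n @[n --> \oo] --> (0 : R) by exact: cvg_harmonic.
have glim zeta : T zeta -> limn (g ^~ zeta) = invsq_dist xi zeta.
  move=> Tz; apply/cvg_lim => //.
  have [->|zx] := eqVneq zeta xi.
    rewrite invsq_dist_diag.
    have -> : g^~ xi = (fun n => ((n.+1%:R : R) ^+ 2)%:E).
      apply/funext => n; rewrite /g subrr (_ : cmod 0 = 0); last exact: Normc.normc0.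
      by rewrite add0r /eps exprVn invrK.
    apply/cvgeryP; apply/cvgryPge => A; near=> n.
    have h1 : A <= n.+1%:R.
      rewrite (@le_trans _ _ n%:R) ?ler_nat//.
      by near: n; exact: nbhs_infty_ger.
    rewrite (le_trans h1)// expr2 ler_peMl// ler1n//.
  rewrite invsq_distE//; apply: cvg_EFin; first exact: nearW.
  have c0 : 0 < cmod (zeta - xi) by rewrite cmod_gt0 subr_eq0.
  apply: cvgV; first by rewrite expf_neq0// gt_eqF.
  have ce : (cmod (zeta - xi) + eps n) @[n --> \oo] --> (cmod (zeta - xi) : R).
    rewrite -[X in _ --> (X : R)]addr0.
    by apply: cvgD; [exact: cvg_cst|exact: eps_cvg].
  exact: (cvgM ce ce).
have bound : \forall n \near \oo, (\int[mu]_(zeta in T) g n zeta <= M%:E)%E.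
  have : \forall n \near \oo, eps n < 1 - r0.
    have r0' : 0 < 1 - r0 by rewrite subr_gt0.
    move/cvgrPdist_lt : eps_cvg => /(_ _ r0').
    by apply: filterS => n; rewrite sub0r normrN gtr0_norm.
  apply: filterS => n en.
  pose r := 1 - eps n.
  have r1 : r0 < r < 1 by rewrite /r ltrBlDr ltrDl eps0 andbT; lra.
  have [r2 r3] := andP r1.
  have rpos : 0 <= r by rewrite (le_trans r00)// ltW.
  have rz1 : cmod (r%:C * xi) < 1 by rewrite cmod_radial.
  have key zeta : T zeta -> (g n zeta * (eps n)%:E <= (poisson (r%:C * xi) zeta)%:E)%E.
    move=> Tz; rewrite -EFinM lee_fin /poisson cmod_radial//.
    have w0 : 0 < cmod (zeta - r%:C * xi) by rewrite cmod_gt0 circle_neq.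
    have w1 : cmod (zeta - r%:C * xi) <= cmod (zeta - xi) + eps n.
      apply: le_trans (le_cmod_dist _ _ xi) _; rewrite lerD2l.
      have -> : xi - r%:C * xi = (eps n)%:C * xi.
        by rewrite /r rmorphB/= mulrBl mul1r opprB addrC subrK.
      by rewrite cmodM cmod_real gtr0_norm// Txi mulr1.
    rewrite mulrC; apply: ler_pM.
    - exact: ltW.
    - by rewrite invr_ge0 sqr_ge0.
    - by rewrite /r; have := eps0 n; rewrite /r in rpos; nra.
    - rewrite lef_pV2 ?posrE ?exprn_gt0//; last exact: lt_le_trans w1.
      by apply: lerXn2r; rewrite ?nnegrE ?(ltW w0)// (le_trans _ w1)// ltW.
  have : (\int[mu]_(zeta in T) (g n zeta * (eps n)%:E) <= (M * eps n)%:E)%E.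
    apply: (@le_trans _ _ (\int[mu]_(zeta in T) (poisson (r%:C * xi) zeta)%:E)%E).
      apply: ge0_le_integral => //.
      - by move=> zeta Tz; rewrite mule_ge0 ?g0// lee_fin ltW.
      - by apply: emeasurable_funM => //; exact: measurable_cst.
      - by apply/measurable_EFinP; apply: measurable_funTS; exact: measurable_poisson.
    rewrite -EFin_poisson_integral// lee_fin (le_trans (bM r r1))//.
    by rewrite /r opprB addrC subrK.
  rewrite ge0_integralZr//; last 2 first.
  - by move=> zeta Tz; exact: g0.
  - by rewrite lee_fin ltW.
  by rewrite EFinM lee_pmul2r ?lte_fin.
have -> : J xi = limn (fun n => \int[mu]_(zeta in T) g n zeta)%E.
  rewrite -monotone_convergence//; apply: eq_integral => zeta; rewrite inE => Tz.
  by rewrite glim.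
apply: (@le_lt_trans _ _ M%:E); last exact: ltry.
apply: lime_le => //; apply: ereal_nondecreasing_is_cvgn => m n mn.
by apply: ge0_le_integral => // zeta Tz; [exact: g0|exact: gnd].
Unshelve. all: by end_near. Qed.

(** Near the boundary |S| is close to 1 and |S'| is bounded, hence so is
    H' = - S' / S.  By the mean value theorem the Poisson integral, which tends to 0
    together with log |S|, is at most a constant times 1 - r. *)
Lemma angular_finite_energy xi : T xi -> has_angular_derivative S xi ->
  (J xi < +oo)%E.
Proof.
move=> Txi [cS Tl /cvg_ex[/= L cD]].
have cS1 : cmod (S (r%:C * xi)) @[r --> (1 : R)^'-] --> (1 : R).
  rewrite -[X in _ --> X](Tl : cmod _ = 1).
  by apply: cvg_cmod; exact: cS.
have cD1 : cmod (cderive S (r%:C * xi)) @[r --> (1 : R)^'-] --> cmod L.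
  by apply: cvg_cmod; exact: cD.
pose M := cmod L + 1.
have M0 : 0 <= M by rewrite addr_ge0// cmod_ge0.
have near1 : \forall r \near (1 : R)^'-,
    [/\ 0 <= r < 1, 2^-1 <= cmod (S (r%:C * xi)) &
        cmod (cderive S (r%:C * xi)) <= M].
  near=> r; split.
  - apply/andP; split; near: r; [exact: nbhs_left_ge|exact: nbhs_left_lt].
  - have : `|1 - cmod (S (r%:C * xi))| < 2^-1.
      by near: r; move/cvgrPdist_lt : cS1; apply; rewrite invr_gt0.
    by rewrite ltr_norml => /andP[? ?]; lra.
  - have : `|cmod L - cmod (cderive S (r%:C * xi))| < 1.
      by near: r; move/cvgrPdist_lt : cD1; apply.
    by rewrite ltr_norml /M => /andP[? ?]; lra.
have [d /= d0 Hd] := near1.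
pose r0 := Num.max 0 (1 - d).
have r001 : 0 <= r0 < 1 by rewrite /r0 le_max lexx/= gt_max ltr01 ltrBlDr ltrDl.
have good r : r0 < r < 1 -> [/\ 0 <= r < 1, 2^-1 <= cmod (S (r%:C * xi)) &
        cmod (cderive S (r%:C * xi)) <= M].
  move=> /andP[r0r r1]; apply: Hd => //=.
  move: r0r; rewrite /r0 gt_max => /andP[? ?].
  by rewrite gtr0_norm ?subr_gt0//; lra.
have dbound r : r0 < r < 1 -> `|Re (xi * dH (r%:C * xi))| <= 2 * M.
  move=> rr; have [/andP[rp r1] S2 DM] := good r rr.
  apply: le_trans (abs_Re_le _) _; rewrite cmodM Txi mul1r.
  move: DM; rewrite cderive_singular_inner ?cmod_radial// cmodN cmodM => DM.
  have := cmod_ge0 (dH (r%:C * xi)); nra.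
apply: (@finite_energy_of_poisson_bound xi (2 * M) r0) => // r rr.
have u0 : poisson_integral mu (s%:C * xi) @[s --> (1 : R)^'-] --> (0 : R).
  have h0 : ln (cmod (S (s%:C * xi))) @[s --> (1 : R)^'-] --> (0 : R).
    rewrite -[X in _ --> X](ln1 R).
    by apply: (cvg_comp _ _ cS1); exact: continuous_ln.
  have h : (- ln (cmod (S (s%:C * xi)))) @[s --> (1 : R)^'-] --> (0 : R).
    by rewrite -[X in _ --> X]oppr0; exact: cvgN.
  apply: cvg_trans h; apply: near_eq_cvg; near=> s.
  by rewrite cmod_singular_inner expRK opprK.
apply/ler_addgt0Pr => e e0.
have [s [rs s1 us]] : exists s, [/\ r < s, s < 1 & poisson_integral mu (s%:C * xi) < e].
  have : \forall s \near (1 : R)^'-, [/\ r < s, s < 1 & poisson_integral mu (s%:C * xi) < e].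
    near=> s; split.
    - by near: s; apply: nbhs_left_gt; case/andP: rr.
    - by near: s; exact: nbhs_left_lt.
    - have : `|0 - poisson_integral mu (s%:C * xi)| < e.
        by near: s; move/cvgrPdist_lt : u0; apply.
      by rewrite sub0r normrN; exact: le_lt_trans (ler_norm _).
  by move/filter_ex.
have [rr1 rr2] := andP rr.
have [r00 _] := andP r001.
have dv x : r <= x <= s -> is_derive x 1
    (fun s : R => poisson_integral mu (s%:C * xi)) (Re (xi * dH (x%:C * xi))).
  move=> /andP[rx xs]; apply: is_derive_poisson_radial => //.
  by rewrite (le_lt_trans xs)// andbT (le_trans r00)// (le_trans _ rx)// ltW.
have bv x : r <= x <= s -> `|Re (xi * dH (x%:C * xi))| <= 2 * M.
  move=> /andP[rx xs]; apply: dbound.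
  by rewrite (lt_le_trans rr1 rx) (le_lt_trans xs s1).
have := lipschitz_derive (ltW rs) dv bv.
rewrite ler_norml => /andP[h1 _].
have : 2 * M * (s - r) <= 2 * M * (1 - r).
  by rewrite ler_wpM2l ?mulr_ge0// lerD2r ltW.
lra.
Unshelve. all: by end_near. Qed.

(** Both sides are finite at the same points of the circle, with the same value.
    This also shows that the angular derivative is a Borel function. *)
Lemma abs_angular_derivativeE xi : T xi ->
  abs_angular_derivative S xi = (2%:E * J xi)%E.
Proof.
move=> Txi; rewrite /abs_angular_derivative; case: asboolP => hd.
  have fin := angular_finite_energy Txi hd.
  have [_ cv] := finite_energy_angular Txi fin.
  rewrite (cvg_lim _ cv)// EFinM fineK// ge0_fin_numE//.
  exact: boundary_energy_ge0.
have [fin|] := ltP (J xi) +oo%E.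
  by have [/hd] := finite_energy_angular Txi fin.
by rewrite leye_eq => /eqP ->; rewrite gt0_muley// lte_fin.
Qed.

End angular_energy.

(** * The logarithmic weight *)

Section logarithmic_weight.
Context (R : realType) (p : R) (p_gt0 : 0 < p).
Notation lambda := (@lebesgue_measure R).
Implicit Types s d a : R.

(** The density of the sublevel integrals at distance s from the circle. *)
Definition log_weight s : R := `|ln s| `^ (p - 1) / s.

Lemma log_weight_ge0 s : 0 <= s -> 0 <= log_weight s.
Proof. by move=> s0; rewrite divr_ge0// powR_ge0. Qed.

Lemma measurable_log_weight : measurable_fun [set: R] log_weight.
Proof.
apply: measurable_funM; last exact: measurable_funV.
apply: (measurableT_comp (measurable_powR (p - 1))).
by apply: measurableT_comp => //; exact: measurable_ln.
Qed.

(** An antiderivative is - (- ln s)^p / p. *)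
Lemma integral_log_weight d a : 0 < d -> d < a -> a < 1 ->
  (\int[lambda]_(s in `[d, a]) (log_weight s)%:E)%E =
  ((`|ln d| `^ p - `|ln a| `^ p) / p)%:E.
Proof.
move=> d0 da a1; have p0 : p != 0 by rewrite gt_eqF.
have s01 s : d <= s <= a -> 0 < s < 1.
  by move=> /andP[ds sa]; rewrite (lt_le_trans d0)//= (le_lt_trans sa).
have lnE s : 0 < s < 1 -> `|ln s| = - ln s /\ 0 < - ln s.
  by move=> s1; rewrite oppr_gt0 ln_lt0// ltr0_norm// ln_lt0.
have dF s : d <= s <= a ->
    is_derive s 1 (fun s => - (p^-1 * (- ln s) `^ p)) (log_weight s).
  move=> /s01 s1; have [ls lp] := lnE s s1.
  have [s0 _] := andP s1.
  have h1 : is_derive s 1 (fun s => - ln s) (- s^-1).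
    by apply: is_deriveN; exact: is_derive1_ln.
  have h2 := is_derive1_powR p lp.
  have h3 : is_derive s 1 ((@powR R ^~ p) \o (fun s => - ln s))
      ((p * (- ln s) `^ (p - 1)) * (- s^-1)).
    exact: (@is_derive1_comp R (@powR R ^~ p) (fun s => - ln s) s _ _ h2 h1).
  have h4 : is_derive s 1 (fun s => - (p^-1 * (- ln s) `^ p))
     (- (p^-1 * ((p * (- ln s) `^ (p - 1)) * (- s^-1)))).
    apply: is_deriveN; exact: is_deriveZ.
  apply: is_derive_eq h4 _; rewrite /log_weight ls.
  by field; rewrite p0 gt_eqF.
rewrite (integral_derive da dF); last first.
  move=> s /s01 s1; have [ls lp] := lnE s s1; have [s0 _] := andP s1.
  apply: continuousM; last by apply: continuousV; [rewrite gt_eqF|].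
  have cl : {for s, continuous (fun s => `|ln s|)}.
    apply: continuous_comp; first exact: continuous_ln.
    exact: norm_continuous.
  apply: (continuous_comp (f := fun s => `|ln s|) (g := @powR R ^~ (p - 1))) => //.
  rewrite ls; apply: differentiable_continuous; apply/derivable1_diffP.
  by apply: derivable_powR; rewrite in_itv/= lp.
have d01 : 0 < d < 1 by rewrite d0 (lt_trans da a1).
have a01 : 0 < a < 1 by rewrite a1 (lt_trans d0 da).
by rewrite (lnE d d01).1 (lnE a a01).1; congr EFin; ring.
Qed.

Lemma measurable_EFin_log_weight (D : set R) :
  measurable_fun D (fun s => (log_weight s)%:E).
Proof. by apply/measurable_EFinP; apply: measurable_funTS; exact: measurable_log_weight. Qed.

(** Substitute for the triangle inequality in L^p that also covers p < 1. *)
Lemma powRD_le (a b : R) : 0 <= a -> 0 <= b ->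
  (a + b) `^ p <= 2 `^ p * (a `^ p + b `^ p).
Proof.
move=> a0 b0; apply: (@le_trans _ _ ((2 * Num.max a b) `^ p)).
  apply: ge0_ler_powR; rewrite ?nnegrE ?(ltW p_gt0)// ?addr_ge0// ?mulr_ge0 ?le_max ?a0//.
  by rewrite mulr2n mulrDl mul1r lerD// le_max lexx ?orbT.
rewrite powRM ?le_max ?a0// ler_wpM2l ?powR_ge0//.
by case: (leP a b) => _; rewrite ?lerDr ?lerDl powR_ge0.
Qed.

(** For p < 1 the weight blows up at s = 1, the centre of the disc.  The
    Jacobian 1 - s compensates this, because - ln s >= 1 - s. *)
Lemma log_weight_outer s : 2^-1 <= s -> s < 1 ->
  (1 - s) * log_weight s <= 2 * (1 + (ln 2) `^ (p - 1)).
Proof.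
move=> s2 s1; have s0 : 0 < s by apply: lt_le_trans s2; rewrite invr_gt0.
have ls : ln s < 0 by rewrite ln_lt0// s0.
have u1 : 1 - s <= - ln s.
  have := @le_ln1Dx R (s - 1); rewrite subrKC => h; have : ln s <= s - 1.
    by apply: h; lra.
  lra.
have u2 : - ln s <= ln 2.
  by rewrite -lnV ?posrE// ler_ln ?posrE ?invr_gt0// -[leRHS]invrK lef_pV2 ?posrE ?invr_gt0.
have us : 0 < 1 - s by rewrite subr_gt0.
have key : (1 - s) * (- ln s) `^ (p - 1) <= 1 + (ln 2) `^ (p - 1).
  have [p1|p1] := leP 1 p.
    have h : (- ln s) `^ (p - 1) <= ln 2 `^ (p - 1).
      by apply: ge0_ler_powR; rewrite ?nnegrE ?subr_ge0// ?oppr_ge0 ?(ltW ls)// ln_ge0// ler1n.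
    have := powR_ge0 (- ln s) (p - 1); nra.
  have h : (- ln s) `^ (p - 1) <= (1 - s) `^ (p - 1).
    rewrite -(opprB 1 p) !powRN lef_pV2 ?posrE ?powR_gt0 ?oppr_gt0//.
    by apply: ge0_ler_powR; rewrite ?nnegrE ?subr_ge0 ?(ltW p1) ?(ltW s1)// oppr_ge0 ltW.
  have h2 : (1 - s) * (1 - s) `^ (p - 1) <= 1.
    rewrite -{1}(powRr1 (ltW us)) -powRD ?(gt_eqF us) ?implybT// subrKC.
    have : (1 - s) `^ p <= 1 `^ p.
      apply: ge0_ler_powR; rewrite ?nnegrE ?(ltW p_gt0) ?(ltW us)//.
      by rewrite gerBl ltW.
    by rewrite powR1.
  have := powR_ge0 (ln 2) (p - 1).
  have : (1 - s) * (- ln s) `^ (p - 1) <= (1 - s) * (1 - s) `^ (p - 1).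
    by rewrite ler_wpM2l// ltW.
  lra.
rewrite /log_weight ltr0_norm// mulrA ler_pdivrMr//.
have := powR_ge0 (ln 2) (p - 1); nra.
Qed.

End logarithmic_weight.

(** * Sublevel integrals in polar coordinates *)

Section sublevel_polar.
Context (R : realType) (mu : {finite_measure set (borelC R) -> \bar R}).
Context (p : R) (p_gt0 : 0 < p).
Local Open Scope complex_scope.
Local Notation T := (unit_circle R).
Local Notation S := (singular_inner mu).
Local Notation lambda := (@lebesgue_measure R).
Local Notation RR := (measurableTypeR R * measurableTypeR R)%type.

Lemma ge0_integral_onem (f : R -> \bar R) :
  measurable_fun [set: R] f -> (forall y, 0 <= f y)%E ->
  (\int[lambda]_y f y = \int[lambda]_x f (1 - x)%R)%E.
Proof.
move=> mf f0; rewrite ge0_integral_reflect//.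
rewrite (@ge0_integral_affine _ (fun x => f (- x)%R) 1 (-1))//; last first.
  by apply: (measurableT_comp mf); exact: oppr_measurable.
by apply: eq_integral => x _; rewrite mul1e mul1r opprD opprK addrC.
Qed.

Lemma cmeasurable_plane : cmeasurable (fun u : RR => u.1 +i* u.2 : CC R).
Proof. by split; [exact: measurable_fst|exact: measurable_snd]. Qed.

(** The variable is the distance s = 1 - r to the circle and the factor 1 - s is
    the Jacobian of polar coordinates. *)
Definition sublevel_radial (c : R) (xi : CC R) : \bar R :=
  (\int[lambda]_(s in `]0%R, 1%R[)
    ((1 - s) * log_weight p s * (cmod (S ((1 - s)%:C * xi)) < c)%R%:R)%:E)%E.

Lemma sublevel_radial_ge0 c xi : (0 <= sublevel_radial c xi)%E.
Proof.
apply: integral_ge0 => s /=; rewrite in_itv/= => /andP[s0 s1].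
rewrite lee_fin; apply: mulr_ge0 => //; apply: mulr_ge0.
  by rewrite subr_ge0 ltW.
by apply: log_weight_ge0; exact: ltW.
Qed.

Let abs_poisson_integral (u : RR) : \bar R :=
  (\int[mu]_(zeta in T) `|poisson (u.1 +i* u.2) zeta|%:E)%E.

Let measurable_abs_poisson_integral :
  measurable_fun [set: RR] abs_poisson_integral.
Proof.
pose f (q : RR * borelC R) : \bar R := ((\1_(T : set (borelC R)) q.2)%:E *
  `|poisson (q.1.1 +i* q.1.2) q.2|%:E)%E.
rewrite (_ : abs_poisson_integral = fubini_F mu f); last first.
  by apply/funext => u; rewrite /abs_poisson_integral integral_indicM.
apply: measurable_fun_fubini_tonelli_F; last first.
  by move=> q; rewrite mule_ge0// lee_fin.
have m1 : cmeasurable (fun q : RR * borelC R => q.1.1 +i* q.1.2 : CC R).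
  exact: (cmeasurable_comp measurable_fst cmeasurable_plane).
have m2 := cmeasurable_comp (@measurable_snd _ _ RR (borelC R)) (@cmeasurable_id R).
apply: emeasurable_funM.
  apply/measurable_EFinP; apply: (measurableT_comp _ measurable_snd).
  by apply: measurable_indic; exact: measurable_unit_circle.
apply/measurable_EFinP; apply: measurableT_comp => //.
apply: measurable_funM.
  by apply: measurable_funB => //; exact: measurable_sqr_cmod.
apply: measurable_funV; apply: measurable_sqr_cmod.
exact: (cmeasurableB m2 m1).
Qed.

Let D (c : R) : set RR := [set u | unit_disc R (u.1 +i* u.2) /\
  cmod (S (u.1 +i* u.2)) < c].

Let measurable_D c : measurable (D c).
Proof.
pose b (u : RR) := (cmod (u.1 +i* u.2 : CC R) < 1) &&
  (expR (- fine (abs_poisson_integral u)) < c).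
have SE (u : RR) : cmod (u.1 +i* u.2 : CC R) < 1 ->
    cmod (S (u.1 +i* u.2)) = expR (- fine (abs_poisson_integral u)).
  move=> u1; rewrite cmod_singular_inner; congr (expR (- _)).
  apply: eq_Rintegral => zeta _; rewrite ger0_norm//; exact: poisson_ge0.
have -> : D c = b @^-1` [set true].
  apply/seteqP; split=> u.
    by move=> [u1 uc]; apply/andP; split; [exact: u1|rewrite -SE].
  by move=> /andP[u1 uc]; split; [exact: u1|rewrite SE].
rewrite -[X in measurable X]setTI.
suff : measurable_fun [set: RR] b by apply.
apply: measurable_and; apply: measurable_fun_ltr => //.
  exact: (measurable_cmod cmeasurable_plane).
apply: measurableT_comp; first exact: measurable_expR.
apply: measurableT_comp; first exact: oppr_measurable.
apply: measurableT_comp; last exact: measurable_abs_poisson_integral.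
exact: fine_measurable.
Qed.

Let F (c : R) (u : RR) : \bar R :=
  ((\1_(D c) u)%:E * (log_weight p (1 - cmod (u.1 +i* u.2 : CC R)))%:E)%E.

Let F_ge0 c u : (0 <= F c u)%E.
Proof.
rewrite /F indicE; case: (boolP (u \in D c)) => [|_]; last by rewrite mul0e.
by rewrite inE mul1e lee_fin => -[u1 _]; rewrite log_weight_ge0// subr_ge0 ltW.
Qed.

Let measurable_F c : measurable_fun [set: RR] (F c).
Proof.
apply: emeasurable_funM; apply/measurable_EFinP.
  by apply: measurable_indic; exact: measurable_D.
apply: (measurableT_comp (measurable_log_weight p)).
apply: measurable_funB => //; exact: (measurable_cmod cmeasurable_plane).
Qed.

Let polar_integrand_onem c (t s : R) :
  ((\1_(`]0%R, +oo[ : set R) (1 - s)%R)%:E *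
    ((1 - s)%:E * F c ((1 - s) * cos t, (1 - s) * sin t)%R) =
  (\1_(`]0%R, 1%R[ : set R) s)%:E * ((1 - s) * log_weight p s *
    (cmod (S ((1 - s)%:C * cis t)) < c)%R%:R)%:E)%E.
Proof.
have zE : ((1 - s) * cos t) +i* ((1 - s) * sin t) = (1 - s)%:C * cis t :> CC R.
  by apply: complex_ext; rewrite ?ReM ?ImM/= mul0r ?subr0 ?addr0.
rewrite !indicE !mem_setE/= !in_itv/= andbT subr_gt0.
have [s1|s1] := ltP s 1; last by rewrite andbF !mul0e.
have cz : cmod ((1 - s)%:C * cis t) = 1 - s.
  by rewrite cmodM cmod_cis mulr1 cmod_real gtr0_norm ?subr_gt0.
have DE : (((1 - s) * cos t, (1 - s) * sin t) \in D c) =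
    (0 < s) && (cmod (S ((1 - s)%:C * cis t)) < c).
  apply/idP/idP.
    move=> /set_mem[h1 h2]; apply/andP; split; last by rewrite -zE.
    by move: h1; rewrite /unit_disc -[_.1 +i* _]/(_ +i* _) zE /mkset cz gtrBl.
  move=> /andP[h1 h2]; apply: mem_set; split; last by rewrite -zE in h2.
  by rewrite /unit_disc -[_.1 +i* _]/(_ +i* _) zE /mkset cz gtrBl.
have -> : F c ((1 - s) * cos t, (1 - s) * sin t) =
    (((0 < s) && (cmod (S ((1 - s)%:C * cis t)) < c))%:R%:E *
    (log_weight p s)%:E)%E.
  by rewrite -[LHS]/(_ * (log_weight p (1 - cmod (_ +i* _)))%:E)%E zE cz opprB subrKC indicE DE.
rewrite mul1e andbT.
case: (ltP 0 s) => s0 /=; last by rewrite !mul0e mule0.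
by rewrite mul1e -!EFinM; congr EFin; ring.
Qed.

Let measurable_polar_section c (t : R) : measurable_fun [set: measurableTypeR R]
  (fun r : R => (\1_(`]0%R, +oo[ : set R) r)%:E *
    (r%:E * F c (r * cos t, r * sin t)%R))%E.
Proof.
have mp : measurable_fun [set: measurableTypeR R]
    (fun r : measurableTypeR R => (t : measurableTypeR R, r)).
  by apply: measurable_fun_pairing.
exact: (measurableT_comp (measurable_polar_integrand (@measurable_F c)) mp).
Qed.

Lemma measurable_sublevel_integrand (c t : R) :
  measurable_fun [set: measurableTypeR R] (fun s => ((\1_(`]0%R, 1%R[ : set R) s)%:E *
    ((1 - s) * log_weight p s * (cmod (S ((1 - s)%:C * cis t)) < c)%R%:R)%:E)%E).
Proof.
under eq_fun do rewrite -polar_integrand_onem.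
have mo : measurable_fun [set: measurableTypeR R] (fun s : measurableTypeR R => 1 - s).
  exact: measurable_funB.
exact: (measurableT_comp (measurable_polar_section c t) mo).
Qed.

Let radial_F c t : radial (F c) t = sublevel_radial c (cis t).
Proof.
rewrite /radial integral_indicM ge0_integral_onem; last 2 first.
- exact: measurable_polar_section.
- move=> r; rewrite indicE mem_setE/= in_itv/= andbT.
  by case: ltP => r0; rewrite ?mul0e// mul1e mule_ge0// ?lee_fin ?ltW.
rewrite [RHS]integral_indicM; apply: eq_integral => s _.
exact: polar_integrand_onem.
Qed.

Lemma measurable_sublevel_radial_cis c :
  measurable_fun [set: measurableTypeR R] (fun t => sublevel_radial c (cis t)).
Proof.
rewrite (_ : (fun t => _) = radial (F c)); last first.
  by apply/funext => t; rewrite radial_F.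
apply: measurable_radial; [exact: measurable_F|exact: F_ge0].
Qed.

Lemma sublevel_integral_polar c : sublevel_integral p S c =
  (\int[lambda]_(t in `[0%R, (2 * pi)%R[) sublevel_radial c (cis t))%E.
Proof.
rewrite /sublevel_integral /area_integral integral_indicM.
rewrite (@ge0_integral_polar _ (F c) (@measurable_F c) (F_ge0 c)).
by apply: eq_integral => t _; exact: radial_F.
Qed.

End sublevel_polar.

(** * From finite entropy to convergent sublevel integrals *)

Section entropy_to_sublevel.
Context (R : realType) (mu : {finite_measure set (borelC R) -> \bar R}).
Context (p : R) (p_gt0 : 0 < p).
Local Open Scope complex_scope.
Local Notation T := (unit_circle R).
Local Notation S := (singular_inner mu).
Local Notation J := (boundary_energy mu).
Local Notation lambda := (@lebesgue_measure R).
Local Notation m := (circle_measure R).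
Implicit Types (xi zeta : CC R).

Lemma measurable_lne : measurable_fun [set: \bar R] (@lne R).
Proof.
have -> : @lne R = (fun x => if x == +oo%E then +oo%E else
    if fine x <= 0 then -oo%E else (ln (fine x))%:E).
  by apply/funext => -[r| |] //=; rewrite lexx.
have mf := @fine_measurable R setT measurableT.
apply: measurable_fun_ifT => //; first exact: measurable_fun_eqe.
apply: measurable_fun_ifT => //; first exact: measurable_fun_ler.
by apply/measurable_EFinP; apply: (measurableT_comp (@measurable_ln R)).
Qed.

(** The numerator of the Poisson kernel is at most 2 s, and its denominator is at
    least |zeta - xi|^2 / 4 by [circle_dist_radial]. *)
Lemma poisson_integral_le_energy xi (s : R) : T xi -> 0 < s < 1 ->
  ((poisson_integral mu ((1 - s)%:C * xi))%:E <= (8 * s)%:E * J xi)%E.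
Proof.
move=> Txi /andP[s0 s1]; have mT := @measurable_unit_circle R.
have s1' : 0 <= 1 - s by rewrite subr_ge0 ltW.
have cz : cmod ((1 - s)%:C * xi) = 1 - s by exact: cmod_radial.
have cz1 : cmod ((1 - s)%:C * xi) < 1 by rewrite cz gtrBl.
rewrite EFin_poisson_integral// -ge0_integralZl//; last 3 first.
- by apply: measurable_funTS; exact: measurable_invsq_dist.
- by move=> zeta _; exact: invsq_dist_ge0.
- by rewrite lee_fin mulr_ge0// ltW.
apply: ge0_le_integral => //.
- by move=> zeta _; rewrite lee_fin poisson_ge0.
- by apply/measurable_EFinP; apply: measurable_funTS; exact: measurable_poisson.
- apply: emeasurable_funM; first exact: measurable_cst.
  by apply: measurable_funTS; exact: measurable_invsq_dist.
move=> zeta Tz; have [->|zx] := eqVneq zeta xi.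
  by rewrite invsq_dist_diag gt0_muley ?leey// lte_fin mulr_gt0.
rewrite invsq_distE// -EFinM lee_fin /poisson cz.
have c0 : 0 < cmod (zeta - xi) by rewrite cmod_gt0 subr_eq0.
have w0 : 0 < cmod (zeta - (1 - s)%:C * xi) by rewrite cmod_gt0 circle_neq.
have h : cmod (zeta - xi) <= 2 * cmod (zeta - (1 - s)%:C * xi).
  by apply: circle_dist_radial => //; rewrite s1' gerBl ltW.
rewrite ler_pdivrMr ?exprn_gt0// mulrAC ler_pdivlMr ?exprn_gt0//.
have h2 : cmod (zeta - xi) ^+ 2 <= 4 * cmod (zeta - (1 - s)%:C * xi) ^+ 2.
  by rewrite !expr2; nra.
have h3 : 1 - (1 - s) ^+ 2 <= 2 * s by rewrite expr2; nra.
apply: (@le_trans _ _ (2 * s * cmod (zeta - xi) ^+ 2)).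
  by rewrite ler_wpM2r// sqr_ge0.
have s20 : 0 <= 2 * s by rewrite mulr_ge0// ltW.
have := ler_wpM2l s20 h2; lra.
Qed.

(** If |S((1 - s) xi)| < c then - ln c < 8 s J(xi), so that s exceeds a constant
    over J(xi); integrating the weight from there gives the p-th power of
    |ln J(xi)| up to constants.  If J(xi) is infinite, so is the right-hand side. *)
Lemma sublevel_radial_le (c : R) : 0 < c < 1 -> exists C1 C2 : R,
  [/\ 0 <= C1, 0 < C2 & forall t,
    (sublevel_radial mu p c (cis t) <=
     C1%:E + C2%:E * (`|lne (2%:E * J (cis t))| `^ p))%E].
Proof.
move=> /andP[c0 c1]; pose K := - ln c.
have K0 : 0 < K by rewrite oppr_gt0 ln_lt0// c0.
pose C0 : R := 2 * (1 + (ln 2) `^ (p - 1)).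
have C00 : 0 <= C0 by rewrite mulr_ge0// addr_ge0// powR_ge0.
pose C1 : R := C0 + 2 `^ p / p * (`|ln (K / 4)| `^ p).
pose C2 : R := 2 `^ p / p.
have C2pos : 0 < C2 by rewrite divr_gt0// powR_gt0.
have C1pos : 0 <= C1 by rewrite addr_ge0// mulr_ge0 ?powR_ge0// ltW.
exists C1, C2; split => // t; set xi := cis t.
have Txi : T xi by exact: cmod_cis.
have J0 := boundary_energy_ge0 mu xi.
have toy (x : \bar R) : `|lne x|%E = +oo%E ->
    (sublevel_radial mu p c xi <= C1%:E + C2%:E * (`|lne x| `^ p))%E.
  by move=> ->; rewrite poweRyr ?gt_eqF// gt0_muley ?lte_fin// addey// leey.
have : (0 <= 2%:E * J xi)%E by rewrite mule_ge0.
case E : (2%:E * J xi)%E => [r| |]; [move=> r0|by move=> _; apply: toy|by []].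
have [rpos|r_le0] := ltP 0 r; last by apply: toy; rewrite /= r_le0.
rewrite lne_EFin// abse_EFin poweR_EFin -EFinM -EFinD.
have key (s : R) : 0 < s < 1 -> cmod (S ((1 - s)%:C * xi)) < c -> K / (4 * r) < s.
  move=> s01; rewrite cmod_singular_inner => h.
  have {}h : K < poisson_integral mu ((1 - s)%:C * xi).
    have : - poisson_integral mu ((1 - s)%:C * xi) < ln c.
      by rewrite -[ltLHS]expRK ltr_ln ?posrE ?expR_gt0.
    by rewrite /K; lra.
  have h2 := poisson_integral_le_energy Txi s01.
  have h3 : ((8 * s)%:E * J xi = (4 * s * r)%:E)%E.
    by rewrite (_ : 8 * s = 4 * s * 2) ?EFinM -?muleA ?E//; ring.
  rewrite h3 lee_fin in h2.
  rewrite ltr_pdivrMr ?mulr_gt0//; lra.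
pose d := K / (4 * r).
have d0 : 0 < d by rewrite divr_gt0// mulr_gt0.
(* [h1] bounds the integrand for s >= 1/2 and [h2] below *)
pose h1 := fun s : R => (C0 * \1_(`[2^-1, 1[ : set R) s)%:E.
pose h2 := fun s : R => (\1_(`[d, 2^-1] : set R) s * log_weight p s)%:E.
have mh1 : measurable_fun setT h1.
  by apply/measurable_EFinP; apply: measurable_funM => //; exact: measurable_indic.
have mh2 : measurable_fun setT h2.
  apply/measurable_EFinP; apply: measurable_funM; first exact: measurable_indic.
  exact: measurable_log_weight.
have h10 s : (0 <= h1 s)%E by rewrite lee_fin mulr_ge0.
have h20 s : (0 <= h2 s)%E.
  rewrite lee_fin indicE mem_setE/= in_itv/=.
  case: andP => [[ds _]|_]; last by rewrite mul0r.
  by rewrite mul1r log_weight_ge0// (le_trans (ltW d0)).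
apply: (@le_trans _ _ (\int[lambda]_s (h1 s + h2 s))%E).
  rewrite /sublevel_radial integral_indicM; apply: ge0_le_integral => //.
  - move=> s _; rewrite indicE mem_setE/= in_itv/=.
    case: andP => [[s0 s1]|_]; last by rewrite mul0e.
    rewrite mul1e lee_fin; apply: mulr_ge0 => //; apply: mulr_ge0.
      by rewrite subr_ge0 ltW.
    by apply: log_weight_ge0; exact: ltW.
  - exact: measurable_sublevel_integrand.
  - exact: emeasurable_funD.
  move=> s _; rewrite indicE mem_setE/= in_itv/=.
  case: andP => [[s0 s1]|_]; last by rewrite mul0e adde_ge0.
  rewrite mul1e.
  have w0 : 0 <= log_weight p s by apply: log_weight_ge0; exact: ltW.
  have s1' : 0 <= 1 - s by rewrite subr_ge0 ltW.
  have [s2|s2] := leP 2^-1 s.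
    rewrite -[leLHS]adde0; apply: leeD => //.
    rewrite /h1 lee_fin indicE mem_setE/= in_itv/= s2 s1 mulr1.
    apply: le_trans (log_weight_outer p_gt0 s2 s1).
    apply: ler_piMr; [exact: mulr_ge0|by case: (cmod (S ((1 - s)%:C * xi)) < c)].
  case: ltP => [hc|_]; last by rewrite mulr0 adde_ge0.
  rewrite mulr1 -[leLHS]add0e; apply: leeD => //.
  have ds : d <= s by apply: ltW; apply: key => //; rewrite s0.
  rewrite /h2 lee_fin indicE mem_setE/= in_itv/= (ltW s2) ds mul1r.
  by apply: ler_piMl => //; rewrite gerBl ltW.
rewrite ge0_integralD//.
have i1 : (\int[lambda]_s h1 s <= C0%:E)%E.
  rewrite /h1; under eq_integral do rewrite EFinM.
  rewrite ge0_integralZl ?lee_fin//; last first.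
    by apply/measurable_EFinP; exact: measurable_indic.
  rewrite integral_indic//= setIT lebesgue_measure_itv/= lte_fin ifT.
    rewrite -EFinD -EFinM lee_fin ler_piMr// gerBl// invr_ge0//.
  by rewrite invf_lt1// ltr1n.
have i2 : (\int[lambda]_s h2 s <= (`|ln d| `^ p / p)%:E)%E.
  rewrite /h2; under eq_integral do rewrite EFinM.
  rewrite -(integral_indicM lambda (`[d, 2^-1] : set R) (fun s => (log_weight p s)%:E)).
  have [d2|d2] := ltP d 2^-1.
    rewrite (integral_log_weight p_gt0)//; last by rewrite invf_lt1// ltr1n.
    by rewrite lee_fin ler_pM2r ?invr_gt0// gerBl powR_ge0.
  rewrite (@integral_Sset1 _ _ _ (2^-1)) => [|s /=]; first by rewrite lee_fin divr_ge0 ?powR_ge0// ltW.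
  rewrite in_itv/= => /andP[ds s2].
  by apply/eqP; rewrite eq_le s2 (le_trans d2).
apply: le_trans (leeD i1 i2) _; rewrite -EFinD lee_fin /C1 -addrA lerD2l.
rewrite /C2 -mulrDr mulrAC ler_pM2r ?invr_gt0//.
apply: le_trans (powRD_le p_gt0 (normr_ge0 _) (normr_ge0 _)).
apply: ge0_ler_powR; rewrite ?nnegrE ?(ltW p_gt0)// ?addr_ge0//.
have -> : ln d = ln (K / 4) - ln r.
  by rewrite /d -ln_div ?posrE// ?divr_gt0//; congr ln; field; rewrite gt_eqF.
by rewrite (le_trans (ler_normB _ _)).
Qed.

Theorem entropy_sublevel_finite (c : R) : 0 < c < 1 -> finite_entropy p S ->
  (sublevel_integral p S c < +oo)%E.
Proof.
move=> c01 [_ [_ Ip]].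
have [C1 [C2 [C10 C20 hC]]] := sublevel_radial_le c01.
have pi0 := pi_gt0 R.
pose g (xi : borelC R) : \bar R := (`|lne (2%:E * J xi)| `^ p)%E.
have g0 xi : (0 <= g xi)%E by exact: poweR_ge0.
have mg : measurable_fun [set: borelC R] g.
  apply: (measurableT_comp (measurable_poweR p)).
  apply: measurableT_comp; first exact: abse_measurable.
  apply: (measurableT_comp measurable_lne).
  by apply: emeasurable_funM => //; exact: measurable_boundary_energy.
have Ig : (\int[m]_(xi in T) g xi < +oo)%E.
  apply: le_lt_trans Ip; rewrite le_eqVlt; apply/orP; left; apply/eqP.
  by apply: eq_integral => xi; rewrite inE => Txi; rewrite abs_angular_derivativeE.
rewrite ge0_integral_circle_lty// in Ig; last exact: measurable_funTS.
have mgc : measurable_fun [set: measurableTypeR R] (fun t => g (cis t)).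
  exact: (measurableT_comp mg (@measurable_cis R)).
rewrite sublevel_integral_polar.
apply: (@le_lt_trans _ _
  (\int[lambda]_(t in `[0%R, (2 * pi)%R[) (C1%:E + C2%:E * g (cis t)))%E).
  apply: ge0_le_integral => //.
  - by move=> t _; exact: sublevel_radial_ge0.
  - by apply: measurable_funTS; exact: measurable_sublevel_radial_cis.
  - apply: measurable_funTS; apply: emeasurable_funD => //.
    exact: emeasurable_funM.
have hA t : (0 <= C2%:E * g (cis t))%E by rewrite mule_ge0// lee_fin ltW.
have hM : measurable_fun (`[0%R, (2 * pi)%R[ : set (measurableTypeR R))
    (fun t => C2%:E * g (cis t))%E.
  by apply: measurable_funTS; exact: emeasurable_funM.
have mgD : measurable_fun (`[0%R, (2 * pi)%R[ : set (measurableTypeR R))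
    (fun t => g (cis t)) by exact: measurable_funTS.
have C20' : (0 <= C2%:E)%E by rewrite lee_fin ltW.
rewrite ge0_integralD// ge0_integralZl//.
rewrite lte_add_pinfty//.
  rewrite integral_cst//= lebesgue_measure_itv/= lte_fin mulr_gt0//.
  by rewrite -EFinD -EFinM ltry.
by rewrite lte_mul_pinfty// ?lee_fin ?ltW.
Qed.

End entropy_to_sublevel.

(** * Distance to a set and null sets *)

Section distance_to_set.
Context (R : realType).
Local Open Scope complex_scope.
Local Notation Re := (@complex.Re R).
Local Notation Im := (@complex.Im R).
Local Notation T := (unit_circle R).
Implicit Types (z w xi : CC R) (E : set (CC R)).

Let has_inf_dist xi E w : E w -> has_inf [set cmod (xi - w) | w in E].
Proof.
move=> Ew; split; first by exists (cmod (xi - w)), w.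
by exists 0 => _ [v _ <-]; exact: cmod_ge0.
Qed.

Lemma dist_le xi E w : E w -> dist xi E <= cmod (xi - w).
Proof.
move=> Ew; apply: ge_inf; last by exists w.
by exists 0 => _ [v _ <-]; exact: cmod_ge0.
Qed.

Lemma le_dist xi E w0 (r : R) : E w0 -> (forall w, E w -> r <= cmod (xi - w)) ->
  r <= dist xi E.
Proof.
move=> Ew h; apply: lb_le_inf; first by exists (cmod (xi - w0)), w0.
by move=> _ [w Ew' <-]; exact: h.
Qed.

Lemma dist_ge0 xi E : 0 <= dist xi E.
Proof.
have [->|/set0P[w Ew]] := eqVneq E set0.
  by rewrite /dist image_set0 inf0.
by apply: (le_dist Ew) => v _; exact: cmod_ge0.
Qed.

Lemma dist_adherent xi E w (e : R) : E w -> dist xi E < e ->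
  exists2 v, E v & cmod (xi - v) < e.
Proof.
move=> Ew he; have e0 : 0 < e - dist xi E by rewrite subr_gt0.
have [_ [v Ev <-] h] := inf_adherent e0 (has_inf_dist xi Ew).
by exists v => //; rewrite -/(dist xi E) subrKC in h.
Qed.

Lemma dist_lipschitz E w : E w -> forall xi z,
  `|dist xi E - dist z E| <= cmod (xi - z).
Proof.
move=> Ew.
have h xi z : dist xi E <= cmod (xi - z) + dist z E.
  rewrite -lerBlDl; apply: (le_dist Ew) => v Ev; rewrite lerBlDl.
  by rewrite (le_trans (dist_le _ Ev))// le_cmod_dist.
move=> xi z; rewrite ler_norml lerBlDr h andbT lerNl opprB lerBlDr.
by rewrite (le_trans (h z xi))// cmodB.
Qed.

Lemma measurable_dist E w : E w ->
  measurable_fun [set: borelC R] (fun xi : borelC R => dist xi E).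
Proof.
move=> Ew; apply: measurable_continuousC.
exact: cmod_lipschitz_continuous (dist_lipschitz Ew).
Qed.

Lemma nbhs_cmodP z (U : set (CC R)) : nbhs z U ->
  exists2 e : R, 0 < e & forall w, cmod (z - w) < e -> U w.
Proof.
move=> /nbhs_ballP[e /= e0 eU].
have [er ei] : 0 < Re e /\ e = (Re e)%:C.
  by move: e0; case: e {eU} => a b; rewrite ltcE /= => /andP[/eqP -> a0].
exists (Re e) => // w zw; apply: eU; rewrite /ball/= ei.
by rewrite -ltcR in zw.
Qed.

Lemma dist_gt0 xi E w : E w -> closed E -> ~ E xi -> 0 < dist xi E.
Proof.
move=> Ew cE nE.
have [e e0 he] : exists2 e : R, 0 < e & forall w, cmod (xi - w) < e -> (~` E) w.
  by apply: nbhs_cmodP; apply: open_nbhs_nbhs; split=> //; exact: closed_openC.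
apply: (lt_le_trans e0); apply: (le_dist Ew) => v Ev.
by rewrite leNgt; apply/negP => /he.
Qed.

(** This makes closedness free of charge: a set may be replaced by its closure
    without changing the logarithmic integral. *)
Lemma dist_closure E w xi : E w -> dist xi (closure E) = dist xi E.
Proof.
move=> Ew; apply/eqP; rewrite eq_le; apply/andP; split.
  by apply: (le_dist Ew) => v Ev; apply: dist_le; exact: subset_closure.
apply: (le_dist (subset_closure Ew)) => v Ev.
apply/ler_addgt0Pr => e e0.
have [u [Eu hu]] : (E `&` [set u | cmod (v - u) < e]) !=set0.
  apply: Ev.
  have := (@cvgCP R _ (nbhs v) (nbhs_filter v) id v).1 cvg_id e e0.
  by [].
apply: le_trans (dist_le xi Eu) _; apply: le_trans (le_cmod_dist _ _ v) _.
by rewrite lerD2l ltW.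
Qed.

Lemma open_cball z (r : R) : open [set w : CC R | cmod (w - z) < r].
Proof.
have cfl (u v : CC R) : `|cmod (u - z) - cmod (v - z)| <= cmod (u - v).
  have -> : u - v = (u - z) - (v - z) by rewrite opprB addrA subrK.
  rewrite ler_norml lerNl opprB le_cmodB andbT.
  by rewrite [leRHS]cmodB le_cmodB.
have cf := cmod_lipschitz_continuous cfl.
have -> : [set w : CC R | cmod (w - z) < r] = (fun w => cmod (w - z)) @^-1` `]-oo, r[.
  by apply/seteqP; split => w /=; rewrite in_itv.
by move/continuousP: cf; apply; exact: interval_open.
Qed.

(** Discs with rational centres and radii 1 / (n + 1) form a countable base. *)
Lemma null_of_locally_null (mu : {measure set (borelC R) -> \bar R}) (A : set (CC R)) :
  measurable (A : set (borelC R)) ->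
  (forall x, A x -> exists U : set (CC R), [/\ open U, U x & mu U = 0%E]) ->
  mu A = 0%E.
Proof.
move=> mA hA.
pose B (q : rat * rat * nat) : set (borelC R) :=
  [set w : CC R | cmod (w - (ratr q.1.1 +i* ratr q.1.2)) < q.2.+1%:R^-1].
have mB q : measurable (B q) by apply: open_measurableC; exact: open_cball.
pose N (k : nat) : set (borelC R) :=
  if unpickle k is Some q then (if mu (B q) == 0%E then B q else set0) else set0.
have mN k : measurable (N k).
  by rewrite /N; case: unpickle => // q; case: ifP.
have N0 k : mu.-negligible (N k).
  apply/negligibleP => //; rewrite /N; case: unpickle => [q|]; rewrite ?measure0//.
  by case: ifP => [/eqP //|_]; rewrite measure0.
apply: measure_negligible => //; apply: negligibleS (negligible_bigcup N0).
move=> x Ax; have [U [oU Ux U0]] := hA x Ax.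
have [e e0 he] := nbhs_cmodP (open_nbhs_nbhs (conj oU Ux)).
(* the disc of radius 1 / (n + 1) around a rational point close to [x] lies in [U] *)
have [n hn] : exists n : nat, n.+1%:R^-1 < e / 2.
  exists (Num.trunc (e / 2)^-1); rewrite invf_plt ?posrE ?divr_gt0//.
  exact: truncnS_gt.
have n0 : 0 < n.+1%:R^-1 / 2 :> R by rewrite divr_gt0// invr_gt0.
have sub_lt (y : R) : y - n.+1%:R^-1 / 2 < y by rewrite ltrBlDr ltrDl.
have [q1] := rat_in_itvoo (sub_lt (Re x)); rewrite in_itv/= => /andP[q11 q12].
have [q2] := rat_in_itvoo (sub_lt (Im x)); rewrite in_itv/= => /andP[q21 q22].
pose q := (q1, q2, n).
have xB : cmod (x - (ratr q1 +i* ratr q2)) < n.+1%:R^-1.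
  apply: le_lt_trans (cmod_le_ReIm _) _; rewrite ReB ImB/=.
  rewrite !gtr0_norm ?subr_gt0// [ltRHS]splitr ltrD// ltrBlDl -ltrBlDr//.
have BU : B q `<=` (U : set (borelC R)).
  move=> w wB; apply: he; apply: le_lt_trans (le_cmod_dist _ _ (ratr q1 +i* ratr q2)) _.
  rewrite [X in _ + X]cmodB (splitr e); apply: ltrD; first exact: (lt_trans xB hn).
  exact: (lt_trans wB hn).
have B0 : mu (B q) = 0%E.
  apply/eqP; rewrite -measure_le0 -U0; apply: le_measure; rewrite ?inE//.
  exact: open_measurableC.
exists (pickle q); first by [].
rewrite /N pickleK ifT; first exact: xB.
by apply/eqP; exact: B0.
Qed.

End distance_to_set.

(** * From a Beurling-Carleson support to finite entropy *)

Section support_to_entropy.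
Context (R : realType) (mu : {finite_measure set (borelC R) -> \bar R}).
Context (p : R) (p_gt0 : 0 < p).
Hypothesis mu_neq0 : mu (unit_circle R) != 0%E.
Local Open Scope complex_scope.
Local Notation T := (unit_circle R).
Local Notation S := (singular_inner mu).
Local Notation J := (boundary_energy mu).
Local Notation mass := (fine (mu T)).
Local Notation lambda := (@lebesgue_measure R).
Local Notation m := (circle_measure R).
Implicit Types (xi zeta : CC R) (E : set (CC R)).

Let muT : mu T = mass%:E.
Proof. by rewrite fineK// ge0_fin_numE//; exact: mu_circle_fin. Qed.

Lemma mass_gt0 : 0 < mass.
Proof.
rewrite lt_def mass_ge0 andbT; apply: contra mu_neq0 => /eqP m0.
by rewrite muT m0.
Qed.

Lemma support_null E : closed E -> measure_support mu `<=` E -> mu (~` E) = 0%E.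
Proof.
move=> cE sE; apply: null_of_locally_null.
  by apply: measurableC; exact: closed_measurableC.
move=> x nEx; apply: contrapT => h; apply: nEx; apply: sE => U oU Ux.
by apply/eqP => U0; apply: h; exists U.
Qed.

Lemma boundary_energy_ge xi : T xi -> ((mass / 4)%:E <= J xi)%E.
Proof.
move=> Txi; have mT := @measurable_unit_circle R.
have -> : (mass / 4)%:E = (\int[mu]_(zeta in T) (4^-1)%:E)%E.
  by rewrite integral_cst// [X in (_ * X)%E]muT -EFinM mulrC.
apply: ge0_le_integral => //.
- by apply: measurable_funTS; exact: measurable_invsq_dist.
move=> zeta Tz; have [->|zx] := eqVneq zeta xi.
  by rewrite invsq_dist_diag leey.
rewrite invsq_distE// lee_fin.
have c0 : 0 < cmod (zeta - xi) by rewrite cmod_gt0 subr_eq0.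
rewrite lef_pV2 ?posrE ?exprn_gt0//.
have : cmod (zeta - xi) <= 2.
  by rewrite (le_trans (le_cmodD _ _))// cmodN Tz Txi.
by rewrite expr2; nra.
Qed.

Lemma boundary_energy_le xi E w : E w -> measurable (E : set (borelC R)) ->
  mu (~` E) = 0%E -> 0 < dist xi E ->
  (J xi <= (mass / dist xi E ^+ 2)%:E)%E.
Proof.
move=> Ew mE E0 d0; have mT := @measurable_unit_circle R.
have -> : (mass / dist xi E ^+ 2)%:E =
    (\int[mu]_(zeta in T) ((dist xi E ^+ 2)^-1)%:E)%E.
  by rewrite integral_cst// [X in (_ * X)%E]muT -EFinM mulrC.
apply: ae_ge0_le_integral => //.
- by move=> zeta _; exact: invsq_dist_ge0.
- by apply: measurable_funTS; exact: measurable_invsq_dist.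
- by move=> zeta _; rewrite lee_fin invr_ge0 sqr_ge0.
exists (~` E); split=> //; first exact: measurableC.
move=> zeta /=; apply: contra_not => Ez Tz.
have dz : dist xi E <= cmod (zeta - xi).
  by rewrite cmodB; apply: dist_le; apply: contrapT.
have c0 : 0 < cmod (zeta - xi) by apply: lt_le_trans dz.
rewrite invsq_distE; last by rewrite -subr_eq0 -cmod_gt0.
rewrite lee_fin lef_pV2 ?posrE ?exprn_gt0//.
by apply: lerXn2r; rewrite ?nnegrE ?(ltW d0) ?(ltW c0).
Qed.

Lemma circle_measure_lty : (m T < +oo)%E.
Proof.
have c0 : 0 < (2 * pi)^-1 :> R by rewrite invr_gt0 mulr_gt0// pi_gt0.
rewrite /circle_measure; apply: lte_mul_pinfty.
- by rewrite lee_fin ltW.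
- by [].
apply: (@le_lt_trans _ _ (lambda `[0%R, (2 * pi)%R[)).
  apply: le_measure; rewrite ?inE//.
  apply: measurableI => //; rewrite -[X in measurable X]setTI.
  by apply: measurable_cis => //; exact: measurable_unit_circle.
by rewrite lebesgue_measure_itv/= lte_fin mulr_gt0 ?pi_gt0// -EFinD ltry.
Qed.

(** With d = dist(xi, E), the energy lies between mass / 4 and mass / d^2. *)
Lemma log_energy_le E w : E w -> measurable (E : set (borelC R)) ->
  mu (~` E) = 0%E -> exists C1 C2 : R, [/\ 0 <= C1, 0 < C2 & forall xi, T xi ->
    (`|lne (2%:E * J xi)| `^ p <= C1%:E + C2%:E * (`|lne (dist xi E)%:E| `^ p))%E].
Proof.
move=> Ew mE E0; have M0 := mass_gt0.
pose C := `|ln (2 * mass)| + `|ln (mass / 2)|.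
have C0 : 0 <= C by rewrite addr_ge0.
pose C1 := 2 `^ p * C `^ p.
pose C2 := 2 `^ p * 2 `^ p.
have C20 : 0 < C2 by rewrite mulr_gt0// powR_gt0.
have C10 : 0 <= C1 by rewrite mulr_ge0// powR_ge0.
exists C1, C2; split => // xi Txi.
have := dist_ge0 xi E; rewrite le_eqVlt => /orP[/eqP <-|d0].
  have -> : `|lne (0%R%:E : \bar R)|%E = +oo%E by rewrite /= lexx.
  rewrite poweRyr ?gt_eqF// gt0_muley ?lte_fin//.
  by rewrite addey// leey.
have Jle := boundary_energy_le Ew mE E0 d0.
have Jge := boundary_energy_ge Txi.
have Jfin : J xi \is a fin_num.
  by rewrite ge0_fin_numE ?boundary_energy_ge0// (le_lt_trans Jle)// ltry.
move: Jle Jge; rewrite -(fineK Jfin) !lee_fin; set r := fine (J xi) => Jle Jge.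
have r0 : 0 < r by apply: lt_le_trans Jge; rewrite divr_gt0.
rewrite -EFinM !lne_EFin ?mulr_gt0// !abse_EFin !poweR_EFin -EFinM -EFinD lee_fin.
have lr : `|ln (2 * r)| <= C + 2 * `|ln (dist xi E)|.
  have up : ln (2 * r) <= ln (2 * mass) - 2 * ln (dist xi E).
    have -> : 2 * ln (dist xi E) = ln (dist xi E ^+ 2).
      by rewrite lnXn// mulr_natl.
    rewrite -ln_div ?posrE ?mulr_gt0 ?exprn_gt0// ler_ln ?posrE ?divr_gt0 ?mulr_gt0 ?exprn_gt0//.
    by rewrite -mulrA ler_wpM2l.
  have lo : ln (mass / 2) <= ln (2 * r).
    by rewrite ler_ln ?posrE ?mulr_gt0// ?divr_gt0//; lra.
  rewrite /C.
  have := ler_norm (ln (2 * mass)); have := ler_norm (- ln (mass / 2)).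
  have := normr_ge0 (ln (2 * mass)); have := normr_ge0 (ln (mass / 2)).
  have := ler_norm (- ln (dist xi E)); have := normr_ge0 (ln (dist xi E)).
  rewrite !normrN ler_norml => *; apply/andP; split; lra.
have d0' := normr_ge0 (ln (dist xi E)).
have : `|ln (2 * r)| `^ p <= (C + 2 * `|ln (dist xi E)|) `^ p.
  by apply: ge0_ler_powR; rewrite ?nnegrE ?(ltW p_gt0)// addr_ge0// mulr_ge0.
move=> /le_trans; apply.
apply: le_trans (powRD_le p_gt0 C0 (mulr_ge0 _ d0')) _ => //.
by rewrite powRM// mulrDr mulrA.
Qed.

Theorem support_finite_entropy E : beurling_carleson p E ->
  measure_support mu `<=` E -> finite_entropy p S.
Proof.
move=> [cE ET mE0 IE] sE.
have mE : measurable (E : set (borelC R)) by exact: closed_measurableC.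
have mT := @measurable_unit_circle R.
have E0 := support_null cE sE.
have [w Ew] : exists w, E w.
  apply: contrapT => nE; move: mu_neq0; rewrite -measure_le0.
  apply/negP; rewrite negbK -E0; apply: le_measure; rewrite ?inE//.
    exact: measurableC.
  by move=> x _ Ex; apply: nE; exists x.
have mJ : measurable_fun [set: borelC R] (fun xi => lne (2%:E * J xi))%E.
  apply: (measurableT_comp (@measurable_lne R)).
  by apply: emeasurable_funM => //; exact: measurable_boundary_energy.
have eqJ xi : T xi -> lne (abs_angular_derivative S xi) = lne (2%:E * J xi)%E.
  by move=> Txi; rewrite abs_angular_derivativeE.
split.
  exists E; split => //.
  move=> xi /= h; apply: contrapT => nE; apply: h => Txi.
  have d0 := dist_gt0 Ew cE nE.
  rewrite abs_angular_derivativeE// fin_numM// ge0_fin_numE ?boundary_energy_ge0//.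
  by rewrite (le_lt_trans (boundary_energy_le Ew mE E0 d0))// ltry.
split.
  have e : {in (T : set (borelC R)), (fun xi => lne (abs_angular_derivative S xi)) =1
      (fun xi => lne (2%:E * J xi)%E)}.
    by move=> xi; rewrite inE => Txi; rewrite eqJ.
  by apply/(measurable_fun_eqP _ e); exact: measurable_funTS.
have [C1 [C2 [C10 C20 hC]]] := log_energy_le Ew mE E0.
pose g (xi : borelC R) : \bar R := (`|lne (dist xi E)%:E| `^ p)%E.
have g0 xi : (0 <= g xi)%E by exact: poweR_ge0.
have mg : measurable_fun (T : set (borelC R)) g.
  apply: measurable_funTS; apply: (measurableT_comp (measurable_poweR p)).
  apply: measurableT_comp; first exact: abse_measurable.
  apply: (measurableT_comp (@measurable_lne R)).
  by apply/measurable_EFinP; exact: measurable_dist Ew.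
apply: (@le_lt_trans _ _ (\int[m]_(xi in T) (C1%:E + C2%:E * g xi))%E).
  rewrite (eq_integral (fun xi : borelC R => `|lne (2%:E * J xi)| `^ p)%E); last first.
    by move=> xi; rewrite inE => Txi; rewrite eqJ.
  apply: ge0_le_integral => //.
  - by move=> xi _; exact: poweR_ge0.
  - apply: measurable_funTS; apply: (measurableT_comp (measurable_poweR p)).
    by apply: measurableT_comp => //; exact: abse_measurable.
  - apply: emeasurable_funD => //; exact: emeasurable_funM.
have hA xi : (0 <= C2%:E * g xi)%E by rewrite mule_ge0// lee_fin ltW.
have hM : measurable_fun (T : set (borelC R)) (fun xi => C2%:E * g xi)%E.
  exact: emeasurable_funM.
have C20' : (0 <= C2%:E)%E by rewrite lee_fin ltW.
rewrite ge0_integralD// ge0_integralZl// lte_add_pinfty//.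
  by rewrite integral_cst// lte_mul_pinfty// circle_measure_lty.
by rewrite lte_mul_pinfty// ?lee_fin ?ltW.
Qed.

End support_to_entropy.

(** * Dyadic density of singular measures *)

Section dyadic_density.
Context (R : realType) (nu : {measure set (measurableTypeR R) -> \bar R}).
Notation lambda := (@lebesgue_measure R).

(** Upper density estimates pass to disjoint unions. *)
Lemma measure_le_bigcup (F : (set (measurableTypeR R))^nat) (A : R) : 0 <= A ->
  (forall i, measurable (F i)) -> trivIset setT F ->
  (forall i, (nu (F i) <= A%:E * lambda (F i))%E) ->
  (nu (\bigcup_i F i) <= A%:E * lambda (\bigcup_i F i))%E.
Proof.
move=> A0 mF tF h.
rewrite !measure_bigcup// -nneseriesZl; last by move=> i _; exact: measure_ge0.
by apply: lee_nneseries => // i _; exact: measure_ge0.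
Qed.

Definition dyadic_index (k : nat) (t : R) : nat := Num.truncn (2 ^+ k * t).

Definition dyadic (k j : nat) : set R :=
  [set` `[j%:R / 2 ^+ k, j.+1%:R / 2 ^+ k[].

Lemma dyadicP k j (t : R) : 0 <= t -> dyadic k j t <-> dyadic_index k t = j.
Proof.
move=> t0; rewrite /dyadic /dyadic_index/= in_itv/=.
have k0 : 0 < 2 ^+ k :> R by rewrite exprn_gt0.
rewrite ler_pdivrMr// ltr_pdivlMr// (mulrC t); split.
  by move=> h; apply: truncn_def.
by move=> <-; apply: truncn_itv; rewrite mulr_ge0// ltW.
Qed.

Lemma dyadic_ge0 k j (t : R) : dyadic k j t -> 0 <= t.
Proof.
rewrite /dyadic/= in_itv/= => /andP[h _]; apply: le_trans h.
by rewrite divr_ge0// exprn_ge0.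
Qed.

Lemma dyadic_self k (t : R) : 0 <= t -> dyadic k (dyadic_index k t) t.
Proof. by move=> t0; apply/dyadicP. Qed.

Lemma dyadic_uniq k j j' (t : R) : dyadic k j t -> dyadic k j' t -> j = j'.
Proof.
by move=> h h'; have t0 := dyadic_ge0 h; move/dyadicP: h => <- //; move/dyadicP: h' => <-.
Qed.

Lemma measurable_dyadic k j : measurable (dyadic k j : set (measurableTypeR R)).
Proof. exact: measurable_itv. Qed.

Lemma lebesgue_dyadic k j : lambda (dyadic k j) = (2 ^- k)%:E.
Proof.
have k0 : 0 < 2 ^- k :> R by rewrite invr_gt0 exprn_gt0.
rewrite lebesgue_measure_itv/= lte_fin ltr_pM2r// ltr_nat ltnSn -EFinB.
by rewrite -mulrBl -natrB// subSnn mul1r.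
Qed.

Lemma dyadic_dist k j (t t' : R) : dyadic k j t -> dyadic k j t' ->
  `|t - t'| <= 2 ^- k.
Proof.
rewrite /dyadic/= !in_itv/= -[j.+1%:R]natr1 mulrDl mul1r => /andP[a b] /andP[c d].
by rewrite ler_norml; apply/andP; split; lra.
Qed.

(** The quotient by 2^(k-i) of the index at scale k is the index at scale i. *)
Lemma dyadic_nested i k j (t t' : R) : (i <= k)%N ->
  dyadic k j t -> dyadic k j t' -> dyadic_index i t = dyadic_index i t'.
Proof.
move=> ik.
suff key s : dyadic k j s -> dyadic_index i s = (j %/ 2 ^ (k - i))%N.
  by move=> /key -> /key ->.
move=> hs; have s0 := dyadic_ge0 hs; apply/(dyadicP _ _ s0).
set q := (j %/ 2 ^ (k - i))%N.
have q1 : (q * 2 ^ (k - i) <= j)%N by exact: leq_divM.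
have q2 : (j.+1 <= q.+1 * 2 ^ (k - i))%N by rewrite ltn_ceil// expn_gt0.
have kE : 2 ^+ k = 2 ^+ i * (2 ^ (k - i))%:R :> R by rewrite natrX -exprD subnKC.
have i0 : 0 < 2 ^+ i :> R by rewrite exprn_gt0.
have m0 : 0 < (2 ^ (k - i))%:R :> R by rewrite ltr0n expn_gt0.
move: hs; rewrite /dyadic/= !in_itv/= kE => /andP[a b].
have e1 (x : R) : x / 2 ^+ i = x * (2 ^ (k - i))%:R / (2 ^+ i * (2 ^ (k - i))%:R).
  by field; rewrite !gt_eqF.
have im0 : 0 < (2 ^+ i * (2 ^ (k - i))%:R)^-1 :> R by rewrite invr_gt0 mulr_gt0.
rewrite !e1; apply/andP; split.
  by apply: le_trans a; rewrite ler_pM2r// -natrM ler_nat.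
by apply: lt_le_trans b _; rewrite ler_pM2r// -natrM ler_nat.
Qed.

(** Consider the dyadic intervals inside U on which nu is at most A times the
    length.  The maximal ones are disjoint, so that nu of their union is at most
    A |U|. *)
Lemma dyadic_cover_le (U : set R) (A : R) : 0 <= A -> open U ->
  exists C : set (measurableTypeR R), [/\ measurable C,
    (nu C <= A%:E * lambda U)%E &
    forall t, 0 <= t -> U t ->
      (forall n, exists2 k, (n <= k)%N &
        (nu (dyadic k (dyadic_index k t)) < (A * 2 ^- k)%:E)%E) -> C t].
Proof.
move=> A0 oU.
pose P k j := `[< dyadic k j `<=` U /\ (nu (dyadic k j) < (A * 2 ^- k)%:E)%E >].
pose D k j : set (measurableTypeR R) := if P k j then dyadic k j else set0.
pose cov k : set (measurableTypeR R) := \bigcup_j D k j.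
have mD k j : measurable (D k j).
  by rewrite /D; case: ifP => // _; exact: measurable_dyadic.
have mcov k : measurable (cov k) by exact: bigcup_measurable.
exists (\bigcup_k cov k); split; first exact: bigcup_measurable.
- have covU : \bigcup_k cov k `<=` U.
    move=> t [k _ [j _]]; rewrite /D; case: ifP => // /asboolP[h _]; exact: h.
  apply: (@le_trans _ _ (A%:E * lambda (\bigcup_k cov k))%E); last first.
    rewrite lee_wpmul2l ?lee_fin//; apply: le_measure; rewrite ?inE//.
      exact: bigcup_measurable.
    exact: open_measurable.
  (* at each scale, keep the intervals that no coarser one contains *)
  rewrite seqDU_bigcup_eq.
  have mX k : measurable (seqDU cov k).
    by apply: measurableD => //; apply: bigsetU_measurable.
  apply: measure_le_bigcup => // k.
  have XE : seqDU cov k = \bigcup_j (seqDU cov k `&` D k j).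
    rewrite -setI_bigcupr; apply/esym/setIidl => t [].
    by move=> [j _ Dt] _; exists j.
  rewrite XE; apply: measure_le_bigcup => //.
  + by move=> j; apply: measurableI.
  + move=> i j _ _ [t [[_ ti] [_ tj]]]; move: ti tj; rewrite /D.
    by case: ifP => // _ ti; case: ifP => // _ tj; exact: dyadic_uniq ti tj.
  + move=> j; have [->|/set0P[t [Xt Dt]]] := eqVneq (seqDU cov k `&` D k j) set0.
      by rewrite !measure0 mule0.
    have -> : seqDU cov k `&` D k j = D k j.
      apply/setIidr => t' Dt'; split; first by exists j.
      rewrite -bigcup_mkord => -[i /= ik [j' _ Dij']].
      case: Xt => _; apply; rewrite -bigcup_mkord; exists i => //; exists j' => //.
      move: Dij' Dt Dt'; rewrite /D; case: ifP => // _ ij'.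
      case: ifP => // _ kt kt'.
      apply/dyadicP; first exact: dyadic_ge0 kt.
      rewrite (dyadic_nested (ltnW ik) kt kt').
      by apply/dyadicP => //; exact: dyadic_ge0 kt'.
    move: Dt; rewrite /D; case: ifP => // /asboolP[_ h] _.
    rewrite lebesgue_dyadic -EFinM; exact: ltW.
move=> t t0 Ut ht.
have [e /= e0 eU] : nbhs_ball t U by apply/nbhs_ballP; exact: open_nbhs_nbhs.
have [n hn] : exists n : nat, 2 ^- n < e.
  exists (Num.truncn e^-1).+1; rewrite invf_plt ?posrE ?exprn_gt0//.
  apply: (lt_trans (truncnS_gt _)).
  by rewrite -natrX ltr_nat; exact: ltn_expl.
have [k nk hk] := ht n.
exists k => //; exists (dyadic_index k t) => //; rewrite /D ifT; first exact: dyadic_self.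
apply/asboolP; split=> // t' ht'; apply: eU; rewrite /ball/=.
apply: le_lt_trans (dyadic_dist (dyadic_self k t0) ht') _; apply: le_lt_trans hn.
by rewrite lef_pV2 ?posrE ?exprn_gt0// ler_weXn2l// ler1n.
Qed.

(** A measure that lives on a null set N has density at least A at all small
    dyadic scales around almost all of its points: otherwise cover N by an open set
    of small length and use [dyadic_cover_le]. *)
Lemma dyadic_density_negligible (N : set (measurableTypeR R)) (A : R) : 0 < A ->
  measurable N -> lambda N = 0%E -> nu (~` N) = 0%E ->
  nu.-negligible [set t | 0 <= t /\ forall n, exists2 k, (n <= k)%N &
        (nu (dyadic k (dyadic_index k t)) < (A * 2 ^- k)%:E)%E].
Proof.
move=> A0 mN lN nN.
have step (n : nat) : exists C : set (measurableTypeR R), [/\ measurable C,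
    (nu C <= (n.+1%:R^-1)%:E)%E &
    forall t, N t -> 0 <= t ->
      (forall n, exists2 k, (n <= k)%N &
        (nu (dyadic k (dyadic_index k t)) < (A * 2 ^- k)%:E)%E) -> C t].
  have e0 : 0 < A^-1 * n.+1%:R^-1 by rewrite mulr_gt0// invr_gt0.
  have [U [oU NU lU]] : exists U : set R, [/\ open U, N `<=` U &
      (lambda (U `\` N) < (A^-1 * n.+1%:R^-1)%:E)%E].
    apply: lebesgue_regularity_outer => //.
    by apply: (@le_lt_trans _ _ 0%E); [exact: (eq_ind_r (fun x => x <= 0)%E (lexx _) lN)|exact: ltry].
  have [C [mC nC hC]] := dyadic_cover_le (ltW A0) oU.
  exists C; split => //; last by move=> t Nt t0 h; apply: hC => //; exact: NU.
  apply: le_trans nC _.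
  have lUe : (lambda U <= (A^-1 * n.+1%:R^-1)%:E)%E.
    have mU : measurable (U : set (measurableTypeR R)) by exact: open_measurable.
    have -> : U = (U `\` N) `|` N by rewrite setUC setDUK.
    rewrite measureU//; last 2 first.
    - exact: measurableD.
    - by rewrite setDE -setIA setICl setI0.
    rewrite [X in (_ + X)%E](_ : _ = 0%E); last exact: lN.
    by rewrite adde0; exact: ltW.
  apply: (@le_trans _ _ (A%:E * (A^-1 * n.+1%:R^-1)%:E)%E).
    by rewrite lee_wpmul2l// lee_fin ltW.
  by rewrite -EFinM lee_fin mulVKf// gt_eqF.
have [C hC] := choice step.
pose M := (~` N) `|` \bigcap_n C n.
have mM : measurable M.
  apply: measurableU; first exact: measurableC.
  by apply: bigcap_measurable => // n _; case: (hC n).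
exists M; split => //.
  have mcap : measurable (\bigcap_n C n).
    by apply: bigcap_measurable => // n _; case: (hC n).
  apply/eqP; rewrite -measure_le0.
  apply: (@le_trans _ _ (nu (~` N) + nu (\bigcap_n C n))%E).
    by apply: measureU2 => //; exact: measurableC.
  rewrite nN add0e; apply/lee_addgt0Pr => e e0; rewrite add0e.
  have [n hn] : exists n : nat, n.+1%:R^-1 < e.
    by exists (Num.truncn e^-1); rewrite invf_plt ?posrE// truncnS_gt.
  have [mCn nCn _] := hC n.
  apply: (@le_trans _ _ (nu (C n))).
    by apply: le_measure; rewrite ?inE//; exact: bigcap_inf.
  by rewrite (le_trans nCn)// lee_fin ltW.
move=> t [t0 ht]; have [Nt|nNt] := pselect (N t); last by left.
by right=> n _; case: (hC n) => _ _; apply.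
Qed.

End dyadic_density.

(** * An argument function *)

Section argument.
Context (R : realType).
Local Open Scope complex_scope.
Local Notation Re := (@complex.Re R).
Local Notation Im := (@complex.Im R).
Local Notation T := (unit_circle R).
Implicit Types (z xi : CC R).

(** The half-angle formula for the tangent, applied to - z and shifted by pi so
    that the values lie in [0, 2 pi[; the formula breaks down at z = 1 only. *)
Definition carg z : R :=
  if Re z == 1 then 0 else pi + 2 * atan (- Im z / (1 - Re z)).

Lemma carg_itv z : 0 <= carg z < 2 * pi.
Proof.
rewrite /carg; have pi0 := pi_gt0 R; case: ifP => _.
  by rewrite lexx mulr_gt0.
have := atan_ltpi2 (- Im z / (1 - Re z)); have := atan_gtNpi2 (- Im z / (1 - Re z)).
by move=> ? ?; apply/andP; split; lra.
Qed.

Lemma cis_carg xi : T xi -> cis (carg xi) = xi.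
Proof.
move=> Txi; have : Re xi ^+ 2 + Im xi ^+ 2 = 1 by rewrite -sqr_cmod Txi expr1n.
rewrite /carg; case: xi {Txi} => x y /= xy.
case: eqP => [x1|/eqP x1].
  have y0 : y = 0.
    by apply/eqP; rewrite -sqrf_eq0; apply/eqP; move: xy; rewrite x1 expr1n; lra.
  by rewrite /cis cos0 sin0 x1 y0.
have x10 : 1 - x != 0 by rewrite subr_eq0 eq_sym.
set u := - y / (1 - x); set a := atan u.
have ca0 : cos a != 0.
  by rewrite gt_eqF// cos_gt0_pihalf// atan_gtNpi2 atan_ltpi2.
have ta : sin a = u * cos a.
  by have := atanK u; rewrite -/a /tan => <-; rewrite divfK.
have cu : cos a ^+ 2 * (1 + u ^+ 2) = 1.
  transitivity (cos a ^+ 2 + sin a ^+ 2); last exact: cos2Dsin2.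
  by rewrite ta; ring.
have u2 : (1 + u ^+ 2) * (1 - x) = 2.
  have yE : y ^+ 2 = 1 - x ^+ 2 by lra.
  by rewrite /u expr_div_n sqrrN yE; field.
have ca2 : cos a ^+ 2 = (1 - x) / 2.
  have : cos a ^+ 2 * 2 = 1 - x by rewrite -u2 mulrA cu mul1r.
  by lra.
have -> : pi + 2 * a = (a + a) + pi by ring.
rewrite /cis cosDpi sinDpi cosD sinD ta.
apply: complex_ext => /=.
  transitivity (cos a ^+ 2 * (1 + u ^+ 2) - 2 * cos a ^+ 2); first by ring.
  by rewrite cu ca2; field.
have -> : - (u * cos a * cos a + cos a * (u * cos a)) = - (2 * u * cos a ^+ 2) by ring.
by rewrite ca2 /u; field.
Qed.

Lemma measurable_carg : measurable_fun [set: borelC R] (carg : borelC R -> R).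
Proof.
have [mr mi] := @cmeasurable_id R.
apply: measurable_fun_ifT; first exact: measurable_fun_eqr.
  exact: measurable_cst.
apply: measurable_funD => //; apply: measurable_funM => //.
apply: measurableT_comp.
  by apply: continuous_measurable_fun; exact: continuous_atan.
apply: measurable_funM.
  exact: (measurableT_comp (@oppr_measurable R setT) mi).
by apply: measurable_funV; exact: measurable_funB.
Qed.

Lemma cis_lipschitz (a b : R) : cmod (cis a - cis b) <= 2 * `|a - b|.
Proof.
wlog ab : a b / b <= a.
  move=> h; have [|/ltW ba] := leP b a; first exact: h.
  by rewrite cmodB distrC; exact: h.
apply: le_trans (cmod_le_ReIm _) _; rewrite ReB ImB/= mulr2n mulrDl mul1r.
rewrite (ger0_norm (_ : 0 <= a - b)) ?subr_ge0//.
apply: lerD; rewrite -[leRHS]mul1r.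
  apply: (@lipschitz_derive R _ (fun x => - sin x)) => // x _.
  by rewrite normrN sin_max.
by apply: (@lipschitz_derive R _ cos) => // x _; rewrite cos_max.
Qed.

End argument.

(** * Points of high dyadic density *)

Section sublevel_to_concentration.
Context (R : realType) (mu : {finite_measure set (borelC R) -> \bar R}).
Context (p : R) (p_gt0 : 0 < p).
Local Open Scope complex_scope.
Local Notation T := (unit_circle R).
Local Notation S := (singular_inner mu).
Local Notation lambda := (@lebesgue_measure R).
Local Notation m := (circle_measure R).
Implicit Types (xi zeta : CC R).

(** On D the kernel at (1 - s) xi is at least s / (6 s)^2. *)
Lemma poisson_integral_ge (D : set (borelC R)) xi (s : R) :
  measurable D -> D `<=` T -> T xi -> 0 < s < 1 ->
  (forall zeta, D zeta -> cmod (zeta - (1 - s)%:C * xi) <= 6 * s) ->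
  ((36 * s)^-1%:E * mu D <= (poisson_integral mu ((1 - s)%:C * xi))%:E)%E.
Proof.
move=> mD DT Txi /andP[s0 s1] hD; have mT := @measurable_unit_circle R.
have s1' : 0 <= 1 - s by rewrite subr_ge0 ltW.
have cz : cmod ((1 - s)%:C * xi) = 1 - s by exact: cmod_radial.
have cz1 : cmod ((1 - s)%:C * xi) < 1 by rewrite cz gtrBl.
rewrite EFin_poisson_integral//.
have mP (A : set (borelC R)) : measurable_fun A
    (fun zeta => (poisson ((1 - s)%:C * xi) zeta)%:E).
  by apply/measurable_EFinP; apply: measurable_funTS; exact: measurable_poisson.
have P0 zeta : (0 <= (poisson ((1 - s)%:C * xi) zeta)%:E)%E.
  by rewrite lee_fin poisson_ge0.
apply: (@le_trans _ _ (\int[mu]_(zeta in D) (poisson ((1 - s)%:C * xi) zeta)%:E)%E);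
  last exact: ge0_subset_integral.
rewrite -integral_cst//; apply: ge0_le_integral => //.
  by move=> zeta _; rewrite lee_fin invr_ge0 mulr_ge0// ltW.
move=> zeta Dz; rewrite lee_fin /poisson cz.
have w0 : 0 < cmod (zeta - (1 - s)%:C * xi).
  by rewrite cmod_gt0 circle_neq//; exact: DT.
rewrite ler_pdivlMr ?exprn_gt0// mulrC ler_pdivrMr ?mulr_gt0//.
have h := hD _ Dz.
have h2 : cmod (zeta - (1 - s)%:C * xi) ^+ 2 <= 36 * s ^+ 2 by rewrite !expr2; nra.
apply: (le_trans h2); rewrite !expr2; nra.
Qed.

Let mT := @measurable_unit_circle R.

(** [carg] is defined on the whole plane, so mu is first restricted to the
    circle. *)
Definition arg_measure : {measure set (measurableTypeR R) -> \bar R} :=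
  measure_function_pushforward__canonical__measure_function_Measure
    (mrestr mu mT) (@measurable_carg R :
      measurable_fun setT (@carg R : borelC R -> measurableTypeR R)).

Lemma arg_measureE (A : set (measurableTypeR R)) :
  arg_measure A = mu (@carg R @^-1` A `&` T).
Proof. by []. Qed.

(** These sets increase with n; for singular mu their images on the circle cover
    almost every point, by [dyadic_density_negligible].  They are not closed in
    general, whence the use of [dist_closure]. *)
Definition dense_arg (A : R) (n : nat) : set R := [set t | 0 <= t < 2 * pi /\
  forall k, (n <= k)%N ->
    ((A * 2 ^- k)%:E <= arg_measure (dyadic k (dyadic_index k t)))%E].

Definition dense_circle (A : R) (n : nat) : set (CC R) := @cis R @` dense_arg A n.

Lemma dyadic_scale (s : R) : 0 < s -> exists k : nat,
  2 ^- k.+1 <= s /\ (forall n : nat, s < 2 ^- n -> (n <= k)%N) /\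
  (s < 1 -> s < 2 ^- k).
Proof.
move=> s0; have hex : exists k, 2 ^- k.+1 <= s.
  exists (Num.truncn s^-1); rewrite invf_ple ?posrE ?exprn_gt0//.
  apply: ltW; apply: (lt_trans (truncnS_gt _)).
  by rewrite -natrX ltr_nat; exact: ltn_expl.
have kP := ex_minnP hex; case: kP => k hk kmin; exists k; split => //; split.
  move=> n sn; have := le_lt_trans hk sn.
  by rewrite ltf_pV2 ?posrE ?exprn_gt0// ltr_eXn2l ?ltr1n// ltnS.
case: k hk kmin => [|k] hk kmin s1; first by rewrite expr0 invr1.
rewrite ltNge; apply/negP => /kmin; by rewrite ltnn.
Qed.

(** Let w = cis t be within s of xi and choose k with 2^-k comparable to s.  The
    dyadic arc of length 2^-k around w stays within 6 s of (1 - s) xi and has mass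
    at least A 2^-k, so that the Poisson integral there is at least A / 36. *)
Lemma near_dense_small (c A : R) (n : nat) xi (s : R) :
  0 < c -> 36 * (1 - ln c) <= A -> T xi -> 0 < s < 1 -> s < 2 ^- n ->
  (exists2 w, dense_circle A n w & cmod (xi - w) < s) ->
  cmod (S ((1 - s)%:C * xi)) < c.
Proof.
move=> c0 hA Txi s01 sn [_ [t [/andP[t0 t1] ht] <-] xt].
have [s0 s1] := andP s01.
have [k [ks [kn sk]]] := dyadic_scale s0.
have {}sk := sk s1; have {}kn := kn n sn.
pose D : set (borelC R) := @carg R @^-1` (dyadic k (dyadic_index k t)) `&` T.
have mD : measurable D.
  apply: measurableI => //; rewrite -[X in measurable X]setTI.
  by apply: measurable_carg => //; exact: measurable_dyadic.
have D6 zeta : D zeta -> cmod (zeta - (1 - s)%:C * xi) <= 6 * s.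
  move=> [Dz Tz].
  apply: le_trans (le_cmod_dist _ _ xi) _.
  have h1 : cmod (xi - (1 - s)%:C * xi) = s.
    have -> : xi - (1 - s)%:C * xi = s%:C * xi.
      by rewrite rmorphB/= mulrBl mul1r opprB addrC subrK.
    by rewrite cmod_radial// ltW.
  have h2 : cmod (zeta - xi) <= cmod (zeta - cis t) + cmod (cis t - xi).
    exact: le_cmod_dist.
  have h3 : cmod (zeta - cis t) <= 2 * 2 ^- k.
    rewrite -{1}(cis_carg Tz); apply: le_trans (cis_lipschitz _ _) _.
    rewrite ler_wpM2l//; apply: dyadic_dist Dz _; exact: dyadic_self.
  have h4 : 2 ^- k <= 2 * s.
    rewrite (_ : 2 ^- k = 2 * 2 ^- k.+1) ?ler_wpM2l//.
    by rewrite exprS invfM mulrA mulfV ?mul1r.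
  rewrite h1; rewrite cmodB in xt; lra.
have := poisson_integral_ge mD (fun z h => h.2) Txi s01 D6.
have -> : mu D = arg_measure (dyadic k (dyadic_index k t)) by rewrite arg_measureE.
have hk := ht k kn => hP.
have c36 : 0 < (36 * s)^-1 by rewrite invr_gt0 mulr_gt0.
have : ((36 * s)^-1%:E * (A * 2 ^- k)%:E <=
    (poisson_integral mu ((1 - s)%:C * xi))%:E)%E.
  by apply: le_trans hP; rewrite lee_wpmul2l// lee_fin ltW.
rewrite -EFinM lee_fin mulrC ler_pdivrMr ?mulr_gt0// => {}hP.
rewrite cmod_singular_inner -ltr_ln ?posrE ?expR_gt0// expRK.
suff : 1 - ln c <= poisson_integral mu ((1 - s)%:C * xi) by lra.
have P0 : 0 <= poisson_integral mu ((1 - s)%:C * xi).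
  by apply: poisson_integral_ge0; rewrite cmod_radial ?subr_ge0 ?(ltW s1)// gtrBl.
rewrite leNgt; apply/negP => hlt.
have A0 : 0 < A by lra.
have k0 : 0 < 2 ^- k :> R by rewrite invr_gt0 exprn_gt0.
move: hP; set P := poisson_integral _ _ in hlt P0 * => hP.
have : A * s < P * (36 * s) by apply: lt_le_trans hP; rewrite ltr_pM2l.
nra.
Qed.

(** Let d be the distance of xi to the dense set.  By [near_dense_small] the
    radius of xi lies in the sublevel set for d < s < 2^-n, where the weight
    integrates to |ln d|^p / p up to a constant; for d = 0 the integral diverges.
    If d >= 2^-(n+1) the left-hand side is at most the constant, as d <= 2. *)
Lemma log_dist_le_radial (c A : R) (n : nat) (t : R) w :
  0 < c -> 36 * (1 - ln c) <= A -> dense_circle A n w ->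
  (`|lne (dist (cis t) (dense_circle A n))%:E| `^ p <=
   (2 * p)%:E * sublevel_radial mu p c (cis t) +
   (`|ln (2 ^- n.+1)| `^ p)%:E)%E.
Proof.
move=> c0 hA Fw; set xi := cis t; set d := dist xi _.
have Txi : T xi by exact: cmod_cis.
pose s0 : R := 2 ^- n.+1.
have s00 : 0 < s0 by rewrite invr_gt0 exprn_gt0.
have s0h : s0 <= 2^-1.
  by rewrite /s0 lef_pV2 ?posrE ?exprn_gt0// -[leLHS]expr1 ler_weXn2l// ler1n.
have s0n : s0 < 2 ^- n by rewrite ltf_pV2 ?posrE ?exprn_gt0// ltr_eXn2l ?ltr1n.
have R0 := sublevel_radial_ge0 mu p c xi.
have p20 : 0 < 2 * p by rewrite mulr_gt0.
have key d' : d <= d' -> 0 < d' < s0 ->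
    ((`|ln d'| `^ p)%:E <= (2 * p)%:E * sublevel_radial mu p c xi +
     (`|ln s0| `^ p)%:E)%E.
  move=> dd' /andP[d'0 d's0].
  have lower : ((2^-1)%:E * ((`|ln d'| `^ p - `|ln s0| `^ p) / p)%:E <=
      sublevel_radial mu p c xi)%E.
    rewrite -(integral_log_weight p_gt0 d'0 d's0); last by lra.
    rewrite -integral_itv_obnd_cbnd; last exact: (@measurable_EFin_log_weight R p).
    have mw : measurable_fun (`]d', s0] : set (measurableTypeR R))
        (fun s => (log_weight p s)%:E) by exact: measurable_EFin_log_weight.
    have w0 s : `]d', s0]%classic s -> (0 <= (log_weight p s)%:E)%E.
      rewrite /= in_itv/= => /andP[d's _].
      by rewrite lee_fin log_weight_ge0// ltW// (lt_trans d'0).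
    have h0 : (0 <= (2^-1)%:E :> \bar R)%E by rewrite lee_fin invr_ge0.
    rewrite -ge0_integralZl//.
    rewrite /sublevel_radial [leLHS]integral_indicM [leRHS]integral_indicM.
    apply: ge0_le_integral => //.
    - move=> s _; rewrite indicE mem_setE/= in_itv/=.
      case: andP => [[d's _]|_]; last by rewrite mul0e.
      rewrite mul1e mule_ge0// ?lee_fin ?invr_ge0//.
      by rewrite log_weight_ge0// ltW// (lt_trans d'0).
    - apply: emeasurable_funM; first by apply/measurable_EFinP; exact: measurable_indic.
      by apply: emeasurable_funM => //; exact: (@measurable_EFin_log_weight R p).
    - exact: measurable_sublevel_integrand.
    move=> s _; rewrite !indicE !mem_setE/= !in_itv/=.
    case: andP => [[d's ss0]|_]; last first.
      rewrite mul0e; case: andP => [[sp sl]|_]; last by rewrite mul0e.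
      rewrite mul1e lee_fin; apply: mulr_ge0 => //; apply: mulr_ge0.
        by rewrite subr_ge0 ltW.
      by apply: log_weight_ge0; exact: ltW.
    have sp : 0 < s by apply: lt_trans d's.
    have s1 : s < 1 by lra.
    have -> : cmod (S ((1 - s)%:C * xi)) < c.
      apply: (near_dense_small c0 hA Txi) => //; first by rewrite sp.
        exact: le_lt_trans ss0 s0n.
      have [v Fv hv] := dist_adherent Fw (le_lt_trans dd' d's).
      by exists v.
    rewrite sp s1 !mul1e -EFinM lee_fin mulr1 ler_wpM2r//.
      by apply: log_weight_ge0; exact: ltW.
    lra.
  have : ((2 * p)%:E * ((2^-1)%:E * ((`|ln d'| `^ p - `|ln s0| `^ p) / p)%:E) <=
      (2 * p)%:E * sublevel_radial mu p c xi)%E.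
    by rewrite lee_wpmul2l// lee_fin ltW.
  rewrite -!EFinM (_ : 2 * p * _ = `|ln d'| `^ p - `|ln s0| `^ p); last first.
    by field; rewrite gt_eqF.
  by rewrite EFinB leeBlDr.
have d_ge0 : 0 <= d by exact: dist_ge0.
have [s0d|ds0] := leP s0 d.
  have d2 : d <= 2.
    apply: le_trans (dist_le _ Fw) _; apply: le_trans (le_cmodD _ _) _.
    by case: Fw => t' _ <-; rewrite cmodN !cmod_cis.
  have d0 : 0 < d by apply: lt_le_trans s0d.
  rewrite lne_EFin// abse_EFin poweR_EFin.
  apply: (@le_trans _ _ (`|ln s0| `^ p)%:E); last first.
    by rewrite leeDr// mule_ge0// lee_fin ltW.
  rewrite lee_fin; apply: ge0_ler_powR; rewrite ?nnegrE ?(ltW p_gt0)//.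
  have l1 : ln s0 <= ln d by rewrite ler_ln ?posrE.
  have l2 : ln d <= - ln s0.
    by rewrite -lnV ?posrE// ler_ln ?posrE ?invr_gt0// (le_trans d2)// -[leLHS]invrK lef_pV2 ?posrE ?invr_gt0.
  rewrite [leRHS]ler0_norm; last by rewrite ln_le0//; lra.
  by rewrite ler_norml opprK l1 l2.
have [d0|] := ltP 0 d.
  rewrite lne_EFin// abse_EFin poweR_EFin; apply: key => //.
  by rewrite d0.
move=> dle0; have dE : d = 0 by apply/eqP; rewrite eq_le dle0 d_ge0.
suff -> : sublevel_radial mu p c xi = +oo%E.
  by rewrite gt0_muley ?lte_fin// addye// leey.
move: R0 key; case: (sublevel_radial mu p c xi) => [a| |]// a0 key.
exfalso; rewrite lee_fin in a0.
pose B : R := 2 * p * a + `|ln s0| `^ p.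
have B0 : 0 <= B by rewrite addr_ge0 ?powR_ge0// mulr_ge0// ltW.
(* finiteness would bound |ln d'|^p by [B] for all small [d'] *)
pose x : R := (B + 1) `^ p^-1.
have xp : x `^ p = B + 1.
  by rewrite /x -powRrM mulVf ?gt_eqF// powRr1// addr_ge0.
have x0 : 0 <= x by exact: powR_ge0.
pose d' : R := s0 * expR (- (x + 1)).
have d'0 : 0 < d' by rewrite mulr_gt0// expR_gt0.
have d's : d' < s0 by rewrite gtr_pMr// expR_lt1 oppr_lt0 ltr_wpDl.
have := key d'; rewrite dE ltW// d'0 d's => /(_ isT isT).
rewrite -EFinM -EFinD lee_fin -/B.
have ld : x <= `|ln d'|.
  rewrite lnM ?posrE ?expR_gt0// expRK -normrN opprD opprK.
  apply: le_trans (ler_norm _).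
  have : ln s0 <= 0 by rewrite ln_le0//; lra.
  lra.
have : x `^ p <= `|ln d'| `^ p.
  by apply: ge0_ler_powR; rewrite ?nnegrE ?(ltW p_gt0).
rewrite xp; lra.
Qed.

End sublevel_to_concentration.

(** * From sublevel integrals to concentration *)

Section concentration.
Context (R : realType) (mu : {finite_measure set (borelC R) -> \bar R}).
Context (p : R) (p_gt0 : 0 < p).
Local Open Scope complex_scope.
Local Notation T := (unit_circle R).
Local Notation S := (singular_inner mu).
Local Notation lambda := (@lebesgue_measure R).
Local Notation m := (circle_measure R).
Implicit Types (xi zeta : CC R).

Lemma closed_unit_circle : closed T.
Proof.
have -> : T = (fun z : CC R => cmod z) @^-1` [set 1] by [].
apply: closed_comp; last exact: closed_eq.
by move=> z _; exact: continuous_cmod.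
Qed.

Lemma dense_circle_sub (A : R) n : dense_circle mu A n `<=` T.
Proof. by move=> _ [t _ <-]; exact: cmod_cis. Qed.

(** Integrating [log_dist_le_radial] over the circle bounds the logarithmic
    integral.  The closure is then a null set, since the integrand is infinite at
    distance 0. *)
Lemma beurling_carleson_dense_circle (c A : R) (n : nat) w :
  0 < c -> 36 * (1 - ln c) <= A -> dense_circle mu A n w ->
  (sublevel_integral p S c < +oo)%E ->
  beurling_carleson p (closure (dense_circle mu A n)).
Proof.
move=> c0 hA Fw fin; set F := dense_circle mu A n in Fw *.
have mT := @measurable_unit_circle R.
have pi0 := pi_gt0 R.
have clF : closed (closure F) by exact: closed_closure.
have FT : closure F `<=` T.
  by rewrite closureE; apply: smallest_sub; [exact: closed_unit_circle|exact: dense_circle_sub].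
pose g (xi : borelC R) : \bar R := (`|lne (dist xi F)%:E| `^ p)%E.
have g0 xi : (0 <= g xi)%E by exact: poweR_ge0.
have mg : measurable_fun [set: borelC R] g.
  apply: (measurableT_comp (measurable_poweR p)).
  apply: measurableT_comp; first exact: abse_measurable.
  apply: (measurableT_comp (@measurable_lne R)).
  by apply/measurable_EFinP; exact: measurable_dist Fw.
have mgT : measurable_fun (T : set (borelC R)) g by exact: measurable_funTS.
have Ig : (\int[m]_(xi in T) g xi < +oo)%E.
  rewrite ge0_integral_circle_lty//.
  pose I : set (measurableTypeR R) := `[0%R, (2 * pi)%R[%classic.
  have mI : measurable I by exact: measurable_itv.
  pose rad t := sublevel_radial mu p c (cis t).
  have mrad : measurable_fun I rad.
    by apply: measurable_funTS; exact: measurable_sublevel_radial_cis.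
  have rad0 t : (0 <= rad t)%E by exact: sublevel_radial_ge0.
  have C0 : (0 <= (`|ln (2 ^- n.+1)| `^ p)%:E :> \bar R)%E.
    by rewrite lee_fin powR_ge0.
  have p0 : (0 <= (2 * p)%:E :> \bar R)%E by rewrite lee_fin mulr_ge0// ltW.
  have hA' t : (0 <= (2 * p)%:E * rad t)%E by rewrite mule_ge0.
  have hM : measurable_fun I (fun t => (2 * p)%:E * rad t)%E by exact: emeasurable_funM.
  apply: (@le_lt_trans _ _ (\int[lambda]_(t in I)
      ((2 * p)%:E * rad t + (`|ln (2 ^- n.+1)| `^ p)%:E))%E).
    apply: ge0_le_integral => //.
    - by apply: measurable_funTS; exact: (measurableT_comp mg (@measurable_cis R)).
    - exact: emeasurable_funD.
    - by move=> t _; exact: (log_dist_le_radial p_gt0 t c0 hA Fw).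
  rewrite ge0_integralD// ge0_integralZl//; apply: lte_add_pinfty.
    apply: lte_mul_pinfty => //.
    by move: fin; rewrite sublevel_integral_polar.
  rewrite integral_cst//= lebesgue_measure_itv/= lte_fin mulr_gt0//.
  by rewrite -EFinD -EFinM ltry.
split; [exact: clF|exact: FT| |].
- have ig : m.-integrable (T : set (borelC R)) g.
    apply/integrableP; split => //.
    by under eq_integral do rewrite gee0_abs//.
  have := integrable_ae mT ig; rewrite /almost_everywhere/= => ng.
  apply: measure_negligible; first exact: closed_measurableC.
  apply: negligibleS ng => xi clxi /= /(_ (FT _ clxi)).
  have d0 : dist xi F = 0.
    apply/eqP; rewrite eq_le dist_ge0 andbT -(dist_closure _ Fw).
    by rewrite (le_trans (dist_le xi clxi))// subrr (_ : cmod 0 = 0)//; exact: Normc.normc0.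
  by rewrite /g d0 (_ : `|lne 0%R%:E|%E = +oo%E) ?poweRyr ?gt_eqF//= lexx.
- by under eq_integral do rewrite (dist_closure _ Fw).
Qed.

Theorem sublevel_concentrated (c : R) : 0 < c ->
  mu T != 0%E -> singular mu m ->
  (sublevel_integral p S c < +oo)%E ->
  exists2 E : nat -> set (CC R), (forall n, beurling_carleson p (E n)) &
    concentrated mu (\bigcup_n E n).
Proof.
move=> c0 muT [N [mN N0 muN]] fin; have pi0 := pi_gt0 R.
have mT := @measurable_unit_circle R.
(* above the threshold of [near_dense_small], and positive also for large [c] *)
pose A : R := 36 * (1 - ln c) + 36 * `|1 - ln c| + 1.
have hA : 36 * (1 - ln c) <= A by rewrite /A -addrA lerDl addr_ge0// mulr_ge0.
have A0 : 0 < A.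
  by rewrite /A; have := ler_norm (- (1 - ln c)); rewrite normrN; lra.
pose N' : set (measurableTypeR R) := @cis R @^-1` N `&` `[0%R, (2 * pi)%R[%classic.
have mN' : measurable N'.
  apply: measurableI => //; rewrite -[X in measurable X]setTI.
  exact: measurable_cis.
have lN' : lambda N' = 0%E.
  move: N0; rewrite /circle_measure => /eqP; rewrite mule_eq0 => /orP[|/eqP//].
  by rewrite eqe invr_eq0 mulf_eq0 (gt_eqF pi0) orbF pnatr_eq0.
have nN' : arg_measure mu (~` N') = 0%E.
  rewrite arg_measureE; apply/eqP; rewrite -measure_le0 -muN.
  apply: le_measure; rewrite ?inE.
  - apply: measurableI => //; rewrite -[X in measurable X]setTI.
    by apply: measurable_carg => //; exact: measurableC.
  - exact: measurableC.
  move=> z [nz Tz] Nz; apply: nz; split; first by rewrite /= cis_carg.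
  by rewrite /= in_itv/= carg_itv.
have [M [mM M0 BM]] := dyadic_density_negligible A0 mN' lN' nN'.
pose F n := dense_circle mu A n.
have outside z n0 : T z -> (forall n, ~ F (n + n0)%N z) -> M (carg z).
  move=> Tz nF; apply: BM => /=; have /andP[z0 z1] := carg_itv z; split=> // n.
  apply: contrapT => h; apply: (nF n); exists (carg z); last exact: cis_carg.
  split; first by rewrite z0 z1.
  move=> k nk; rewrite leNgt; apply/negP => hk; apply: h; exists k => //.
  exact: leq_trans (leq_addr _ _) nk.
have null (B : set (borelC R)) : measurable B -> B `<=` T ->
    (forall z, B z -> M (carg z)) -> mu B = 0%E.
  move=> mB BT hB; apply/eqP; rewrite -measure_le0 -M0 arg_measureE.
  apply: le_measure; rewrite ?inE//.
    apply: measurableI => //; rewrite -[X in measurable X]setTI.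
    exact: measurable_carg.
  by move=> z Bz; split; [exact: hB|exact: BT].
(* the empty set does not qualify, so the sequence starts at a nonempty term *)
have [n0 [w Fw]] : exists n0 w, F n0 w.
  apply: contrapT => nF; move/eqP: muT; apply; apply: null => // z Tz.
  by apply: (outside z 0%N Tz) => n Fz; apply: nF; exists (n + 0)%N, z.
have Fmono n n' : (n <= n')%N -> F n `<=` F n'.
  move=> nn' _ [t [t01 ht] <-]; exists t => //; split => // k nk; apply: ht.
  exact: leq_trans nk.
exists (fun n => closure (F (n + n0)%N)).
  move=> n; apply: (beurling_carleson_dense_circle (w := w) c0 hA) => //.
  by apply: Fmono Fw; exact: leq_addl.
apply: null.
- apply: measurableD => //; apply: bigcup_measurable => n _.
  by apply: closed_measurableC; exact: closed_closure.
- by move=> z [].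
move=> z [Tz nz]; apply: (outside z n0 Tz) => n Fz; apply: nz; exists n => //.
exact: subset_closure.
Qed.

End concentration.

(** * The chain of implications *)

Theorem theorem1p3 (R : realType) (p : R)
    (mu : {finite_measure set (borelC R) -> \bar R})
    (p_gt0 : 0 < p)
    (mu_circle : mu (~` unit_circle R) = 0%E)
    (mu_neq0 : mu (unit_circle R) != 0%E)
    (mu_singular : singular mu (circle_measure R)) :
  let S := singular_inner mu in
  let cond1 := exists2 E : set R[i]^o,
    beurling_carleson p E & measure_support mu `<=` E in
  let cond2 := finite_entropy p S in
  let cond3 := forall c : R, 0 < c < 1 -> (sublevel_integral p S c < +oo)%E in
  let cond4 := exists2 c : R, 0 < c < 1 & (sublevel_integral p S c < +oo)%E in
  let cond5 := exists2 E : nat -> set R[i]^o,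
    (forall n, beurling_carleson p (E n)) &
    concentrated mu (\bigcup_n E n) in
  [/\ cond1 -> cond2, cond2 -> cond3, cond3 -> cond4 & cond4 -> cond5].
Proof.
move=> S cond1 cond2 cond3 cond4 cond5; split.
- by move=> [E bcE sE]; exact: (support_finite_entropy p_gt0 mu_neq0 bcE sE).
- by move=> fe c c01; exact: entropy_sublevel_finite.
- move=> h; exists 2^-1; last apply: h;
    by rewrite invr_gt0 ltr0n invf_lt1 ?ltr1n ?ltr0n.
- move=> [c /andP[c0 _] fin].
  exact: (sublevel_concentrated p_gt0 c0 mu_neq0 mu_singular fin).
Qed.
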